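(* Let $\mathfrak{a}_r$ be a rank $r$ detecting subalgebra, where $r\ge 2$. Then $T(\mathfrak{a}_r)\cong\mathbb{Z}\times\mathbb{Z}_2$, and $T(\mathfrak{a}_r)$ is generated by (the classes of) $\Omega^1(k_{ev})$ and $k_{od}$.
   Context: $k$ is an algebraically closed field of characteristic $0$. All modules are $\mathbb{Z}_2$-graded (supermodules), and homomorphisms are homogeneous of degree $\overline 0$. Detecting subalgebras: $\mathfrak{q}(1)$ has even basis $t$, odd basis $e$, with only nonzero bracket $[e,e]=2t$; $\mathfrak{sl}(1|1)$ has even basis $t$, odd basis $x,y$, with only nonzero bracket $[x,y]=[y,x]=t$. Put $\mathfrak{e}_m=\mathfrak{q}(1)\times\cdots\times\mathfrak{q}(1)$ ($m$ factors) and $\mathfrak{f}_n=\mathfrak{sl}(1|1)\times\cdots\times\mathfrak{sl}(1|1)$ ($n$ factors). A detecting subalgebra is a Lie superalgebra $\mathfrak{a}$ isomorphic to some $\mathfrak{e}_m$ or $\mathfrak{f}_n$; its rank is $\dim\mathfrak{a}_{\overline 1}$, so $\mathfrak{e}_m$ has rank $m$ and $\mathfrak{f}_n$ has rank $2n$. $\mathfrak{a}_r$ denotes one of rank $r$, i.e. $\mathfrak{e}_r$, or $\mathfrak{f}_{r/2}$ when $r$ is even. For a Lie superalgebra $\mathfrak{g}=\mathfrak{g}_{\overline 0}\oplus\mathfrak{g}_{\overline 1}$, $\mathcal{F}=\mathcal{F}_{(\mathfrak{g},\mathfrak{g}_{\overline 0})}$ is the full subcategory of $\mathfrak{g}$-supermodules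 whose objects are the finite dimensional supermodules that are completely reducible over $\mathfrak{g}_{\overline 0}$; it has enough projectives and is self-injective. $k_{ev}$ and $k_{od}$ are the trivial one-dimensional supermodules concentrated in degree $\overline 0$ and $\overline 1$ respectively. $\Omega^1(M)$ is the kernel of the projective cover of $M$ in $\mathcal F$. $M\in\mathcal F$ is endotrivial if $M\otimes M^*\cong k_{ev}\oplus P$ with $P$ projective in $\mathcal F$. The stable module category $\mathrm{Stmod}(\mathcal{F})$ has the same objects as $\mathcal F$, and morphisms are those of $\mathcal{F}$ modulo $f\sim g$ if $f-g$ factors through a projective module in $\mathcal{F}$. $T(\mathfrak{g})$ is the set of isomorphism classes $[M]$ in $\mathrm{Stmod}(\mathcal{F})$ of endotrivial modules, an abelian group under $[M]+[N]=[M\otimes N]$. $\mathbb{Z}_2$ is the group of order two. *)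

(* Defs.v *)
From HB Require Import structures.
From mathcomp Require Import all_boot all_order all_algebra.

Set Implicit Arguments.
Unset Strict Implicit.
Unset Printing Implicit Defensive.

Import GRing.Theory.
Local Open Scope ring_scope.

(* Z_2-degrees are booleans (false = even, true = odd), added with (+), so     *)
(* that the sign (-1)^{ij} is (-1) ^+ (i && j).                                *)

Lemma linfun_lin (k : fieldType) (V W : vectType k) (f : V -> W) :
  linear f -> linfun f =1 f.
Proof.
move=> lf; pose h := GRing.isLinear.Build k V W _ f lf.
pose F : {linear V -> W} := HB.pack f h.
by move=> v; rewrite -[linfun f]/(linfun F) lfunE.
Qed.

Section BilinearMaps.
Variables (k : fieldType) (U V W : vectType k).

Definition bilfun (b : U -> V -> W) : 'Hom(U, 'Hom(V, W)) :=
  linfun (fun u => linfun (b u)).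

Lemma bilfunE (b : U -> V -> W) :
  (forall u, linear (b u)) -> (forall v, linear (b^~ v)) ->
  forall u v, bilfun b u v = b u v.
Proof.
move=> br bl u v; rewrite /bilfun linfun_lin ?linfun_lin // => c x y.
apply/lfunP => z; rewrite add_lfunE scale_lfunE !linfun_lin //.
exact: bl.
Qed.

End BilinearMaps.

Section SuperSpaces.
Variable k : fieldType.

Record superspace := Superspace {
  car :> vectType k;
  gr : bool -> {vspace car};
  gr_add : (gr false + gr true)%VS = fullv;
  gr_cap : (gr false :&: gr true)%VS = 0%VS }.

Definition prj (V : superspace) (i : bool) : 'End(V) :=
  daddv_pi (gr V i) (gr V (~~ i)).

(* v |-> (-1)^{i |v|} v *)
Definition sgn (V : superspace) (i : bool) : 'End(V) :=
  if i then prj V false - prj V true else \1%VF.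

Lemma gr_capb (V : superspace) i : (gr V i :&: gr V (~~ i))%VS = 0%VS.
Proof. by case: i; rewrite /= ?gr_cap // capvC gr_cap. Qed.

Lemma gr_addb (V : superspace) i : (gr V i + gr V (~~ i))%VS = fullv.
Proof. by case: i; rewrite /= ?gr_add // addvC gr_add. Qed.

Lemma memv_prj (V : superspace) i (v : V) : prj V i v \in gr V i.
Proof. exact: memv_pi. Qed.

Lemma prj_id (V : superspace) i (v : V) : v \in gr V i -> prj V i v = v.
Proof. exact/daddv_pi_id/gr_capb. Qed.

Lemma prj_add (V : superspace) (v : V) : prj V false v + prj V true v = v.
Proof. by apply: daddv_pi_add; rewrite ?gr_cap // (gr_addb V false) memvf. Qed.

Lemma prj_neg (V : superspace) i (v : V) : v \in gr V (~~ i) -> prj V i v = 0.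
Proof.
move=> h; have := prj_add v; case: i h => /= h; rewrite (prj_id h).
  by move/(canRL (addKr _)); rewrite addNr.
by move/(canRL (addrK _)); rewrite subrr.
Qed.

Lemma prj_gr (V : superspace) i j (v : V) :
  v \in gr V i -> prj V j v = if i == j then v else 0.
Proof.
case: eqP => [<-|/eqP ij] h; first exact: prj_id.
by apply: prj_neg; case: i j ij h => -[].
Qed.

Lemma prj_comp (V : superspace) i j :
  (prj V i \o prj V j)%VF = if i == j then prj V i else 0.
Proof.
apply/lfunP => v; rewrite comp_lfunE (prj_gr _ (memv_prj _ _)) eq_sym.
by case: eqP => [->|]; rewrite ?lfunE.
Qed.

Lemma sgn_gr (V : superspace) i j (v : V) :
  v \in gr V j -> sgn V i v = (-1) ^+ (i && j) *: v.
Proof.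
case: i => /= h; last by rewrite lfunE scale1r.
rewrite add_lfunE opp_lfunE !(prj_gr _ h).
by case: (j); rewrite /= ?sub0r ?scaleN1r // subr0 scale1r.
Qed.

Lemma prj_ext (V W : superspace) (f g : 'Hom(V, W)) :
  (forall i v, v \in gr V i -> f v = g v) -> f = g.
Proof.
move=> h; apply/lfunP => v.
by rewrite -(prj_add v) !linearD /= !(h _ _ (memv_prj _ _)).
Qed.

Section FromProjections.
Variables (V : vectType k) (P : bool -> 'End(V)).
Hypothesis P_comp : forall i j, (P i \o P j)%VF = if i == j then P i else 0.
Hypothesis P_add : P false + P true = \1%VF.

Lemma limg_projP i v : reflect (P i v = v) (v \in limg (P i)).
Proof.
apply: (iffP idP) => [/memv_imgP[w _ ->]|<-]; last exact: memv_img (memvf _).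
by rewrite -comp_lfunE P_comp eqxx.
Qed.

Fact proj_gr_add : (limg (P false) + limg (P true))%VS = fullv.
Proof.
apply/eqP; rewrite eqEsubv subvf; apply/subvP => v _.
have -> : v = P false v + P true v by rewrite -add_lfunE P_add lfunE.
by rewrite memv_add // memv_img // memvf.
Qed.

Fact proj_gr_cap : (limg (P false) :&: limg (P true))%VS = 0%VS.
Proof.
apply/eqP; rewrite -subv0; apply/subvP => v; rewrite memv_cap.
case/andP=> /limg_projP <- /limg_projP <-.
by rewrite -comp_lfunE P_comp lfunE mem0v.
Qed.

Definition proj_superspace : superspace :=
  @Superspace V (fun i => limg (P i)) proj_gr_add proj_gr_cap.

End FromProjections.
End SuperSpaces.

Arguments gr {k} _ _.
Arguments prj {k} _ _.
Arguments sgn {k} _ _ : simpl never.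

Section LieSuperalgebras.
Variable k : fieldType.

Record lieSuper := LieSuper {
  lie_space :> superspace k;
  br : 'Hom(lie_space, 'End(lie_space));
  br_gr : forall i j x y, x \in gr lie_space i -> y \in gr lie_space j ->
    br x y \in gr lie_space (i (+) j);
  br_skew : forall i j x y, x \in gr lie_space i -> y \in gr lie_space j ->
    br x y = - ((-1) ^+ (i && j) *: br y x);
  br_jacobi : forall i j x y z, x \in gr lie_space i -> y \in gr lie_space j ->
    br x (br y z) = br (br x y) z + (-1) ^+ (i && j) *: br y (br x z) }.

Definition lie_iso (g h : lieSuper) : Prop :=
  exists f : 'Hom(g, h),
    [/\ lker f = 0%VS, limg f = fullv,
        forall i x, x \in gr g i -> f x \in gr h i
      & forall x y, f (br g x y) = br h (f x) (f y)].

(* The superspace with even part V and odd part W. *)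
Section PairSpace.
Variables V W : vectType k.

Definition pair_proj_fun (i : bool) (u : V * W) : V * W :=
  if i then (0, u.2) else (u.1, 0).
Definition pair_proj i : 'End((V * W)%type) := linfun (pair_proj_fun i).

Fact pair_projE i u : pair_proj i u = pair_proj_fun i u.
Proof.
by rewrite linfun_lin //; case: i => c [x1 x2] [y1 y2];
  congr (_, _); rewrite /= ?scaler0 ?addr0.
Qed.

Fact pair_proj_comp i j :
  (pair_proj i \o pair_proj j)%VF = if i == j then pair_proj i else 0.
Proof.
by apply/lfunP => u; rewrite comp_lfunE !pair_projE;
  case: i j => -[] /=; rewrite ?lfunE ?pair_projE.
Qed.

Fact pair_proj_add : pair_proj false + pair_proj true = \1%VF.
Proof.
apply/lfunP => -[x y]; rewrite add_lfunE !pair_projE lfunE /=.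
by congr (_, _); rewrite /= ?addr0 ?add0r.
Qed.

Definition pair_space : superspace k :=
  proj_superspace pair_proj_comp pair_proj_add.

Lemma pair_grE (i : bool) (u : V * W) :
  u \in gr pair_space i -> u = pair_proj_fun i u.
Proof. by move/(limg_projP pair_proj_comp) => {1}<-; rewrite pair_projE. Qed.

End PairSpace.

(* q(1): (a, b) stands for a t + b e. *)
Section Q1.
Let V := pair_space k^o k^o.
Definition q1_br_fun (u v : V) : V := (u.2 * v.2 *+ 2, 0).
Definition q1_br : 'Hom(V, 'End(V)) := bilfun q1_br_fun.

Fact q1_brE u v : q1_br u v = q1_br_fun u v.
Proof.
rewrite bilfunE // => w c x y; congr (_, _);
  rewrite /= ?scaler0 ?addr0 // -scalerMnr -mulrnDl; congr (_ *+ 2).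
  by rewrite mulrDr -scalerAr.
by rewrite mulrDl -scalerAl.
Qed.

Fact q1_br_gr i j x y : x \in gr V i -> y \in gr V j ->
  q1_br x y \in gr V (i (+) j).
Proof.
move=> /pair_grE-> /pair_grE->; apply/(limg_projP (@pair_proj_comp _ _)).
rewrite q1_brE pair_projE.
by case: i j => -[]; rewrite /q1_br_fun /= ?mulr0 ?mul0r ?mul0rn.
Qed.

Fact q1_br_skew i j x y : x \in gr V i -> y \in gr V j ->
  q1_br x y = - ((-1) ^+ (i && j) *: q1_br y x).
Proof.
move=> /pair_grE-> /pair_grE->; rewrite !q1_brE.
case: i j => -[]; rewrite /q1_br_fun /= ?mulr0 ?mul0r ?mul0rn ?expr1 ?expr0;
  rewrite ?scaler0 ?oppr0 //.
by rewrite scaleN1r opprK mulrC.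
Qed.

Fact q1_br_jacobi i j x y z : x \in gr V i -> y \in gr V j ->
  q1_br x (q1_br y z) =
  q1_br (q1_br x y) z + (-1) ^+ (i && j) *: q1_br y (q1_br x z).
Proof.
move=> _ _; rewrite !q1_brE /q1_br_fun /= !mulr0 mul0r mul0rn.
by rewrite scaler0 addr0.
Qed.

Definition q1 : lieSuper := LieSuper q1_br_gr q1_br_skew q1_br_jacobi.
End Q1.

(* sl(1|1): (a, (b, c)) stands for a t + b x + c y. *)
Section SL11.
Let V := pair_space k^o (k^o * k^o)%type.
Definition sl11_br_fun (u v : V) : V :=
  (u.2.1 * v.2.2 + u.2.2 * v.2.1, 0).
Definition sl11_br : 'Hom(V, 'End(V)) := bilfun sl11_br_fun.

Fact sl11_brE u v : sl11_br u v = sl11_br_fun u v.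
Proof.
rewrite bilfunE // => w c x y; congr (_, _);
  rewrite /= ?scaler0 ?addr0 // scalerDr addrACA; congr (_ + _);
  by rewrite ?mulrDr -?scalerAr // mulrDl -?scalerAl.
Qed.

Fact sl11_br_gr i j x y : x \in gr V i -> y \in gr V j ->
  sl11_br x y \in gr V (i (+) j).
Proof.
move=> /pair_grE-> /pair_grE->; apply/(limg_projP (@pair_proj_comp _ _)).
rewrite sl11_brE pair_projE.
by case: i j => -[]; rewrite /sl11_br_fun /= ?mulr0 ?mul0r ?addr0.
Qed.

Fact sl11_br_skew i j x y : x \in gr V i -> y \in gr V j ->
  sl11_br x y = - ((-1) ^+ (i && j) *: sl11_br y x).
Proof.
move=> /pair_grE-> /pair_grE->; rewrite !sl11_brE.
case: i j => -[]; rewrite /sl11_br_fun /= ?mulr0 ?mul0r ?addr0 ?expr1 ?expr0;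
  rewrite ?scaler0 ?oppr0 //.
by rewrite scaleN1r opprK addrC; congr (_ + _, _); rewrite mulrC.
Qed.

Fact sl11_br_jacobi i j x y z : x \in gr V i -> y \in gr V j ->
  sl11_br x (sl11_br y z) =
  sl11_br (sl11_br x y) z + (-1) ^+ (i && j) *: sl11_br y (sl11_br x z).
Proof.
move=> _ _; rewrite !sl11_brE /sl11_br_fun /= !mulr0 !mul0r !addr0.
by rewrite scaler0 addr0.
Qed.

Definition sl11 : lieSuper := LieSuper sl11_br_gr sl11_br_skew sl11_br_jacobi.
End SL11.

(* The direct product of n copies of g. *)
Section Power.
Variables (n : nat) (g : lieSuper).

Definition pow_proj_fun (i : bool) (u : {ffun 'I_n -> g}) : {ffun 'I_n -> g} :=
  [ffun a => prj g i (u a)].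
Definition pow_proj i : 'End({ffun 'I_n -> g}) := linfun (pow_proj_fun i).

Fact pow_projE i u : pow_proj i u = pow_proj_fun i u.
Proof.
by rewrite linfun_lin // => c x y; apply/ffunP => a; rewrite !ffunE linearP.
Qed.

Fact pow_proj_comp i j :
  (pow_proj i \o pow_proj j)%VF = if i == j then pow_proj i else 0.
Proof.
apply/lfunP => u; rewrite comp_lfunE !pow_projE; apply/ffunP => a.
rewrite !ffunE -comp_lfunE prj_comp.
by case: eqP => _; rewrite ?pow_projE ?zero_lfunE ?ffunE.
Qed.

Fact pow_proj_add : pow_proj false + pow_proj true = \1%VF.
Proof.
apply/lfunP => u; rewrite add_lfunE !pow_projE lfunE.
by apply/ffunP => a; rewrite !ffunE prj_add.
Qed.

Definition pow_space : superspace k :=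
  proj_superspace pow_proj_comp pow_proj_add.
Let V := pow_space.

Fact pow_grP i (u : {ffun 'I_n -> g}) :
  (u \in gr V i) <-> (forall a, u a \in gr g i).
Proof.
split=> [/(limg_projP pow_proj_comp) <- a|h].
  by rewrite pow_projE ffunE memv_prj.
apply/(limg_projP pow_proj_comp); rewrite pow_projE.
by apply/ffunP => a; rewrite ffunE prj_id.
Qed.

Definition pow_br_fun (u v : {ffun 'I_n -> g}) : {ffun 'I_n -> g} :=
  [ffun a => br g (u a) (v a)].
Definition pow_br : 'Hom(V, 'End(V)) := bilfun pow_br_fun.

Fact pow_brE u v : pow_br u v = pow_br_fun u v.
Proof.
rewrite bilfunE // => w c x y; apply/ffunP => a; rewrite !ffunE linearP //.
by rewrite add_lfunE scale_lfunE.
Qed.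

Fact pow_br_gr i j x y : x \in gr V i -> y \in gr V j ->
  pow_br x y \in gr V (i (+) j).
Proof.
move=> /pow_grP hx /pow_grP hy; rewrite pow_brE; apply/pow_grP => a.
by rewrite ffunE br_gr.
Qed.

Fact pow_br_skew i j x y : x \in gr V i -> y \in gr V j ->
  pow_br x y = - ((-1) ^+ (i && j) *: pow_br y x).
Proof.
move=> /pow_grP hx /pow_grP hy; rewrite !pow_brE; apply/ffunP => a.
by rewrite !ffunE (br_skew (hx a) (hy a)).
Qed.

Fact pow_br_jacobi i j x y z : x \in gr V i -> y \in gr V j ->
  pow_br x (pow_br y z) =
  pow_br (pow_br x y) z + (-1) ^+ (i && j) *: pow_br y (pow_br x z).
Proof.
move=> /pow_grP hx /pow_grP hy; rewrite !pow_brE; apply/ffunP => a.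
by rewrite !ffunE (br_jacobi _ (hx a) (hy a)).
Qed.

Definition lie_pow : lieSuper := LieSuper pow_br_gr pow_br_skew pow_br_jacobi.
End Power.

Definition e_alg (m : nat) : lieSuper := lie_pow m q1.
Definition f_alg (n : nat) : lieSuper := lie_pow n sl11.

Definition detecting (a : lieSuper) : Prop :=
  (exists m, lie_iso a (e_alg m)) \/ (exists n, lie_iso a (f_alg n)).

Definition rank (a : lieSuper) : nat := \dim (gr a true).

End LieSuperalgebras.

Arguments br {k} _.
Arguments e_alg {k} m.
Arguments f_alg {k} n.

Section Supermodules.
Variables (k : fieldType) (g : lieSuper k).

(* Finite dimensional g-supermodules. *)
Record smod := Smod {
  mod_space :> superspace k;
  act : 'Hom(g, 'End(mod_space));
  act_gr : forall i j x v, x \in gr g i -> v \in gr mod_space j ->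
    act x v \in gr mod_space (i (+) j);
  act_br : forall i j x y v, x \in gr g i -> y \in gr g j ->
    act (br g x y) v = act x (act y v) - (-1) ^+ (i && j) *: act y (act x v) }.

Definition is_hom (M N : smod) (f : 'Hom(M, N)) : Prop :=
  (forall i v, v \in gr M i -> f v \in gr N i) /\
  (forall x v, f (act M x v) = act N x (f v)).

Definition smod_iso (M N : smod) : Prop :=
  exists f : 'Hom(M, N), [/\ is_hom f, lker f = 0%VS & limg f = fullv].

Lemma act_linear_l (M : smod) c x y v :
  act M (c *: x + y) v = c *: act M x v + act M y v.
Proof. by rewrite linearP add_lfunE scale_lfunE. Qed.

Lemma act_0l (M : smod) v : act M 0 v = 0.
Proof. by rewrite linear0 zero_lfunE. Qed.

Lemma act_mod_gr (M : smod) i x v : x \in gr g i ->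
  sgn M true (act M x v) = (-1) ^+ i *: act M x (sgn M true v).
Proof.
move=> hx; rewrite -(prj_add v) !linearD /=.
rewrite !(sgn_gr _ (memv_prj _ _)) !(sgn_gr _ (act_gr hx (memv_prj _ _))).
rewrite !linearZ /= !scalerA.
by case: i {hx}; rewrite /= ?expr0 ?expr1 ?expr2 ?mulrNN ?mulr1 ?mul1r.
Qed.

(* s^i y = (-1)^{ij} y s^i on M, for y of degree j *)
Lemma sgn_act (M : smod) i j y v : y \in gr g j ->
  sgn M i (act M y v) = (-1) ^+ (i && j) *: act M y (sgn M i v).
Proof.
case: i => hy; first by rewrite (act_mod_gr _ hy).
by rewrite !lfunE /= scale1r.
Qed.

Lemma act_sgn (M : smod) i j y v : y \in gr g j ->
  act M y (sgn M i v) = (-1) ^+ (i && j) *: sgn M i (act M y v).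
Proof. by move/sgn_act->; rewrite scalerA -expr2 sqrr_sign scale1r. Qed.

Lemma sgn_sgn (V : superspace k) i j v :
  sgn V i (sgn V j v) = sgn V (i (+) j) v.
Proof.
rewrite -(prj_add v) !linearD /= !(sgn_gr _ (memv_prj _ _)) !linearZ /=.
rewrite !(sgn_gr _ (memv_prj _ _)) !scalerA -!exprD.
by case: i j => -[]; rewrite /= ?expr2 ?mulrNN ?mulr1.
Qed.

(* The trivial module, in degree d. *)
Section Trivial.
Variable d : bool.

Definition triv_gr (i : bool) : {vspace k^o} := if i == d then fullv else 0%VS.
Fact triv_gr_add : (triv_gr false + triv_gr true)%VS = fullv.
Proof. by rewrite /triv_gr; case: (d); rewrite ?addv0 ?add0v. Qed.
Fact triv_gr_cap : (triv_gr false :&: triv_gr true)%VS = 0%VS.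
Proof. by rewrite /triv_gr; case: (d); rewrite ?capv0 ?cap0v. Qed.
Definition triv_space := Superspace triv_gr_add triv_gr_cap.

Fact triv_act_gr i j x v : x \in gr g i -> v \in gr triv_space j ->
  (0 : 'Hom(g, 'End(triv_space))) x v \in gr triv_space (i (+) j).
Proof. by move=> _ _; rewrite !lfunE mem0v. Qed.
Fact triv_act_br i j x y (v : triv_space) : x \in gr g i -> y \in gr g j ->
  (0 : 'Hom(g, 'End(triv_space))) (br g x y) v =
  (0 : 'Hom(g, 'End(triv_space))) x ((0 : 'Hom(g, 'End(triv_space))) y v)
  - (-1) ^+ (i && j) *:
    (0 : 'Hom(g, 'End(triv_space))) y ((0 : 'Hom(g, 'End(triv_space))) x v).
Proof. by move=> _ _; rewrite !lfunE /= scaler0 subr0. Qed.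
Definition triv : smod := Smod triv_act_gr triv_act_br.
End Trivial.

Definition k_ev : smod := triv false.
Definition k_od : smod := triv true.

Section DirectSum.
Variables M N : smod.

Definition dsum_proj_fun (i : bool) (u : M * N) : M * N :=
  (prj M i u.1, prj N i u.2).
Definition dsum_proj i : 'End((M * N)%type) := linfun (dsum_proj_fun i).

Fact dsum_projE i u : dsum_proj i u = dsum_proj_fun i u.
Proof.
by rewrite linfun_lin // => c x y; congr (_, _); rewrite linearP.
Qed.

Fact dsum_proj_comp i j :
  (dsum_proj i \o dsum_proj j)%VF = if i == j then dsum_proj i else 0.
Proof.
apply/lfunP => u; rewrite comp_lfunE !dsum_projE /dsum_proj_fun /=.
rewrite -!comp_lfunE !prj_comp.
by case: eqP => _; rewrite ?dsum_projE ?zero_lfunE.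
Qed.

Fact dsum_proj_add : dsum_proj false + dsum_proj true = \1%VF.
Proof.
apply/lfunP => -[x y]; rewrite add_lfunE !dsum_projE lfunE /=.
by congr (_, _); rewrite /= prj_add.
Qed.

Definition dsum_space : superspace k :=
  proj_superspace dsum_proj_comp dsum_proj_add.
Let V := dsum_space.

Fact dsum_grP i (u : M * N) :
  (u \in gr V i) <-> (u.1 \in gr M i /\ u.2 \in gr N i).
Proof.
split=> [/(limg_projP dsum_proj_comp) <-|[h1 h2]].
  by rewrite dsum_projE /= !memv_prj.
apply/(limg_projP dsum_proj_comp); rewrite dsum_projE /dsum_proj_fun.
by rewrite !prj_id //; case: (u).
Qed.

Definition dsum_act_fun (x : g) (u : M * N) : M * N :=
  (act M x u.1, act N x u.2).
Definition dsum_act : 'Hom(g, 'End(V)) := bilfun dsum_act_fun.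

Fact dsum_actE x u : dsum_act x u = dsum_act_fun x u.
Proof.
rewrite bilfunE // => w c y z; congr (_, _) => /=; rewrite linearP //;
by rewrite add_lfunE scale_lfunE.
Qed.

Fact dsum_act_gr i j x v : x \in gr g i -> v \in gr V j ->
  dsum_act x v \in gr V (i (+) j).
Proof.
move=> hx /dsum_grP[h1 h2]; rewrite dsum_actE; apply/dsum_grP.
by rewrite !act_gr.
Qed.

Fact dsum_act_br i j x y v : x \in gr g i -> y \in gr g j ->
  dsum_act (br g x y) v =
  dsum_act x (dsum_act y v) - (-1) ^+ (i && j) *: dsum_act y (dsum_act x v).
Proof.
move=> hx hy; rewrite !dsum_actE; congr (_, _); rewrite /=;
exact: (act_br _ hx hy).
Qed.

Definition dsum : smod := Smod dsum_act_gr dsum_act_br.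
End DirectSum.

(* M^*: a functional f of degree j vanishes on the part of M of degree 1 - j,  *)
(* and (x.f)(v) = - (-1)^{|x||f|} f(x.v), where f \o sgn M i = (-1)^{i|f|} f.  *)
Section Dual.
Variable M : smod.
Let D : vectType k := 'Hom(M, k^o).

Definition dual_proj_fun (i : bool) (f : D) : D := (f \o prj M i)%VF.
Definition dual_proj i : 'End(D) := linfun (dual_proj_fun i).

Fact dual_projE i u : dual_proj i u = dual_proj_fun i u.
Proof.
rewrite linfun_lin // => c x y.
by rewrite /dual_proj_fun comp_lfunDl comp_lfunZl.
Qed.

Fact dual_proj_comp i j :
  (dual_proj i \o dual_proj j)%VF = if i == j then dual_proj i else 0.
Proof.
apply/lfunP => u; rewrite comp_lfunE !dual_projE /dual_proj_fun.
rewrite -comp_lfunA prj_comp eq_sym.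
by case: eqP => [->|_]; rewrite ?dual_projE // comp_lfun0r lfunE.
Qed.

Fact dual_proj_add : dual_proj false + dual_proj true = \1%VF.
Proof.
apply/lfunP => f; rewrite add_lfunE !dual_projE lfunE -comp_lfunDr /=.
by apply/lfunP => v; rewrite comp_lfunE add_lfunE prj_add.
Qed.

Definition dual_space : superspace k :=
  proj_superspace dual_proj_comp dual_proj_add.

Fact dual_grP i (f : D) :
  (f \in gr dual_space i) <-> (forall v, v \in gr M (~~ i) -> f v = 0).
Proof.
split=> [/(limg_projP dual_proj_comp) <- v hv|h].
  by rewrite dual_projE comp_lfunE prj_neg // linear0.
apply/(limg_projP dual_proj_comp); rewrite dual_projE; apply/lfunP => v.
rewrite comp_lfunE -[in RHS](prj_add v) linearD /=.
by case: i h => h; rewrite (h _ (memv_prj _ _)) ?add0r ?addr0.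
Qed.

Definition dual_act_fun (x : g) (f : D) : D :=
  - \sum_(i : bool) (f \o (sgn M i \o act M (prj g i x)))%VF.
Definition dual_act : 'Hom(g, 'End(dual_space)) := bilfun dual_act_fun.

Fact dual_act_funE x f v : dual_act_fun x f v =
  - (f (sgn M true (act M (prj g true x) v))
     + f (sgn M false (act M (prj g false x) v))).
Proof. by rewrite /dual_act_fun big_bool opp_lfunE add_lfunE !comp_lfunE. Qed.

Fact dual_actE x f : dual_act x f = dual_act_fun x f.
Proof.
rewrite bilfunE // => u c y z; apply/lfunP => v;
  rewrite add_lfunE scale_lfunE !dual_act_funE.
  rewrite !add_lfunE !scale_lfunE scalerN -opprD scalerDr.
  by congr (- _); rewrite addrACA.
rewrite scalerN -opprD scalerDr addrACA; congr (- _).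
by congr (_ + _); rewrite [prj _ _ _]linearP act_linear_l !linearP.
Qed.

Lemma dual_act_gr_fun i x f v : x \in gr g i ->
  dual_act x f v = - f (sgn M i (act M x v)).
Proof.
move=> hx; rewrite dual_actE dual_act_funE !(prj_gr _ hx).
by case: i hx => hx; rewrite /= act_0l !linear0 ?addr0 ?add0r.
Qed.

Lemma dual_act_homE i j x (f : D) v : x \in gr g i -> f \in gr dual_space j ->
  dual_act x f v = - ((-1) ^+ (i && j) * f (act M x v)).
Proof.
move=> hx hf; rewrite (dual_act_gr_fun _ _ hx); congr (- _).
rewrite -[f _ in RHS]/(f (act M x v)) -(prj_add (act M x v)) !linearD /=.
rewrite !(sgn_gr _ (memv_prj _ _)) !linearZ /= mulrDr.
have h0 l : l == ~~ j -> f (prj M l (act M x v)) = 0.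
  by move/eqP->; have/dual_grP := hf; apply; exact: memv_prj.
case: j h0 {hf} => h0.
  by rewrite (h0 false) // scaler0 mulr0.
by rewrite (h0 true) // scaler0 mulr0.
Qed.

Fact dual_act_gr i j x v : x \in gr g i -> v \in gr dual_space j ->
  dual_act x v \in gr dual_space (i (+) j).
Proof.
move=> hx hv; apply/dual_grP => w hw; rewrite (dual_act_homE _ hx hv).
have/dual_grP -> // := hv; first by rewrite mulr0 oppr0.
by have := act_gr hx hw; rewrite addbN addbA addbb addFb.
Qed.

Fact dual_act_br i j x y v : x \in gr g i -> y \in gr g j ->
  dual_act (br g x y) v =
  dual_act x (dual_act y v) - (-1) ^+ (i && j) *: dual_act y (dual_act x v).
Proof.
move=> hx hy; apply/lfunP => w; rewrite add_lfunE opp_lfunE scale_lfunE.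
rewrite (dual_act_gr_fun _ _ (br_gr hx hy)).
rewrite !(dual_act_gr_fun _ _ hx, dual_act_gr_fun _ _ hy).
rewrite (act_br _ hx hy) (act_sgn _ _ hy) (act_sgn _ _ hx).
rewrite !(linearB, linearZ) /= !sgn_sgn !opprK.
rewrite [j && i]andbC [j (+) i]addbC scalerA -expr2 sqrr_sign scale1r.
exact: addrC.
Qed.

Definition dual : smod := Smod dual_act_gr dual_act_br.

End Dual.
(* M (x) N, in coordinates with respect to the fixed bases vbasis fullv of M   *)
(* and N: the matrix A stands for the sum of the A i j *: (b_i (x) c_j).       *)
Section Tensor.
Variables M N : smod.
Let T : vectType k := 'M[k]_(\dim {:M}, \dim {:N}).
Let b := vbasis {:M}.
Let c := vbasis {:N}.

Definition tens (m : M) (n : N) : T :=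
  \matrix_(i, j) (coord b i m * coord c j n).

Fact tens_linear_l n : linear (tens^~ n).
Proof.
by move=> w x y; apply/matrixP => i j; rewrite !mxE linearP /= mulrDl mulrA.
Qed.

Fact tens_linear_r m : linear (tens m).
Proof.
by move=> w x y; apply/matrixP => i j; rewrite !mxE linearP /= mulrDr mulrCA.
Qed.

Fact tensDl m m' n : tens (m + m') n = tens m n + tens m' n.
Proof. by have := tens_linear_l n 1 m m'; rewrite !scale1r. Qed.
Fact tensDr m n n' : tens m (n + n') = tens m n + tens m n'.
Proof. by have := tens_linear_r m 1 n n'; rewrite !scale1r. Qed.
Fact tens0l n : tens 0 n = 0.
Proof. by apply/matrixP => i j; rewrite !mxE linear0 mul0r. Qed.
Fact tens0r m : tens m 0 = 0.
Proof. by apply/matrixP => i j; rewrite !mxE linear0 mulr0. Qed.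
Fact tensZl w m n : tens (w *: m) n = w *: tens m n.
Proof. by have := tens_linear_l n w m 0; rewrite tens0l !addr0. Qed.
Fact tensZr w m n : tens m (w *: n) = w *: tens m n.
Proof. by have := tens_linear_r m w n 0; rewrite tens0r !addr0. Qed.

Fact tens_sumE (A : T) : A = \sum_i \sum_j A i j *: tens b`_i c`_j.
Proof.
have fb : free b := basis_free (vbasisP _).
have fc : free c := basis_free (vbasisP _).
apply/matrixP => i j; rewrite summxE (bigD1 i) //= summxE (bigD1 j) //=.
rewrite !mxE !coord_free // !eqxx !mulr1 !big1 ?addr0 // => [i' ni|j' nj].
  rewrite summxE big1 // => j' _; rewrite !mxE !coord_free //.
  by rewrite (negPf ni) mul0r mulr0.
by rewrite !mxE !coord_free // (negPf nj) !mulr0.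
Qed.

(* f (x) h, without sign *)
Definition tmap_fun (f : 'End(M)) (h : 'End(N)) (A : T) : T :=
  \sum_i \sum_j A i j *: tens (f b`_i) (h c`_j).
Definition tmap f h : 'End(T) := linfun (tmap_fun f h).

Fact tmap_funE f h A : tmap f h A = tmap_fun f h A.
Proof.
rewrite linfun_lin // => w x y; rewrite /tmap_fun scaler_sumr -big_split /=.
apply: eq_bigr => i _; rewrite scaler_sumr -big_split /=.
by apply: eq_bigr => j _; rewrite !mxE scalerDl scalerA.
Qed.

Lemma tmap_tens f h m n : tmap f h (tens m n) = tens (f m) (h n).
Proof.
rewrite tmap_funE [in RHS](coord_vbasis (memvf m)).
rewrite [in RHS](coord_vbasis (memvf n)) !linear_sum /tmap_fun.
rewrite (big_morph (tens^~ _) (fun x y => tensDl x y _) (tens0l _)).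
apply: eq_bigr => i _; rewrite (big_morph (tens _) (tensDr _) (tens0r _)).
apply: eq_bigr => j _; rewrite !mxE !linearZ /= tensZl tensZr scalerA.
by [].
Qed.

Lemma tens_ext (W : vectType k) (f h : 'Hom(T, W)) :
  (forall m n, f (tens m n) = h (tens m n)) -> f = h.
Proof.
move=> e; apply/lfunP => A; rewrite (tens_sumE A) !linear_sum /=.
by apply: eq_bigr => i _; rewrite !linear_sum /=; apply: eq_bigr => j _;
  rewrite !linearZ /= e.
Qed.

Lemma tens_ext_gr (W : vectType k) (f h : 'Hom(T, W)) :
  (forall i j m n, m \in gr M i -> n \in gr N j ->
     f (tens m n) = h (tens m n)) -> f = h.
Proof.
move=> e; apply: tens_ext => m n; rewrite -(prj_add m) -(prj_add n).
by rewrite tensDl !tensDr !linearD /= !(e _ _ _ _ (memv_prj _ _) (memv_prj _ _)).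
Qed.

Definition tens_proj (i : bool) : 'End(T) :=
  \sum_(j : bool) tmap (prj M j) (prj N (i (+) j)).

Fact tens_proj_tens l i j m n : m \in gr M i -> n \in gr N j ->
  tens_proj l (tens m n) = if i (+) j == l then tens m n else 0.
Proof.
move=> hm hn; rewrite /tens_proj big_bool add_lfunE !tmap_tens.
rewrite !(prj_gr _ hm) !(prj_gr _ hn).
by case: l; case: (i); case: (j); rewrite /= ?tens0l ?tens0r ?addr0 ?add0r.
Qed.

Fact tens_proj_comp i j :
  (tens_proj i \o tens_proj j)%VF = if i == j then tens_proj i else 0.
Proof.
apply: tens_ext_gr => i' j' m n hm hn.
rewrite comp_lfunE (tens_proj_tens _ hm hn).
case: eqP => [<-|ne].
  rewrite (tens_proj_tens _ hm hn) eq_sym.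
  by case: eqP => [->|_]; rewrite ?zero_lfunE // (tens_proj_tens _ hm hn) eqxx.
rewrite linear0; case: eqP => [->|_]; last by rewrite zero_lfunE.
by rewrite (tens_proj_tens _ hm hn); case: eqP.
Qed.

Fact tens_proj_add : tens_proj false + tens_proj true = \1%VF.
Proof.
apply: tens_ext_gr => i j m n hm hn.
rewrite add_lfunE !(tens_proj_tens _ hm hn) lfunE /=.
by case: (i (+) j); rewrite /= ?addr0 ?add0r.
Qed.

Definition tens_space : superspace k :=
  proj_superspace tens_proj_comp tens_proj_add.

Lemma tens_gr i j m n : m \in gr M i -> n \in gr N j ->
  tens m n \in gr tens_space (i (+) j).
Proof.
move=> hm hn; apply/(limg_projP tens_proj_comp).
by rewrite (tens_proj_tens _ hm hn) eqxx.
Qed.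

(* x (m (x) n) = x m (x) n + (-1)^{|x| |m|} m (x) x n *)
Definition tens_act_lfun (x : g) : 'End(T) :=
  tmap (act M x) \1 + \sum_(i : bool) tmap (sgn M i) (act N (prj g i x)).
Definition tens_act : 'Hom(g, 'End(tens_space)) := linfun tens_act_lfun.

Fact tens_act_lfunE x m n : tens_act_lfun x (tens m n) =
  tens (act M x m) n + (tens (sgn M true m) (act N (prj g true x) n) +
                        tens (sgn M false m) (act N (prj g false x) n)).
Proof.
rewrite /tens_act_lfun big_bool 2!add_lfunE !tmap_tens.
by congr (tens _ _ + _); rewrite lfunE.
Qed.

Fact tens_actE x : tens_act x = tens_act_lfun x.
Proof.
rewrite linfun_lin // => w y z; apply: tens_ext => m n.
rewrite [LHS]tens_act_lfunE [RHS]add_lfunE scale_lfunE !tens_act_lfunE.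
rewrite act_linear_l.
rewrite ![prj _ _ _]linearP !act_linear_l.
rewrite tensDl tensZl !tensDr !tensZr !scalerDr.
by rewrite [RHS]addrACA; congr (_ + _); rewrite [RHS]addrACA.
Qed.

Lemma tens_act_gr_tens i x m n : x \in gr g i ->
  tens_act x (tens m n) = tens (act M x m) n + tens (sgn M i m) (act N x n).
Proof.
move=> hx; rewrite tens_actE tens_act_lfunE !(prj_gr _ hx).
by case: i {hx}; rewrite /= act_0l tens0r ?addr0 ?add0r.
Qed.

Lemma tens_act_tens i j x m n : x \in gr g i -> m \in gr M j ->
  tens_act x (tens m n) =
  tens (act M x m) n + (-1) ^+ (i && j) *: tens m (act N x n).
Proof.
by move=> hx hm; rewrite (tens_act_gr_tens _ _ hx) (sgn_gr _ hm) tensZl.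
Qed.

Fact tens_act_gr i j x v : x \in gr g i -> v \in gr tens_space j ->
  tens_act x v \in gr tens_space (i (+) j).
Proof.
move=> hx /(limg_projP tens_proj_comp) <-.
apply/(limg_projP tens_proj_comp); rewrite -!comp_lfunE; congr (fun_of_lfun _ v).
apply: tens_ext_gr => i' j' m n hm hn.
rewrite !comp_lfunE (tens_proj_tens _ hm hn).
case: eqP => [<-|_]; last by rewrite !linear0.
apply/(limg_projP tens_proj_comp); rewrite (tens_act_tens _ hx hm).
rewrite memvD ?memvZ //.
  by rewrite addbA; apply: tens_gr => //; apply: act_gr.
by rewrite addbCA; apply: tens_gr => //; apply: act_gr.
Qed.

Fact tens_act_br i j x y v : x \in gr g i -> y \in gr g j ->
  tens_act (br g x y) v =
  tens_act x (tens_act y v) - (-1) ^+ (i && j) *: tens_act y (tens_act x v).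
Proof.
move=> hx hy; rewrite -!comp_lfunE -scale_lfunE -opp_lfunE -add_lfunE.
congr (fun_of_lfun _ v); apply: tens_ext => m n.
rewrite add_lfunE opp_lfunE scale_lfunE !comp_lfunE.
rewrite (tens_act_gr_tens _ _ (br_gr hx hy)).
rewrite !(tens_act_gr_tens _ _ hx, tens_act_gr_tens _ _ hy, linearD) /=.
rewrite !(tens_act_gr_tens _ _ hx, tens_act_gr_tens _ _ hy).
rewrite !sgn_sgn (act_sgn _ _ hy) (act_sgn _ _ hx) !(act_br _ hx hy).
rewrite [j && i]andbC [j (+) i]addbC -!scaleNr.
rewrite tensDl tensDr !tensZl tensZr !scalerDr !scalerA mulNr -expr2 sqrr_sign.
rewrite scaleN1r !scaleNr.
set A := tens _ n; set B := tens _ n; set C := tens (sgn M i _) _.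
set D := tens (sgn M j _) _; set E := tens _ (act N x _).
set F := tens _ (act N y _); set s := (-1) ^+ _.
rewrite [- _ - _ + _]addrACA [RHS]addrACA [- (s *: B) - C]addrC.
by rewrite [s *: D + E]addrC !addrA !addrK.
Qed.

Definition tensor : smod := Smod tens_act_gr tens_act_br.
End Tensor.
(* submod0 and simple0 are the g_0-subsupermodules and the simple ones; in_F is
   membership in F_(g,g_0), complete reducibility being the existence of a
   decomposition into a direct sum of simple g_0-supermodules. *)
Definition submod0 (M : smod) (U : {vspace M}) : Prop :=
  (forall i u, u \in U -> prj M i u \in U) /\
  (forall x u, x \in gr g false -> u \in U -> act M x u \in U).

Definition simple0 (M : smod) (U : {vspace M}) : Prop :=
  [/\ U <> 0%VS, submod0 U &
      forall W : {vspace M}, submod0 W -> (W <= U)%VS -> W = 0%VS \/ W = U].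

Definition in_F (M : smod) : Prop :=
  exists (n : nat) (S : 'I_n -> {vspace M}),
    [/\ forall i, simple0 (S i), (\sum_i S i)%VS = fullv
      & directv (\sum_i S i)%VS].

Definition projective (P : smod) : Prop :=
  in_F P /\
  forall (M N : smod) (q : 'Hom(M, N)) (f : 'Hom(P, N)),
    in_F M -> in_F N -> is_hom q -> limg q = fullv -> is_hom f ->
    exists2 h : 'Hom(P, M), is_hom h & (q \o h)%VF = f.

Definition submod (M : smod) (U : {vspace M}) : Prop :=
  (forall i u, u \in U -> prj M i u \in U) /\
  (forall x u, u \in U -> act M x u \in U).

Definition proj_cover (M P : smod) (p : 'Hom(P, M)) : Prop :=
  [/\ projective P, is_hom p, limg p = fullv
    & forall U : {vspace P}, submod U -> (U + lker p)%VS = fullv -> U = fullv].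

(* K is (a copy of) Omega^1(M). *)
Definition is_Omega1 (M K : smod) : Prop :=
  exists (P : smod) (p : 'Hom(P, M)) (i : 'Hom(K, P)),
    [/\ proj_cover p, is_hom i, lker i = 0%VS & limg i = lker p].

Definition endotrivial (M : smod) : Prop :=
  in_F M /\
  exists2 P : smod, projective P & smod_iso (tensor M (dual M)) (dsum k_ev P).

(* Stmod(F) *)
Definition stable_eq (M N : smod) (f h : 'Hom(M, N)) : Prop :=
  exists (P : smod) (a : 'Hom(M, P)) (b : 'Hom(P, N)),
    [/\ projective P, is_hom a, is_hom b & f - h = (b \o a)%VF].

Definition stable_iso (M N : smod) : Prop :=
  exists (f : 'Hom(M, N)) (h : 'Hom(N, M)),
    [/\ is_hom f, is_hom h,
        stable_eq (h \o f)%VF \1%VF & stable_eq (f \o h)%VF \1%VF].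

(* The isomorphism class of M in Stmod(F), as a predicate on modules. *)
Definition stable_class (M : smod) : smod -> Prop :=
  fun N => in_F N /\ stable_iso M N.

(* The underlying set of T(g); M ranges over modules up to stable isomorphism,
   so an element is the whole class, and T_add is the composition law. *)
Definition T_group (C : smod -> Prop) : Prop :=
  exists2 M, endotrivial M & C = stable_class M.

(* [M] + [N] = [M (x) N]; taking the union over all representatives of the two
   classes makes this total without a well-definedness proof.  Commutativity,
   associativity and inverses are not assumed: an isomorphism as in
   T_isomorphism forces them. *)
Definition T_add (C D : smod -> Prop) : smod -> Prop :=
  fun X => exists M N, [/\ C M, D N & stable_class (tensor M N) X].

Definition T_zero : smod -> Prop := stable_class k_ev.

Definition T_subgroup (H : (smod -> Prop) -> Prop) : Prop :=
  [/\ forall C, H C -> T_group C,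
      H T_zero,
      forall C D, H C -> H D -> H (T_add C D)
    & forall C D, H C -> T_group D -> T_add C D = T_zero -> H D].

(* The elements of S lie in T(g) and generate it: no proper subgroup of T(g)   *)
(* contains S.                                                                 *)
Definition T_generated_by (S : (smod -> Prop) -> Prop) : Prop :=
  (forall C, S C -> T_group C) /\
  (forall H, T_subgroup H -> (forall C, S C -> H C) ->
     forall C, T_group C -> H C).

(* psi is an isomorphism from the abelian group Z onto T(g). *)
Definition T_isomorphism (Z : zmodType) (psi : Z -> smod -> Prop) : Prop :=
  [/\ forall u v, psi u = psi v -> u = v,
      forall C, T_group C <-> exists u, C = psi u
    & forall u v, psi (u + v) = T_add (psi u) (psi v)].

End Supermodules.

Arguments T_group {k} g.
Arguments k_ev {k} g.
Arguments k_od {k} g.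

(* Main.v *)
Require Import Defs.
From mathcomp Require Import all_boot all_order all_algebra.
From mathcomp Require Import zify ring.
From Stdlib Require Import Classical_Prop FunctionalExtensionality PropExtensionality.

Set Implicit Arguments.
Unset Strict Implicit.
Unset Printing Implicit Defensive.

Import GRing.Theory.
Local Open Scope ring_scope.

(** Why the theorem holds.  A detecting subalgebra a has two features that drive
    everything: its even part a_0 is central, and a_0 is spanned by the squares
    [v, v] of odd elements.  Write V for the odd part a_1, of dimension r >= 2.

    Projectivity is a null-homotopy condition.  Call a module contractible if for
    every functional y on a there is an a_0-linear operator H with
    x H + H x = y(x) for all odd x.  In the category F, projective and
    contractible modules coincide: a Koszul module k + k, on which x acts as y(x)
    from one copy to the other, tensored with P covers P, and splitting that cover
    gives H ([projective_contractible]); conversely a family of H makes an a_0-linear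
    lift V-linear, one basis vector of V after the other ([contractible_lift]).

    Endotrivial modules can be moved to weight zero.  If M is endotrivial, then
    End(M) is the sum of a line and a contractible module; let alpha be the
    projection to that line.  The functional alpha kills every x.phi, and the
    idempotent 1 - p which projects away from the part M^0 killed by a_0 is a
    combination of operators v.phi, since a_0 is spanned by squares and acts
    semisimply.  Hence 1 - p is contracted, its image is projective, and M is
    stably isomorphic to M^0.  The same functional shows that for each nonzero v
    in V, which acts on M^0 with square zero, the homology of v on M^0 is exactly
    one-dimensional ([retract_lod]).  Modules of weight zero with this property are
    called [lod] below.

    A lod module N carries an invariant in Z x Z_2: the parity of the homology
    class, and a signed difference of the ranks of v on the odd and even parts.
    It is additive on tensor products, is negated by duality up to the parity
    which it keeps, and is constant on stable isomorphism classes, because r >= 2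
    forces contractible modules of weight zero to have balanced ranks.

    The heart of the proof is that a lod module with invariant (0, e) is the sum
    of the trivial module of parity e and a projective module ([lod_split]).  As V
    acts on N through an exterior algebra, this amounts to showing that the product
    of a basis of V has the largest possible rank, (dim N - 1) / 2^r.  By induction
    on j, the product of any j independent elements of V has rank (dim N - 1) / 2^j:
    if this failed at some step, the part of N without free summands would give a
    pencil or net of matrices of constant rank, of size f x f, f x (f+1) or
    (f+1) x f, and over an algebraically closed field no such pencil or net exists
    for f > 0.  The square case is the vanishing of a determinant
    ([square_pencil_drop]); the rectangular one reduces, through the Krylov matrix
    of a pair, to the vanishing of a binary form ([net_tall_drop]).

    Applied to N (x) N^*, whose invariant is zero, the splitting shows that lod
    modules are endotrivial; applied to M (x) N^* it shows that the invariant
    separates stable classes.  So T(a) embeds in Z x Z_2.  Any projective cover of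
    k_ev has weight zero, and counting dimensions gives Omega^1(k_ev) the invariant
    (-1, 1) ([omega_lod]); k_od has invariant (0, 1).  These two elements generate
    Z x Z_2, which proves both surjectivity and the statement on generators. *)

(** * Pencils and nets of matrices *)

Section Pencils.
Variable k : closedFieldType.

Lemma eigenvector_exists n (A : 'M[k]_n) : (0 < n)%N ->
  exists a, exists2 u : 'rV[k]_n, u != 0 & u *m A = a *: u.
Proof.
move=> n_gt0; have: size (char_poly A) != 1%N by rewrite size_char_poly eqSS -lt0n.
case/closed_rootP => a; rewrite -eigenvalue_root_char => /eigenvalueP[u ua u0].
by exists a, u.
Qed.

Lemma rank_lt_row m n (A : 'M[k]_(m, n)) (u : 'rV_m) :
  u != 0 -> u *m A = 0 -> (\rank A < m)%N.
Proof.
move=> u0 uA; rewrite ltn_neqAle rank_leq_row andbT; apply: contra u0 => /row_freeP[B AB].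
by rewrite -[u]mulmx1 -AB mulmxA uA mul0mx.
Qed.

Lemma rank_lt_col m n (A : 'M[k]_(m, n)) (v : 'cV_n) :
  v != 0 -> A *m v = 0 -> (\rank A < n)%N.
Proof.
move=> v0 Av; rewrite -mxrank_tr; apply: (@rank_lt_row _ _ _ v^T).
  by rewrite -trmx0 (inj_eq trmx_inj).
by rewrite -trmx_mul Av trmx0.
Qed.

(** If Y is invertible, an eigenvalue of X Y^-1 gives a singular member X - a Y. *)
Lemma square_pencil_drop n (X Y : 'M[k]_n) : (0 < n)%N ->
  exists s t, (s, t) != (0, 0) /\ (\rank (s *: X + t *: Y)%R < n)%N.
Proof.
move=> n_gt0; have [Yu|Yn] := boolP (Y \in unitmx); last first.
  exists 0, 1; rewrite scale0r add0r scale1r xpair_eqE oner_eq0 andbF; split=> //.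
  by rewrite ltn_neqAle rank_leq_row andbT -/(row_free Y) row_free_unit.
have [a [u u0 ua]] := eigenvector_exists (X *m invmx Y) n_gt0.
exists 1, (- a); rewrite xpair_eqE oner_eq0; split=> //.
apply: (rank_lt_row u0); rewrite scale1r scaleNr mulmxBr -scalemxAr.
by rewrite scalemxAl -ua -!mulmxA mulVmx // mulmx1 subrr.
Qed.

(** The observability matrix of the pair (p, Y), with rows p, p Y, ..., p Y^n. *)
Definition krylov (R : pzRingType) n (p : 'rV[R]_n.+1) (Y : 'M[R]_n.+1) : 'M[R]_n.+1 :=
  \matrix_(i < n.+1) (p *m Y ^+ i).

Lemma krylov_map (R S : pzRingType) (f : {rmorphism R -> S}) n (p : 'rV[R]_n.+1) Y :
  map_mx f (krylov p Y) = krylov (map_mx f p) (map_mx f Y).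
Proof.
apply/row_matrixP => i; rewrite -map_row !rowK map_mxM; congr (_ *m _).
by rewrite rmorphXn.
Qed.

Lemma det_krylov_scale n (p : 'rV[k]_n.+1) Y c :
  \det (krylov (c *: p) (c *: Y)) = c ^+ (\sum_(i < n.+1) i.+1) * \det (krylov p Y).
Proof.
have -> : krylov (c *: p) (c *: Y) =
    diag_mx (\row_(i < n.+1) c ^+ i.+1) *m krylov p Y.
  apply/row_matrixP => i; rewrite row_mul row_diag_mx -scalemxAl -rowE !rowK mxE.
  by rewrite -scalemxAl exprZn -scalemxAr scalerA -exprS.
rewrite det_mulmx det_diag; congr (_ * _).
rewrite -prodrXr; by apply: eq_bigr => i _; rewrite mxE.
Qed.

(** The determinant of the Krylov matrix of (s p + t q, s Y + t W) is a binary form in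
    (s, t) of positive degree, by [det_krylov_scale], so it has a nontrivial zero. *)
Lemma krylov_pencil_singular n (p q : 'rV[k]_n.+1) (Y W : 'M[k]_n.+1) :
  exists s t, (s, t) != (0, 0) /\
    \det (krylov (s *: p + t *: q) (s *: Y + t *: W)) = 0.
Proof.
pose d (s t : k) := \det (krylov (s *: p + t *: q) (s *: Y + t *: W)).
set D := (\sum_(i < n.+1) i.+1)%N.
have dZ c s t : d (c * s) (c * t) = c ^+ D * d s t.
  by rewrite /d -!scalerA -!scalerDr det_krylov_scale.
have poly (s0 s1 t0 t1 : k) : exists P : {poly k}, forall x,
    P.[x] = d (s0 + s1 * x) (t0 + t1 * x).
  pose l a b : {poly k} := a%:P + b *: 'X.
  pose C m n (A : 'M[k]_(m, n)) := map_mx (@polyC k) A.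
  exists (\det (krylov (l s0 s1 *: C _ _ p + l t0 t1 *: C _ _ q)
                       (l s0 s1 *: C _ _ Y + l t0 t1 *: C _ _ W))) => x.
  rewrite -[_.[x]]/(horner_eval x _) -det_map_mx krylov_map; congr (\det _).
  have e m' n' (A B : 'M[k]_(m', n')) :
      map_mx (horner_eval x) (l s0 s1 *: C _ _ A + l t0 t1 *: C _ _ B) =
      (s0 + s1 * x) *: A + (t0 + t1 * x) *: B.
    by apply/matrixP => i j; rewrite !mxE /horner_eval !hornerE.
  by rewrite !e.
(* P and Q are the restrictions of d to the affine lines (x, 1) and (1, x) *)
have [P hP] := poly 0 1 1 0; have [Q hQ] := poly 1 0 0 1.
have [sP|sP] := eqVneq (size P) 1%N; last first.
  have /closed_rootP[x /rootP] := sP; rewrite hP => dx.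
  exists (0 + 1 * x), (1 + 0 * x); split=> //.
  by rewrite !mul0r addr0 xpair_eqE oner_eq0 andbF.
have /size_poly1P[c c0 Pc] : size P == 1%N by rewrite sP.
(* if P is constant then, by homogeneity, d is a multiple of the D-th power of the second variable *)
have QE : Q = c *: 'X^D.
  (* both sides agree at every x != 0, and a nonzero polynomial times X has a non-root *)
  apply/eqP; rewrite -subr_eq0; apply/negPn/negP => r0.
  set F := Q - _ in r0.
  have [x] := closed_nonrootP (F * 'X) (mulf_neq0 r0 (negbT (polyX_eq0 _))).
  rewrite rootM rootX negb_or => /andP[rF x0]; case/negP: rF; rewrite /root /F hornerD hornerN hornerZ hornerXn hQ subr_eq0.
  apply/eqP; rewrite mul0r addr0 add0r mul1r.
  have -> : d 1 x = d (x * x^-1) (x * 1) by rewrite mulfV // mulr1.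
  rewrite dZ mulrC; have := hP x^-1.
  by rewrite Pc hornerC !mul1r !mul0r add0r addr0 => <-.
exists (1 + 0 * 0), (0 + 1 * 0); split.
  by rewrite mul0r addr0 xpair_eqE oner_eq0.
rewrite -[LHS]hQ QE hornerZ hornerXn.
by rewrite /D big_ord_recl expr0n mulr0.
Qed.


(** The first partial product of the factors Y - z that kills v yields an eigenvector. *)
Lemma first_eigenvector n (Y : 'M[k]_n.+1) (v : 'cV[k]_n.+1) (rs : seq k) :
  v != 0 -> horner_mx Y (\prod_(z <- rs) ('X - z%:P)) *m v = 0 ->
  exists a h, horner_mx Y h *m v != 0 /\
    Y *m (horner_mx Y h *m v) = a *: (horner_mx Y h *m v).
Proof.
move=> v0; elim: rs => [|a rs IH]; first by rewrite big_nil rmorph1 mul1mx => /eqP/(negP v0).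
rewrite big_cons rmorphM rmorphB /= horner_mx_X horner_mx_C.
set h := \prod_(z <- rs) _ => e; have [/IH//|h0] := eqVneq (horner_mx Y h *m v) 0.
exists a, h; split=> //; apply/eqP; rewrite -subr_eq0 -mul_scalar_mx -mulmxBl.
by rewrite mulmxA; apply/eqP.
Qed.

(** Hautus test: if the Krylov matrix kills v, then p kills the whole subspace k[Y] v, by
    Cayley-Hamilton, and this Y-stable subspace contains an eigenvector of Y. *)
Lemma hautus n (p : 'rV[k]_n.+1) (Y : 'M[k]_n.+1) : \det (krylov p Y) = 0 ->
  exists a, exists2 v : 'cV[k]_n.+1, v != 0 & p *m v = 0 /\ Y *m v = a *: v.
Proof.
move=> d0; set K := krylov p Y.
have [v v0 Kv] : exists2 v : 'cV[k]_n.+1, v != 0 & K *m v = 0.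
  have : \det K^T == 0 by rewrite det_tr d0.
  case/det0P => u u0 uK; exists u^T; first by rewrite -trmx0 (inj_eq trmx_inj).
  by apply: trmx_inj; rewrite trmx_mul trmxK uK trmx0.
have pv h : p *m (horner_mx Y h *m v) = 0.
  have -> : horner_mx Y h = horner_mx Y (h %% char_poly Y).
    rewrite {1}(divp_eq h (char_poly Y)) rmorphD rmorphM /= Cayley_Hamilton.
    by rewrite mulr0 add0r.
  set g := _ %% _; have sg : (size g <= n.+1)%N.
    by rewrite -ltnS -(size_char_poly Y) ltn_modp -size_poly_gt0 size_char_poly.
  have -> : g = \poly_(i < n.+1) g`_i.
    apply/polyP => i; rewrite coef_poly; case: ltnP => // /(leq_trans sg).
    by move/leq_sizeP => ->.
  rewrite poly_def rmorph_sum /= mulmx_suml mulmx_sumr big1 // => i _.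
  rewrite -mul_polyC rmorphM rmorphXn /= horner_mx_X horner_mx_C.
  rewrite -mulmxA mul_scalar_mx -scalemxAr.
  have /row_matrixP/(_ i) := Kv; rewrite row_mul rowK row0 -mulmxA => ->.
  exact: scaler0.
have [rs crs] := closed_field_poly_normal (char_poly Y).
have [a [h [h0 he]]] : exists a h, horner_mx Y h *m v != 0 /\
    Y *m (horner_mx Y h *m v) = a *: (horner_mx Y h *m v).
  apply: (@first_eigenvector _ _ _ rs v0).
  have /monicP := char_poly_monic Y; move: crs => /[swap] -> ; rewrite scale1r => <-.
  by rewrite Cayley_Hamilton mul0mx.
by exists a, (horner_mx Y h *m v).
Qed.

(** When X has full rank n, choose a left inverse R of X and a row a0 spanning the left kernel
    of X.  A column v with (s Y + t W) v in the line of X v is the same as an eigenvector v of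
    R (s Y + t W) killed by a0 (s Y + t W).  The Krylov determinant of this pair vanishes for some
    (s, t), and then the Hautus test provides v. *)
Lemma net_tall_drop n (X Y W : 'M[k]_(n.+1, n)) : (0 < n)%N ->
  exists s t u, (s, t, u) != (0, 0, 0) /\
    (\rank (s *: X + t *: Y + u *: W)%R < n)%N.
Proof.
case: n X Y W => [//|n] X Y W _; have [Xf|Xn] := boolP (row_full X); last first.
  exists 1, 0, 0; rewrite !xpair_eqE oner_eq0; split=> //.
  by rewrite scale1r !scale0r !addr0 ltn_neqAle rank_leq_col andbT.
have /row_fullP[R RX] := Xf; pose a0 := nz_row (kermx X).
have rk1 : \rank (kermx X) = 1%N by rewrite mxrank_ker (eqP Xf) subSnn.
have a00 : a0 != 0 by rewrite nz_row_eq0 -mxrank_eq0 rk1.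
have a0s : (kermx X <= a0)%MS.
  by rewrite -(geq_leqif (mxrank_leqif_sup (nz_row_sub _))) rk1 rank_rV a00.
have [s [t [st0 dk]]] := krylov_pencil_singular (a0 *m Y) (a0 *m W) (R *m Y) (R *m W).
have [c [v v0 [pv Yv]]] := hautus dk.
exists (- c), s, t; split.
  by move: st0; rewrite !xpair_eqE; case: (s =P 0) => // _; case: (t =P 0) => //; rewrite !andbF.
apply: (rank_lt_col v0); pose Z := s *: Y + t *: W.
have RZv : R *m Z *m v = c *: v by rewrite -Yv /Z mulmxDr -!scalemxAr.
have aZv : a0 *m Z *m v = 0 by rewrite -pv /Z mulmxDr -!scalemxAr.
rewrite -addrA -/Z; apply/row_matrixP => i; rewrite row0.
rewrite -[_ *m v]mul1mx row_mul; set w := row i 1%:M.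
have /submxP[d wE] : (w - w *m X *m R <= a0)%MS.
  apply: submx_trans a0s; apply/sub_kermxP.
  by rewrite mulmxBl -!mulmxA RX mulmx1 subrr.
have {}wE : w = w *m X *m R + d *m a0 by rewrite -wE addrC subrK.
rewrite mulmxDl -scalemxAl mulmxDr -scalemxAr {2}wE mulmxDl -!mulmxA.
rewrite [a0 *m _]mulmxA aZv mulmx0 addr0 [R *m _]mulmxA RZv -!scalemxAr.
by rewrite scaleNr addNr.
Qed.

Lemma net_wide_drop n (X Y W : 'M[k]_(n, n.+1)) : (0 < n)%N ->
  exists s t u, (s, t, u) != (0, 0, 0) /\
    (\rank (s *: X + t *: Y + u *: W)%R < n)%N.
Proof.
move=> n0; have [s [t [u [z r]]]] := net_tall_drop X^T Y^T W^T n0.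
exists s, t, u; split=> //; rewrite -mxrank_tr; apply: leq_trans r.
by rewrite !linearD !linearZ.
Qed.

End Pencils.

(** * Pencils and nets of linear maps *)

Section PencilsOfMaps.
Variables (k : closedFieldType) (N N' : vectType k).
Implicit Types (A : {vspace N}) (B : {vspace N'}) (phi : 'Hom(N, N')).

Definition coord_mx A B phi : 'M[k]_(\dim A, \dim B) :=
  \matrix_(i, j) coord (vbasis B) j (phi (vbasis A)`_i).

Lemma coord_mx_linear A B : linear (coord_mx A B).
Proof.
by move=> c f h; apply/matrixP => i j; rewrite !mxE add_lfunE scale_lfunE linearP.
Qed.

Lemma dim_img_le_rank A B phi : (phi @: A <= B)%VS ->
  (\dim (phi @: A) <= \rank (coord_mx A B phi))%N.
Proof.
move=> sAB; set M := coord_mx A B phi; set n := \rank M.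
pose L := linfun (fun v : 'rV[k]_(\dim B) => \sum_j v 0 j *: (vbasis B)`_j).
have LE v : L v = \sum_j v 0 j *: (vbasis B)`_j.
  rewrite linfun_lin // => c x y; rewrite scaler_sumr -big_split /=.
  by apply: eq_bigr => j _; rewrite !mxE scalerDl scalerA.
pose Y := [seq L (row i (row_base M)) | i : 'I_n].
suff sY : (phi @: A <= <<Y>>)%VS.
  by apply: leq_trans (dimvS sY) (leq_trans (dim_span _) _); rewrite size_map size_enum_ord.
rewrite -[X in (phi @: X)%VS](span_basis (vbasisP A)) limg_span.
apply/span_subvP => _ /mapP[x xA ->].
have [i Ei] : exists i : 'I_(\dim A), x = (vbasis A)`_i.
  have := index_mem x (vbasis A); rewrite xA size_tuple => h.
  by exists (Ordinal h); rewrite nth_index.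
have -> : phi x = L (row i M).
  rewrite LE Ei {1}(@coord_vbasis _ _ (phi (vbasis A)`_i) B); last first.
    by apply: (subvP sAB); apply: memv_img; rewrite -Ei; apply: vbasis_mem.
  by apply: eq_bigr => j _; rewrite !mxE.
have /submxP[d ->] : (row i M <= row_base M)%MS.
  by rewrite (submx_trans (row_sub _ _)) // eq_row_base.
rewrite mulmx_sum_row linear_sum memv_suml // => j _; rewrite linearZ memvZ //.
by apply/memv_span/mapP; exists j; rewrite ?mem_enum.
Qed.

Lemma img_comb2_sub A B phi psi s t : (phi @: A <= B)%VS -> (psi @: A <= B)%VS ->
  ((s *: phi + t *: psi) @: A <= B)%VS.
Proof.
move=> sp sq; apply/subvP => _ /memv_imgP[x xA ->].
rewrite add_lfunE !scale_lfunE memvD // memvZ //.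
  by apply: (subvP sp); apply: memv_img.
by apply: (subvP sq); apply: memv_img.
Qed.

Lemma square_pencil_trivial A B phi psi : \dim A = \dim B ->
  (phi @: A <= B)%VS -> (psi @: A <= B)%VS ->
  (forall s t, (s, t) != (0, 0) -> (\dim A <= \dim ((s *: phi + t *: psi) @: A))%N) ->
  \dim A = 0.
Proof.
move=> eAB sp sq h; apply/eqP; rewrite -leqn0 leqNgt; apply/negP => A0.
have [s [t [st0]]] : exists s t, (s, t) != (0, 0) /\
    (\rank (s *: coord_mx A B phi + t *: coord_mx A B psi)%R < \dim A)%N.
  move: (coord_mx A B phi) (coord_mx A B psi) => X Y; move: X Y.
  by rewrite -eAB => X Y; apply: square_pencil_drop.
rewrite ltnNge => /negP[]; apply: leq_trans (h s t st0) _.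
apply: leq_trans (dim_img_le_rank (img_comb2_sub s t sp sq)) _.
by rewrite coord_mx_linear -[t *: psi]addr0 coord_mx_linear;
  rewrite (_ : coord_mx A B 0 = 0) ?addr0 //; apply/matrixP => i j;
  rewrite !mxE zero_lfunE linear0.
Qed.

Lemma net_trivial A B phi psi chi f :
  (\dim A = f.+1 /\ \dim B = f) \/ (\dim A = f /\ \dim B = f.+1) ->
  (phi @: A <= B)%VS -> (psi @: A <= B)%VS -> (chi @: A <= B)%VS ->
  (forall s t u, (s, t, u) != (0, 0, 0) ->
     (f <= \dim ((s *: phi + t *: psi + u *: chi) @: A))%N) -> f = 0.
Proof.
move=> dAB sp sq sr h; apply/eqP; rewrite -leqn0 leqNgt; apply/negP => f0.
have [s [t [u [st0]]]] : exists s t u, (s, t, u) != (0, 0, 0) /\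
    (\rank (s *: coord_mx A B phi + t *: coord_mx A B psi
            + u *: coord_mx A B chi)%R < f)%N.
  move: (coord_mx A B phi) (coord_mx A B psi) (coord_mx A B chi) => X Y Z.
  move: X Y Z; case: dAB => -[-> ->] X Y Z; first exact: net_tall_drop.
  exact: net_wide_drop.
rewrite ltnNge => /negP[]; apply: leq_trans (h s t u st0) _.
have sub : ((s *: phi + t *: psi + u *: chi) @: A <= B)%VS.
  by rewrite -[_ + t *: psi]scale1r; apply: img_comb2_sub => //; apply: img_comb2_sub.
apply: leq_trans (dim_img_le_rank sub) _.
rewrite -addrA !coord_mx_linear -[u *: chi]addr0 coord_mx_linear.
by rewrite (_ : coord_mx A B 0 = 0) ?addr0 ?addrA //; apply/matrixP => i j;
  rewrite !mxE zero_lfunE linear0.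
Qed.

End PencilsOfMaps.

(** * Anticommuting operators of square zero *)

Section Exterior.
Variables (k : fieldType) (M : vectType k).
Implicit Types (e f : 'End(M)) (es : seq 'End(M)) (L N Y : {vspace M}).

Definition anticomm es : Prop :=
  {in es, forall e v, e (e v) = 0} /\
  {in es &, forall e f v, e (f v) = - f (e v)}.

Definition prodop es : 'End(M) := foldr (fun e p => (e \o p)%VF) \1%VF es.
(** The submodule generated by L over the exterior algebra of es: the span of all products of
    distinct operators applied to L. *)
Definition freeext es L := foldr (fun e L => (L + e @: L)%VS) L es.
(** The largest es-stable subspace of N; this is dual to the generated submodule. *)
Definition cofree es N := foldr (fun e N => (N :&: (e @^-1: N))%VS) N es.
Definition stable es Y := {in es, forall e, (e @: Y <= Y)%VS}.
Definition soc es : {vspace M} := (\bigcap_(e <- es) lker e)%VS.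
Definition aug es : {vspace M} := (\sum_(e <- es) limg e)%VS.

Lemma anticomm_cons e es : anticomm (e :: es) -> anticomm es.
Proof.
by case=> h1 h2; split=> [f fe|f g fe ge]; [apply: h1|apply: h2]; rewrite inE ?fe ?ge orbT.
Qed.

Lemma prodop_cons e es v : prodop (e :: es) v = e (prodop es v).
Proof. by rewrite /= comp_lfunE. Qed.

Lemma socP es v : reflect {in es, forall e, e v = 0} (v \in soc es).
Proof.
rewrite /soc; elim: es => [|e es IH]; first by rewrite big_nil memvf; constructor.
rewrite big_cons memv_cap memv_ker; apply: (iffP andP) => [[/eqP e0 /IH h] f|h].
  by rewrite inE => /orP[/eqP->|/h].
split; first by rewrite h ?mem_head.
by apply/IH => f fe; rewrite h // inE fe orbT.
Qed.

Lemma stableP es Y : stable es Y -> {in es, forall e v, v \in Y -> e v \in Y}.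
Proof. by move=> h e ee v vY; apply: (subvP (h e ee)); apply: memv_img. Qed.

Lemma stable_intro es Y : {in es, forall e v, v \in Y -> e v \in Y} -> stable es Y.
Proof. by move=> h e ee; apply/subvP => _ /memv_imgP[v vY ->]; apply: h. Qed.

Lemma stable_prodop es Y v : stable es Y -> v \in Y -> prodop es v \in Y.
Proof.
elim: es => [|e es IH] h vY; first by rewrite /= id_lfunE.
rewrite prodop_cons (stableP h) ?mem_head // IH // => f fe.
by apply: h; rewrite inE fe orbT.
Qed.

Lemma prodop_comm e es v : {in es, forall f v, e (f v) = - f (e v)} ->
  prodop es (e v) = (-1) ^+ size es *: e (prodop es v).
Proof.
elim: es => [|f es IH] h; first by rewrite /= !id_lfunE scale1r.
rewrite !prodop_cons IH => [|g ge]; last by apply: h; rewrite inE ge orbT.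
by rewrite (h f) ?mem_head //= linearZ /= exprS mulN1r scalerN scaleNr opprK.
Qed.

Lemma anticomm_all es e : anticomm es -> e \in es ->
  {in es, forall f v, e (f v) = - f (e v)}.
Proof. by case=> _ h ee f fe v; apply: h. Qed.

Lemma prodop_kill_l es e v : anticomm es -> e \in es -> e (prodop es v) = 0.
Proof.
elim: es => // f es IH ac; have [h1 h2] := ac; rewrite prodop_cons.
have [->|ef] := eqVneq e f; first by rewrite h1 ?mem_head.
rewrite inE (negPf ef) /= => ee; rewrite (h2 e f) ?mem_head ?inE ?ee ?orbT //.
by rewrite IH ?linear0 ?oppr0 //; apply: anticomm_cons ac.
Qed.

Lemma prodop_soc es v : (0 < size es)%N -> v \in soc es -> prodop es v = 0.
Proof.
case: es => // e es _; elim: es e => [|f es IH] e /socP h.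
  by rewrite prodop_cons /= id_lfunE h ?mem_head.
rewrite prodop_cons IH ?linear0 //; apply/socP => g ge.
by rewrite h // inE ge orbT.
Qed.

Lemma stableI es Y Y' : stable es Y -> stable es Y' -> stable es (Y :&: Y')%VS.
Proof.
move=> h h'; apply: stable_intro => e ee v; rewrite !memv_cap => /andP[vY vY'].
by rewrite (stableP h) ?(stableP h').
Qed.

Lemma stable_ker e es : anticomm (e :: es) -> stable es (lker e).
Proof.
case=> _ h; apply: stable_intro => f fe v; rewrite !memv_ker => /eqP ev.
by rewrite h ?mem_head ?inE ?fe ?orbT // ev linear0 oppr0.
Qed.

(** The exterior algebra is local: every nonzero module has a nonzero socle. *)
Lemma socle_neq0 es Y : anticomm es -> stable es Y -> Y != 0%VS ->
  exists2 y, y != 0 & y \in (Y :&: soc es)%VS.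
Proof.
elim: es Y => [|e es IH] Y ac st Y0.
  by exists (vpick Y); rewrite ?vpick0 // memv_cap memv_pick /soc big_nil memvf.
have st' : stable es Y by move=> f fe; apply: st; rewrite inE fe orbT.
have Ye0 : (Y :&: lker e)%VS != 0%VS.
  have [eY|/subvPn[v vY ev]] := boolP (Y <= lker e)%VS.
    by move/capv_idPl: eY => ->.
  apply: contra ev; rewrite memv_ker => /eqP z.
  rewrite -memv0 -z memv_cap (stableP st) ?mem_head // memv_ker.
  by have [h1 _] := ac; rewrite h1 ?mem_head ?eqxx.
have ac' := anticomm_cons ac.
have [y y0] := IH _ ac' (stableI st' (stable_ker ac)) Ye0.
rewrite !memv_cap -andbA => /and3P[yY ye ys]; exists y => //.
by rewrite memv_cap yY /soc big_cons memv_cap ye.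
Qed.

Lemma freeext_sub es L : (L <= freeext es L)%VS.
Proof. by elim: es => //= e es IH; rewrite (subv_trans IH) ?addvSl. Qed.

Lemma stable_freeext es L : anticomm es -> stable es (freeext es L).
Proof.
elim: es => //= e es IH ac; have ac' := anticomm_cons ac.
apply: stable_intro => f; rewrite inE => fe v /memv_addP[x xL [_ /memv_imgP[y yL ->] ->]].
have [h1 h2] := ac; case/orP: fe => [/eqP->|fe]; rewrite linearD /=.
  by rewrite h1 ?mem_head // addr0 (subvP (addvSr _ _)) // memv_img.
rewrite (h2 f e) ?mem_head ?inE ?fe ?orbT // -linearN /=.
apply: memv_add; first exact: (stableP (IH ac')).
by apply: memv_img; rewrite memvN (stableP (IH ac')).
Qed.

(** If the top product is injective on L, then the submodule generated by L is free on L: a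
    nonzero kernel of the last operator would meet the socle, which is the image of L under the
    product of the others. *)
Lemma freeext_free es L : anticomm es -> (L :&: lker (prodop es) = 0)%VS ->
  \dim (freeext es L) = (2 ^ size es * \dim L)%N /\
  (freeext es L :&: soc es <= prodop es @: L)%VS.
Proof.
elim: es => [|e es IH] ac inj.
  by rewrite mul1n /= /soc big_nil capvf lim1g subvv.
have ac' := anticomm_cons ac; have [h1 h2] := ac.
have inj' : (L :&: lker (prodop es) = 0)%VS.
  apply/eqP; rewrite -subv0 -inj capvS //; apply/subvP => v.
  by rewrite !memv_ker prodop_cons => /eqP->; rewrite linear0.
have [dL sL] := IH ac' inj'; set L' := freeext es L in dL sL *.
have stL' : stable es L' := stable_freeext _ ac'.
have injE : (L' :&: lker e = 0)%VS.
  apply/eqP/negPn/negP => n0.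
  have [y y0] := socle_neq0 ac' (stableI stL' (stable_ker ac)) n0.
  rewrite !memv_cap -andbA => /and3P[yL ye ys].
  have /memv_imgP[b bL yb] : y \in (prodop es @: L)%VS.
    by apply: (subvP sL); rewrite memv_cap yL.
  have : b \in (L :&: lker (prodop (e :: es)))%VS.
    by rewrite memv_cap bL memv_ker prodop_cons -yb -memv_ker.
  by rewrite inj memv0 => /eqP b0; case/eqP: y0; rewrite yb b0 linear0.
have ker0 a : a \in L' -> e a = 0 -> a = 0.
  by move=> aL ea; apply/eqP; rewrite -memv0 -injE memv_cap aL memv_ker ea eqxx.
split.
  rewrite /= dimv_disjoint_sum; last first.
    apply/eqP; rewrite -subv0; apply/subvP => a /memv_capP[aL /memv_imgP[b bL E]].
    by rewrite memv0 (ker0 a) // E h1 ?mem_head.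
  by rewrite limg_dim_eq // -/L' dL expnS; lia.
apply/subvP => x; rewrite memv_cap => /andP[/memv_addP[a aL [_ /memv_imgP[b bL ->] ->]]].
move/socP => sx.
have a0 : a = 0.
  apply: ker0 => //; have := sx e (mem_head _ _).
  by rewrite linearD /= h1 ?mem_head // addr0.
rewrite a0 add0r in sx *; rewrite limg_comp memv_img // (subvP sL) // memv_cap bL.
apply/socP => f fe; apply: ker0; first exact: (stableP stL').
have := sx f; rewrite inE fe orbT => /(_ isT).
by rewrite (h2 f e) ?mem_head ?inE ?fe ?orbT // => /eqP; rewrite oppr_eq0 => /eqP.
Qed.

Lemma stable_cofree es N : anticomm es -> stable es (cofree es N).
Proof.
elim: es => //= e es IH ac; have ac' := anticomm_cons ac.
have [h1 h2] := ac; apply: stable_intro => f fe v.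
rewrite !memv_cap -!memv_preim => /andP[vN evN].
move: fe; rewrite inE => /orP[/eqP->|fe]; first by rewrite evN h1 ?mem_head // mem0v.
have st := stableP (IH ac') fe.
by rewrite st // (h2 e f) ?mem_head ?inE ?fe ?orbT // memvN st.
Qed.

Lemma cofree_sub es N : (cofree es N <= N)%VS.
Proof. by elim: es => //= e es; apply: subv_trans; apply: capvSl. Qed.

Lemma dim_lpreim e N : (\dim N <= \dim (e @^-1: N))%N.
Proof.
have := limg_ker_dim e (e @^-1: N)%VS; rewrite -lpreim_cap_limg lpreimK ?capvSr //.
rewrite (capv_idPr _); last by rewrite -lpreim0 lpreimS ?sub0v.
have := dimv_sum_cap N (limg e); have := limg_ker_dim e fullv; rewrite capfv.
have := dimvS (subvf (N + limg e)%VS); lia.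
Qed.

(** Each operator at most doubles the codimension, since a preimage has no larger codimension
    than the subspace itself. *)
Lemma dim_cofree es N :
  (\dim {:M} - \dim (cofree es N) <= 2 ^ size es * (\dim {:M} - \dim N))%N.
Proof.
elim: es => [|e es IH] /=; first by rewrite mul1n.
set N' := cofree es N in IH *; have := dimv_sum_cap N' (e @^-1: N')%VS.
have := dim_lpreim e N'; have := dimvS (subvf (N' + e @^-1: N')%VS).
rewrite expnS; lia.
Qed.

(** Free modules over an exterior algebra are injective, hence split off.  Here the complement is
    explicit: the largest stable subspace of a complement N of the image of the top product.  It
    misses the free part because it misses its socle, and the codimension bound makes the
    dimensions add up. *)
Lemma ext_decomp es L N : anticomm es ->
  (L :&: lker (prodop es) = 0)%VS -> (prodop es @: L)%VS = limg (prodop es) ->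
  (limg (prodop es) :&: N)%VS = 0%VS -> (limg (prodop es) + N)%VS = fullv ->
  [/\ (freeext es L :&: cofree es N)%VS = 0%VS,
      (freeext es L + cofree es N)%VS = fullv,
      \dim (freeext es L) = (2 ^ size es * \dim (limg (prodop es)))%N
    & forall v, v \in cofree es N -> prodop es v = 0].
Proof.
move=> ac inj sur dis ful; have [dL sL] := freeext_free ac inj.
set L' := freeext es L in dL sL *; set N' := cofree es N.
have stL : stable es L' by apply: stable_freeext.
have stN : stable es N' by apply: stable_cofree.
have cap0 : (L' :&: N')%VS = 0%VS.
  apply/eqP/negPn/negP => /(socle_neq0 ac (stableI stL stN))[y y0].
  rewrite !memv_cap -andbA => /and3P[yL yN ys]; case/negP: y0.
  rewrite -memv0 -dis memv_cap -sur (subvP sL) ?memv_cap ?yL //=.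
  exact: (subvP (cofree_sub es N)).
have dL0 : \dim L = \dim (limg (prodop es)) by rewrite -sur limg_dim_eq.
split=> //.
- apply/eqP; rewrite eqEdim subvf dimv_disjoint_sum // dL dL0.
  have := dim_cofree es N; rewrite -/N'.
  have := dimvS (subvf N'); have := dimv_sum_cap (limg (prodop es)) N.
  by rewrite dis ful dimv0; lia.
- by rewrite dL dL0.
move=> v vN; apply/eqP; rewrite -memv0 -cap0 memv_cap [X in _ && X]stable_prodop // andbT.
have : prodop es v \in (prodop es @: L)%VS by rewrite sur memv_img ?memvf.
by case/memv_imgP => l lL ->; apply: stable_prodop => //; apply: (subvP (freeext_sub _ _)).
Qed.

Lemma ext_decomp_exists es : anticomm es -> exists L N,
  [/\ stable es L, stable es N, (L :&: N)%VS = 0%VS, (L + N)%VS = fullv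
    & \dim L = (2 ^ size es * \dim (limg (prodop es)))%N /\
      forall v, v \in N -> prodop es v = 0].
Proof.
move=> ac; set L := (fullv :\: lker (prodop es))%VS; set N := (limg (prodop es))^C%VS.
have h1 : (L :&: lker (prodop es) = 0)%VS by rewrite /L capv_diff.
have h2 : (prodop es @: L)%VS = limg (prodop es) by rewrite /L limg_ker_compl.
have [a b c d] := ext_decomp ac h1 h2 (capv_compl _) (addv_complf _).
exists (freeext es L), (cofree es N); split=> //.
  exact: stable_freeext.
exact: stable_cofree.
Qed.

Lemma rank_prodop_le es : anticomm es ->
  (2 ^ size es * \dim (limg (prodop es)) <= \dim {:M})%N.
Proof.
move=> ac; have [L [N [_ _ _ _ [<- _]]]] := ext_decomp_exists ac.
exact/dimvS/subvf.
Qed.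

Lemma limg_aug e es : e \in es -> (limg e <= aug es)%VS.
Proof.
move=> ee; rewrite /aug (big_rem e) //=; exact: addvSl.
Qed.

Lemma aug_sub es Y : {in es, forall e, (limg e <= Y)%VS} -> (aug es <= Y)%VS.
Proof.
by move=> h; rewrite /aug big_seq; elim/big_rec: _ => [|e x ee xY];
  rewrite ?sub0v // subv_add h.
Qed.

(** The hypothesis says that M is free up to a complement of dimension one, and anticommuting
    operators of square zero vanish on a stable line.  So the socle and the top of M are those of
    a free module of rank f, enlarged by one dimension at most. *)
Lemma near_free es : anticomm es -> (0 < size es)%N ->
  let f := \dim (limg (prodop es)) in
  (2 ^ size es * f).+1 = \dim {:M} ->
  [/\ (\dim (soc es) <= f.+1)%N, (\dim {:M} <= \dim (aug es) + f.+1)%N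
    & exists z, z \in soc es /\ z \notin aug es].
Proof.
move=> ac es0; set p := prodop es; move=> f dM.
pose L0 := (fullv :\: lker p)%VS; pose N0 := (limg p)^C%VS.
have h1 : (L0 :&: lker p = 0)%VS by rewrite /L0 capv_diff.
have h2 : (p @: L0)%VS = limg p by rewrite /L0 limg_ker_compl.
have [cap0 sumf dL _] := ext_decomp ac h1 h2 (capv_compl _) (addv_complf _).
have [_ sL] := freeext_free ac h1.
have := stable_cofree N0 ac; have := stable_freeext L0 ac.
set L := freeext es L0 in cap0 sumf dL sL *; set N := cofree es N0 in cap0 sumf *.
move=> stL stN.
have dN : \dim N = 1%N.
  have := dimv_sum_cap L N; rewrite cap0 sumf dimv0 dL -dM -/f; lia.
have N0' : N != 0%VS by rewrite -dimv_eq0 dN.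
pose z := vpick N; have z0 : z != 0 by rewrite vpick0.
have zN : z \in N := memv_pick N.
have Nz : N = <[z]>%VS by apply/eqP; rewrite eq_sym eqEdim -memvE zN dN dim_vline z0.
have [h3 _] := ac.
have zs : z \in soc es.
  apply/socP => e ee; have := stableP stN ee zN; rewrite Nz => /vlineP[c ez].
  have := h3 e ee z; rewrite ez linearZ /= ez scalerA => /eqP.
  by rewrite scaler_eq0 (negPf z0) orbF mulf_eq0 orbb => /eqP->; rewrite scale0r.
have augL : (aug es <= L)%VS.
  apply: aug_sub => e ee; apply/subvP => _ /memv_imgP[v _ ->].
  have : v \in (L + N)%VS by rewrite sumf memvf.
  case/memv_addP => l lL [n]; rewrite Nz => /vlineP[c ->] ->.
  by rewrite linearD linearZ /= (socP _ _ zs) // scaler0 addr0 (stableP stL).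
have dL0 : \dim L0 = f by rewrite /f -h2 limg_dim_eq.
split.
- suff: (soc es <= limg p + N)%VS.
    move/dimvS/leq_trans; apply; rewrite -addn1 -dN.
    by have := dimv_sum_cap (limg p) N; rewrite -/f; lia.
  apply/subvP => x xs; have : x \in (L + N)%VS by rewrite sumf memvf.
  case/memv_addP => l lL [n nN xE]; rewrite xE memv_add // -h2.
  apply: (subvP sL); rewrite memv_cap lL; apply/socP => e ee.
  have/socP/(_ e ee) := xs; rewrite xE linearD /= => /eqP; rewrite addr_eq0 => /eqP E.
  apply/eqP; rewrite -memv0 -cap0 memv_cap (stableP stL) //=.
  by rewrite E memvN (stableP stN).
- have : (fullv <= aug es + (L0 + N))%VS.
    have sub : (L <= aug es + L0)%VS.
      suff: forall es', {subset es' <= es} -> (freeext es' L0 <= aug es + L0)%VS.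
        by apply.
      elim=> [|e es' IH] h /=; first exact: addvSr.
      rewrite subv_add IH => [|f' f'e]; last by apply: h; rewrite inE f'e orbT.
      rewrite (subv_trans (limgS _ (subvf _))) // (subv_trans _ (addvSl _ _)) //.
      by rewrite limg_aug // h ?mem_head.
    by rewrite -sumf addvA addvS.
  move/dimvS/leq_trans; apply.
  have := dimv_sum_cap (aug es) (L0 + N)%VS; have := dimv_sum_cap L0 N.
  by rewrite dL0 dN; lia.
exists z; split=> //; apply: contra z0 => za.
by rewrite -memv0 -cap0 memv_cap zN (subvP augL).
Qed.

End Exterior.

(** * Restriction to a stable subspace *)

Section Restriction.
Variables (k : fieldType) (M : vectType k) (U : {vspace M}).
Implicit Types (e : 'End(M)) (es : seq 'End(M)).

Definition restr e : 'End(subvs_of U) := linfun (fun u => vsproj U (e (vsval u))).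
Definition incl : 'Hom(subvs_of U, M) := linfun vsval.

Lemma inclE u : incl u = vsval u.
Proof. by rewrite lfunE. Qed.

Lemma incl_inj : lker incl = 0%VS.
Proof. by apply/eqP/lker0P => u v; rewrite !inclE => /subvs_inj. Qed.

Lemma limg_incl : limg incl = U.
Proof.
apply/eqP; rewrite eqEsubv; apply/andP; split; apply/subvP => v.
  by case/memv_imgP => u _ ->; rewrite inclE subvsP.
by move=> vU; rewrite -(vsprojK vU) -inclE memv_img ?memvf.
Qed.

Lemma restr_fE e u : restr e u = vsproj U (e (vsval u)).
Proof. by rewrite linfun_lin // => c x y; rewrite !linearP. Qed.

Lemma restrE e u : (e @: U <= U)%VS -> vsval (restr e u) = e (vsval u).
Proof.
move=> st; rewrite restr_fE vsprojK //; apply: (subvP st).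
by rewrite memv_img ?subvsP.
Qed.

Lemma restr_linear : linear restr.
Proof.
move=> c e f; apply/lfunP => u.
by rewrite add_lfunE scale_lfunE !restr_fE add_lfunE scale_lfunE linearP.
Qed.

Lemma dim_limg_restr e (f : 'End(subvs_of U)) :
  (forall u, vsval (f u) = e (vsval u)) -> \dim (limg f) = \dim (e @: U).
Proof.
move=> h; rewrite -(@limg_dim_eq _ _ _ incl); last by rewrite incl_inj capv0.
congr (\dim _); rewrite -limg_comp -[in RHS]limg_incl -limg_comp.
by apply: eq_in_limg => u _; rewrite !comp_lfunE !inclE h.
Qed.

Lemma dim_subvs : \dim {:subvs_of U} = \dim U.
Proof.
by rewrite -[in RHS]limg_incl limg_dim_eq // incl_inj capv0.
Qed.

Lemma prodop_restr es u : stable es U ->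
  vsval (prodop [seq restr e | e <- es] u) = prodop es (vsval u).
Proof.
elim: es => [|e es IH] st; first by rewrite /= !id_lfunE.
rewrite !prodop_cons restrE ?st ?mem_head // IH // => f fe.
by apply: st; rewrite inE fe orbT.
Qed.

Lemma anticomm_restr es : anticomm es -> stable es U -> anticomm [seq restr e | e <- es].
Proof.
move=> [h1 h2] st; split=> [_ /mapP[e ee ->] v|_ _ /mapP[e ee ->] /mapP[f fe ->] v].
  by apply: subvs_inj; rewrite !restrE ?st // h1 // linear0.
by apply: subvs_inj; rewrite linearN /= !restrE ?st // h2.
Qed.

Lemma rank_prodop_img es : anticomm es -> stable es U ->
  (2 ^ size es * \dim (prodop es @: U) <= \dim U)%N.
Proof.
move=> ac st; have := rank_prodop_le (anticomm_restr ac st).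
rewrite size_map dim_subvs (@dim_limg_restr (prodop es)) // => u.
exact: prodop_restr.
Qed.

End Restriction.

(** * A net of products of anticommuting operators *)

Section CoreStep.
Variables (k : closedFieldType) (M : vectType k).

(** Products of all but one of the operators induce maps from the top A = M / aug to the socle.
    By [near_free] both have dimension f or f + 1, and x1, x2, x3 give a net of such maps of rank
    at least f.  If A or the socle has dimension f, then [square_pencil_trivial] or [net_trivial]
    gives f = 0; if both have dimension f + 1, then M contains a trivial direct summand, spanned
    by z, and removing it reduces to the square case. *)
Lemma core_step (x1 x2 x3 : 'End(M)) (W : seq 'End(M)) (f : nat)
    (p := prodop W) (w1 := (x2 \o x3 \o p)%VF) (w2 := (x1 \o x3 \o p)%VF)
    (w3 := (x1 \o x2 \o p)%VF) :
  anticomm [:: x1, x2, x3 & W] ->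
  (forall v, prodop [:: x1, x2, x3 & W] v = 0) ->
  (2 ^ (size W).+2 * f).+1 = \dim {:M} ->
  (forall s t u, (s, t, u) != (0, 0, 0) ->
     (f <= \dim (limg (s *: w1 + t *: w2 + u *: w3)%R))%N) -> f = 0%N.
Proof.
move=> ac p0 dM rk; set es := [:: x1, x2, x3 & W] in ac p0.
have [sq an] := ac; set y := [:: x2, x3 & W].
have acy : anticomm y by apply: anticomm_cons ac.
have w1E : prodop y = w1 by rewrite /y /= /w1 comp_lfunA.
have rky : \dim (limg (prodop y)) = f.
  have := rank_prodop_le acy; rewrite w1E -dM.
  have := rk 1 0 0; rewrite !xpair_eqE oner_eq0 => /(_ isT).
  rewrite scale1r !scale0r !addr0 /= => le1 le2; apply/eqP; rewrite eqn_leq le1 andbT.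
  have := expn_gt0 2 (size W).+2; move: le2; set c := (2 ^ _)%N; set r := \dim _ => le2 c0.
  rewrite leqNgt; apply/negP => fr; have : (c * f.+1 <= c * r)%N by rewrite leq_mul2l fr orbT.
  have : (1 < c)%N by rewrite /c expnS; have := expn_gt0 2 (size W).+1; lia.
  by rewrite mulnS; lia.
have [socy augy [z [zs za]]] := near_free acy isT (etrans (congr1 (fun r => (_ * r).+1) rky) dM).
rewrite rky in socy augy.
have w2E : prodop [:: x1, x3 & W] = w2 by rewrite /= /w2 comp_lfunA.
have w3E : prodop [:: x1, x2 & W] = w3 by rewrite /= /w3 comp_lfunA.
have kl e v : e \in es -> [/\ e (w1 v) = 0, e (w2 v) = 0 & e (w3 v) = 0].
  move=> ee; rewrite -w1E -w2E -w3E /=.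
  have i1 : x1 \in es by rewrite mem_head.
  have i2 : x2 \in es by rewrite !inE eqxx orbT.
  have i3 : x3 \in es by rewrite !inE eqxx !orbT.
  have h x x' v' : x \in es -> x' \in es -> e (x (x' (p v'))) =
      x (x' (e (p v'))).
    by move=> xe xe'; rewrite (an e x) // (an e x') // linearN opprK.
  have pW e' v' : e' \in W -> e' (p v') = 0.
    by apply: prodop_kill_l; do 3 apply: anticomm_cons; apply: ac.
  have e0 : x1 (x2 (x3 (p v))) = 0 by have := p0 v; rewrite /es !prodop_cons.
  rewrite !comp_lfunE -/p; move: ee; rewrite !inE => /or4P[/eqP->|/eqP->|/eqP->|eW].
  - by split; rewrite ?sq.
  - split; rewrite ?sq //; last by rewrite (an x2 x1) // sq // linear0 oppr0.
    by rewrite (an x2 x1) // e0 oppr0.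
  - split; [|by rewrite (an x3 x1) // sq // linear0 oppr0|].
      by rewrite (an x3 x2) // sq // linear0 oppr0.
    by rewrite (an x3 x1) // (an x3 x2) // linearN opprK.
  - by rewrite !(h _ _ v) ?inE ?eqxx ?orbT // !pW // !linear0.
have kr e v : e \in es -> [/\ w1 (e v) = 0, w2 (e v) = 0 & w3 (e v) = 0].
  move=> ee; have [k1 k2 k3] := kl e v ee.
  have h := anticomm_all ac ee.
  rewrite -w1E -w2E -w3E; split; rewrite prodop_comm ?w1E ?w2E ?w3E ?k1 ?k2 ?k3 ?scaler0 //;
    by move=> g ge; apply: h; move: ge; rewrite !inE => /or3P[->|->|->]; rewrite ?orbT.
pose phi s t u := s *: w1 + t *: w2 + u *: w3.
have phiI s t u : (phi s t u @: aug es = 0)%VS.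
  apply/eqP; rewrite -lkerE; apply: aug_sub => e ee; apply/subvP => _ /memv_imgP[v _ ->].
  have [r1 r2 r3] := kr e v ee.
  by rewrite memv_ker !add_lfunE !scale_lfunE r1 r2 r3 !scaler0 !addr0.
have wS w : w \in [:: w1; w2; w3] -> (limg w <= soc es)%VS.
  move=> hw; apply/subvP => _ /memv_imgP[v _ ->]; apply/socP => e ee.
  by have [r1 r2 r3] := kl e v ee; move: hw; rewrite !inE => /or3P[]/eqP->.
have [sub1 sub2 sub3] : [/\ limg w1 <= soc es, limg w2 <= soc es & limg w3 <= soc es]%VS.
  by rewrite !wS // !inE eqxx ?orbT.
have socS : (soc es <= soc y)%VS.
  by rewrite [soc es]/soc big_cons capvSr.
have augS : (aug y <= aug es)%VS.
  by rewrite [aug es]/aug big_cons addvSr.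
(* a complement of aug stands for the quotient, as every phi s t u kills aug *)
pose A := (aug es)^C%VS.
have phiA s t u : (phi s t u @: A = limg (phi s t u))%VS.
  by rewrite -(addv_complf (aug es)) limgD phiI add0v.
have sA w : w \in [:: w1; w2; w3] -> (w @: A <= soc es)%VS.
  by move/wS; apply: subv_trans; apply/limgS/subvf.
have [sA1 sA2 sA3] : [/\ w1 @: A <= soc es, w2 @: A <= soc es & w3 @: A <= soc es]%VS.
  by rewrite !sA // !inE eqxx ?orbT.
have dA : \dim A = (\dim {:M} - \dim (aug es))%N by rewrite dimv_compl.
have dA1 : (\dim A <= f.+1)%N by have := dimvS augS; clear -dA augy; lia.
have dA0 : (f <= \dim A)%N.
  apply: leq_trans (rk 1 0 0 _) _; first by rewrite !xpair_eqE oner_eq0.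
  by rewrite -[_ + _]/(phi 1 0 0) -phiA; have := limg_ker_dim (phi 1 0 0) A; clear; lia.
have dB1 : (\dim (soc es) <= f.+1)%N by apply: leq_trans (dimvS socS) _.
have dB0 : (f <= \dim (soc es))%N.
  apply: leq_trans (rk 1 0 0 _) _; first by rewrite !xpair_eqE oner_eq0.
  rewrite !scale0r !addr0 scale1r; exact/dimvS.
have rk' s t u : (s, t, u) != (0, 0, 0) -> (f <= \dim (phi s t u @: A))%N.
  by rewrite phiA; apply: rk.
have rk2 s t : (s, t) != (0, 0) -> (f <= \dim ((s *: w1 + t *: w2)%R @: A))%N.
  move=> h; have := rk' s t 0; rewrite /phi scale0r addr0; apply.
  by move: h; rewrite !xpair_eqE eqxx andbT.
have [eA|eA] := eqVneq (\dim A) f; have [eB|eB] := eqVneq (\dim (soc es)) f.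
- rewrite -eA; apply: (square_pencil_trivial _ sA1 sA2); first by rewrite eA eB.
  by rewrite eA.
- by apply: (net_trivial _ sA1 sA2 sA3) rk'; right; clear -eA dB0 dB1 eB; lia.
- by apply: (net_trivial _ sA1 sA2 sA3) rk'; left; clear -eB dA0 dA1 eA; lia.
have augE : aug es = aug y.
  by apply/eqP; rewrite eq_sym eqEdim augS; clear -dA dA0 dA1 eA augy; lia.
have zs' : z \in soc es.
  suff -> : soc es = soc y by [].
  by apply/eqP; rewrite eqEdim socS; clear -socy dB0 dB1 eB; lia.
(* from here on both dimensions are f + 1 and z is a socle element outside aug *)
rewrite -augE in za; pose B := (soc es :&: aug es)%VS.
pose C := (aug es + <[z]>)^C%VS.
have z0 : z != 0 by apply: contraNneq za => ->; rewrite mem0v.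
have dZ : \dim (aug es + <[z]>)%VS = (\dim (aug es)).+1.
  rewrite dimv_disjoint_sum ?dim_vline ?z0 ?addn1 //.
  apply/eqP; rewrite -subv0; apply/subvP => v /memv_capP[va /vlineP[c vz]].
  rewrite memv0 vz scaler_eq0 (negPf z0) orbF; apply: contraR za => c0.
  by rewrite -[z](scalerK c0) -vz memvZ.
have dC : \dim C = f by rewrite dimv_compl dZ; clear -dA dA0 dA1 eA; lia.
have phiC s t u : (phi s t u @: C = limg (phi s t u))%VS.
  rewrite -(addv_complf (aug es + <[z]>)) !limgD phiI add0v.
  have -> : (phi s t u @: <[z]> = 0)%VS; last by rewrite add0v.
  rewrite limg_line; suff -> : phi s t u z = 0 by [].
  have zk es' : (0 < size es')%N -> {subset es' <= es} -> prodop es' z = 0.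
    move=> h sub; apply: prodop_soc => //; apply/socP => e ee.
    by apply: (socP _ _ zs'); apply: sub.
  rewrite /phi !add_lfunE !scale_lfunE -w1E -w2E -w3E !zk ?scaler0 ?addr0 // => g;
    by rewrite !inE => /or3P[->|->|->]; rewrite ?orbT.
have dB : (\dim B <= f)%N.
  rewrite -ltnS; apply: leq_trans dB1; rewrite ltn_neqAle dimvS ?capvSl // andbT.
  apply: contra za => h; have : B == soc es by rewrite eqEdim capvSl (eqP h) leqnn.
  by move/eqP => E; have := zs'; rewrite -E memv_cap => /andP[].
have augi x : x \in es -> forall v, x v \in aug es.
  by move=> xe v; apply: (subvP (limg_aug xe)); rewrite memv_img ?memvf.
have wB w : w \in [:: w1; w2; w3] -> (w @: C <= B)%VS.
  move=> hw; rewrite subv_cap (subv_trans (limgS _ (subvf _)) (wS w hw)) /=.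
  apply/subvP => _ /memv_imgP[v _ ->]; move: hw.
  rewrite !inE => /or3P[]/eqP->; rewrite /w1 /w2 /w3 !comp_lfunE augi //;
    by rewrite !inE eqxx ?orbT.
have wC s t : (s, t) != (0, 0) -> (f <= \dim ((s *: w1 + t *: w2)%R @: C))%N.
  move=> h; have := rk s t 0; rewrite -[_ + _]/(phi s t 0) -phiC /phi scale0r addr0.
  by apply; move: h; rewrite !xpair_eqE eqxx andbT.
have sB1 : (w1 @: C <= B)%VS by apply: wB; rewrite inE eqxx.
have sB2 : (w2 @: C <= B)%VS by apply: wB; rewrite !inE eqxx orbT.
rewrite -dC; apply: (square_pencil_trivial _ sB1 sB2); last by rewrite dC.
apply/eqP; rewrite dC eqn_leq dB andbT.
apply: leq_trans (wC 1 0 _) _; first by rewrite xpair_eqE oner_eq0.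
by apply/dimvS/img_comb2_sub.
Qed.
End CoreStep.

(** * Induction on the length of the product *)

Section Family.
Variables (k : closedFieldType) (V M : vectType k) (E : 'Hom(V, 'End(M))).
Hypothesis sqE : forall x v, E x (E x v) = 0.
Implicit Types (X Y : seq V).

Lemma fam_anti x y v : E x (E y v) = - E y (E x v).
Proof.
have := sqE (x + y) v; rewrite !linearD !add_lfunE !linearD /= !sqE add0r addr0.
by move/eqP; rewrite addr_eq0 => /eqP.
Qed.

Lemma fam_anticomm X : anticomm [seq E x | x <- X].
Proof.
split=> [_ /mapP[x _ ->] v|_ _ /mapP[x _ ->] /mapP[y _ ->] v]; first exact: sqE.
exact: fam_anti.
Qed.

Lemma stable_span X (U : {vspace M}) : stable [seq E x | x <- X] U ->
  forall y, y \in <<X>>%VS -> (E y @: U <= U)%VS.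
Proof.
move=> st y yX; apply/subvP => _ /memv_imgP[v vU ->].
rewrite [y](coord_span (X := in_tuple X)) // linear_sum sum_lfunE memv_suml // => i _.
rewrite linearZ scale_lfunE memvZ // (stableP st) //.
by apply: map_f; apply: mem_nth; have := ltn_ord i.
Qed.

(** Over the exterior algebra of any j independent elements, M is free up to one extra
    dimension. *)
Definition has_rank j := forall X, free X -> size X = j ->
  (2 ^ j * \dim (limg (prodop [seq E x | x <- X]))).+1 = \dim {:M}.

(** Every bivector over a three-dimensional space is decomposable, so each nonzero member of the
    net is again a multiple of a product of independent operators. *)
Lemma net_product x1 x2 x3 W s t u (es := [seq E x | x <- W]) (p := prodop es) :
  free [:: x1, x2, x3 & W] -> (s, t, u) != (0, 0, 0) ->
  exists c Y, [/\ c != 0, free Y, size Y = (size W).+2,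
    {subset Y <= <<[:: x1, x2, x3 & W]>>%VS} &
    s *: (E x2 \o E x3 \o p)%VF + t *: (E x1 \o E x3 \o p)%VF
     + u *: (E x1 \o E x2 \o p)%VF = c *: prodop [seq E x | x <- Y]].
Proof.
move=> fX stu.
have := fX; rewrite !free_cons => /and4P[n1 n2 n3 fW].
have Wsub x : x \in W -> x \in <<[:: x1, x2, x3 & W]>>%VS.
  by move=> xW; apply: memv_span; rewrite !inE xW !orbT.
have [h1 h2 h3] : [/\ x1 \in <<[:: x1, x2, x3 & W]>>%VS,
    x2 \in <<[:: x1, x2, x3 & W]>>%VS & x3 \in <<[:: x1, x2, x3 & W]>>%VS].
  by rewrite !memv_span // !inE !eqxx ?orbT.
have spanS x v X : x \in <<X>>%VS -> x \in <<v :: X>>%VS.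
  by move=> h; rewrite span_cons (subvP (addvSr _ _)).
(* s x2 x3 + t x1 x3 = (s x2 + t x1) x3 *)
have [u0|u0] := eqVneq u 0.
  pose y := s *: x2 + t *: x1; exists 1, [:: y, x3 & W].
  split; rewrite ?oner_eq0 //.
  - rewrite !free_cons n3 fW !andbT; move: stu; rewrite u0 !xpair_eqE eqxx andbT.
    have [t0|t0 _] := eqVneq t 0.
      rewrite andbT /y t0 scale0r addr0 => s0.
      by apply: contra n2 => /(memvZ s^-1); rewrite scalerK.
    apply: contra n1 => yW; rewrite -[x1](scalerK t0) memvZ //.
    have -> : t *: x1 = y - s *: x2 by rewrite /y addrC addKr.
    by apply: memvB; [exact: spanS|rewrite memvZ // memv_span // mem_head].
  - move=> z; rewrite !inE => /or3P[/eqP->|/eqP->|/Wsub//] //.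
    by rewrite memvD // memvZ.
  rewrite u0 scale0r addr0 scale1r /y; apply/lfunP => v.
  by rewrite /= !lfun_simp linearD !linearZ !lfun_simp.
(* u y1 y2 = u x1 x2 + t x1 x3 + s x2 x3 *)
pose y1 := x1 - (u^-1 * s) *: x3; pose y2 := x2 + (u^-1 * t) *: x3.
exists u, [:: y1, y2 & W]; split=> //.
- rewrite !free_cons fW !andbT; apply/andP; split.
    apply: contra n1 => yW; rewrite -[x1](subrK ((u^-1 * s) *: x3)) memvD //; last first.
      by rewrite memvZ // memv_span // !inE eqxx orbT.
    rewrite -/y1; move: yW; apply/subvP; rewrite span_cons subv_add -memvE.
    apply/andP; split; first by rewrite memvD ?memvZ // memv_span // !inE eqxx ?orbT.
    by apply: sub_span => z zW; rewrite !inE zW !orbT.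
  apply: contra n2 => yW; rewrite -[x2](addrK ((u^-1 * t) *: x3)).
  apply: memvB; first exact: spanS.
  by rewrite memvZ // memv_span // mem_head.
- move=> z; rewrite !inE => /or3P[/eqP->|/eqP->|/Wsub//] //.
    by rewrite memvB // memvZ.
  by rewrite memvD // memvZ.
apply/lfunP => v; rewrite /= -/es -/p.
rewrite !(lfun_simp, linearD, linearN, linearZ) /=.
rewrite !(lfun_simp, linearD, linearN, linearZ) /= -!/p.
set v' := p v; rewrite [E x3 (E x2 _)]fam_anti sqE !(scaler0, scalerDr, scalerN, scalerA, opprK, oppr0, addr0).
rewrite !mulrA divff // !mul1r.
by rewrite mulrAC mulVf // mul1r [RHS]addrC [u *: _ + _]addrC addrA.
Qed.

(** Split off the free part L for j + 1 operators.  On the complement N the product of all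
    of them is zero, while by induction the products of j of them have rank at least f = r - 2 g,
    and dim N = 2^j f + 1.  Then [core_step] yields f = 0, which is the claim. *)
Lemma has_rank_step j : (1 < j)%N -> has_rank j -> has_rank j.+1.
Proof.
case: j => [//|[//|n]] _ IH X fX sX.
case: X fX sX => [//|x1 [//|x2 [//|x3 W]]] fX [sW].
set X := [:: x1, x2, x3 & W]; set es := [seq E x | x <- X].
have ac : anticomm es by apply: fam_anticomm.
have [L [N [stL stN cap0 sumf [dL pN]]]] := ext_decomp_exists ac.
set g := \dim (limg (prodop es)) in dL *.
have dLN : (\dim L + \dim N = \dim {:M})%N by rewrite -dimv_disjoint_sum // sumf.
rewrite size_map [size X]/= sW in dL.
have rk Y : free Y -> size Y = n.+2 -> {subset Y <= <<X>>%VS} ->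
    (\dim (limg (prodop [seq E x | x <- Y])) <=
     2 * g + \dim (prodop [seq E x | x <- Y] @: N))%N.
  move=> fY sY subY; rewrite -sumf limgD.
  have stLY : stable [seq E x | x <- Y] L.
    by move=> _ /mapP[y yY ->]; apply: stable_span stL _ (subY y yY).
  have := rank_prodop_img (fam_anticomm Y) stLY; rewrite size_map sY dL.
  rewrite [(2 ^ n.+3)%N]expnSr -mulnA leq_pmul2l ?expn_gt0 //.
  set a := (_ @: L)%VS; set b := (_ @: N)%VS => le.
  by have := dimv_sum_cap a b; lia.
have [y0 fy0] : exists Y, free Y /\ size Y = n.+2.
  exists [:: x2, x3 & W]; split; last by rewrite /= sW.
  by move: fX; rewrite free_cons => /andP[].
case: fy0 => fy0 sy0; have dM := IH _ fy0 sy0.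
set r := \dim (limg (prodop [seq E x | x <- y0])) in dM.
have IHr Y : free Y -> size Y = n.+2 -> \dim (limg (prodop [seq E x | x <- Y])) = r.
  move=> fY sY; have := IH _ fY sY; rewrite -dM => -[] /eqP.
  by rewrite eqn_pmul2l ?expn_gt0 // => /eqP.
have c0 := expn_gt0 2 n.+2; have e3 : (2 ^ n.+3 = 2 ^ n.+2 * 2)%N by rewrite expnSr.
have c2 : (1 < 2 ^ n.+2)%N by rewrite -[1%N](expn0 2) ltn_exp2l.
have gr : (2 * g <= r)%N.
  rewrite leqNgt; apply/negP => rg.
  have : (2 ^ n.+2 * r.+1 <= \dim L)%N by rewrite dL e3 -mulnA leq_mul2l rg orbT.
  rewrite mulnS; move: dM c2 dLN; set c := (2 ^ n.+2)%N; set d := (c * r)%N.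
  by move: (c) (d) (\dim L) (\dim N) (\dim {:M}); lia.
pose f := (r - 2 * g)%N.
have dN : \dim N = (2 ^ n.+2 * f).+1.
  have : (2 ^ n.+2 * (2 * g) <= 2 ^ n.+2 * r)%N by rewrite leq_mul2l gr orbT.
  rewrite /f mulnBr; have : (\dim L = 2 ^ n.+2 * (2 * g))%N by rewrite dL e3 mulnA.
  move: dM dLN; set c := (2 ^ n.+2 * (2 * g))%N; set d := (2 ^ n.+2 * r)%N.
  by move: (c) (d) (\dim L) (\dim N) (\dim {:M}); lia.
suff f0 : f = 0%N.
  by move: dN; rewrite f0 muln0; lia.
pose rs e := restr N e.
have ac' : anticomm [:: rs (E x1), rs (E x2), rs (E x3) & [seq rs e | e <- [seq E x | x <- W]]].
  exact: (anticomm_restr ac stN).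
have pW u : vsval (prodop [seq rs e | e <- [seq E x | x <- W]] u) =
    prodop [seq E x | x <- W] (vsval u).
  by apply: prodop_restr => e ee; apply: stN; rewrite !inE ee !orbT.
have sE x u : x \in X -> vsval (rs (E x) u) = E x (vsval u).
  by move=> xX; apply: restrE; apply: stN; apply: map_f.
have [i1 i2 i3] : [/\ x1 \in X, x2 \in X & x3 \in X] by rewrite !inE !eqxx ?orbT.
apply: (core_step ac').
- move=> v; apply: subvs_inj; rewrite linear0.
  by rewrite (@prodop_restr _ _ N es) ?pN ?subvsP.
- by rewrite !size_map sW dim_subvs dN.
move=> s t u stu; have [c [Y [cn fY sY subY e]]] := net_product fX stu.
have h : (\dim ((c *: prodop [seq E x | x <- Y])%R @: N) = \dim (prodop [seq E x | x <- Y] @: N))%N.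
  congr (\dim _); apply/vspaceP => v; apply/memv_imgP/memv_imgP => -[w wN ->].
    by exists (c *: w); rewrite ?memvZ // scale_lfunE linearZ.
  by exists (c^-1 *: w); rewrite ?memvZ // scale_lfunE linearZ /= scalerA mulfV ?scale1r.
rewrite (@dim_limg_restr _ _ N (c *: prodop [seq E x | x <- Y])).
  rewrite h; have := rk Y fY (etrans sY _) subY; rewrite sW => /(_ erefl).
  by rewrite IHr ?sY ?sW // /f; lia.
move=> v; rewrite -e !(add_lfunE, scale_lfunE, comp_lfunE) !linearD !linearZ /=.
by rewrite !sE // !pW.
Qed.
End Family.

(** * Generic ranks *)

Lemma dim_limg_le (k : fieldType) (M N : vectType k) (f : 'Hom(M, N)) U :
  (\dim (f @: U) <= \dim U)%N.
Proof. by rewrite -(limg_ker_dim f U) leq_addl. Qed.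

Section GenericRank.
Variables (k : closedFieldType) (M N : vectType k) (phi psi : 'Hom(M, N)).
Variable A : {vspace M}.

Lemma endo_eigenvalues_finite (T : vectType k) (G : 'End(T)) :
  exists rs : seq k, forall c, c \notin rs -> forall u, G u = c *: u -> u = 0.
Proof.
pose X := vbasis {:T}; have bX : basis_of {:T} X := vbasisP _.
have [rs crs] := closed_field_poly_normal (char_poly (passmx.mxof X X G)).
exists rs => // c cr u Gu; apply/eqP; apply: contraR cr => u0.
suff: root (char_poly (passmx.mxof X X G)) c.
  have /monicP m := char_poly_monic (passmx.mxof X X G).
  by rewrite crs m scale1r root_prod_XsubC.
rewrite -eigenvalue_root_char; apply/eigenvalueP; exists (passmx.rVof X u).
  rewrite -passmx.rVof_app // Gu -[c *: u]addr0 passmx.rVof_linear.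
  by rewrite (_ : passmx.rVof X 0 = 0) ?addr0 //; apply/eqP; rewrite passmx.rVof_eq0.
by rewrite passmx.rVof_eq0.
Qed.

(** On a complement of ker phi, psi - c phi has a kernel only if c is an eigenvalue of
    phi^-1 psi, where phi^-1 is a retraction. *)
Lemma pencil_generic_rank :
  exists rs : seq k, forall c, c \notin rs ->
    (\dim (phi @: A) <= \dim ((psi - c *: phi)%R @: A))%N.
Proof.
pose A' := (A :\: lker phi)%VS.
pose f := (phi \o incl A')%VF; pose h := (psi \o incl A')%VF.
have f0 : lker f == 0%VS.
  rewrite -subv0; apply/subvP => u; rewrite memv_ker memv0 comp_lfunE inclE => fu.
  have : vsval u \in (A' :&: lker phi)%VS by rewrite memv_cap subvsP memv_ker.
  by rewrite capv_diff memv0 => /eqP u0; apply/eqP/subvs_inj; rewrite u0 linear0.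
have [rs hrs] := endo_eigenvalues_finite (f^-1 \o h)%VF.
exists rs => // c /hrs hc; rewrite -limg_ker_compl -/A'.
have -> : \dim (phi @: A') = \dim A' by rewrite limg_dim_eq // capv_diff.
apply: leq_trans (dimvS (limgS _ (diffvSl A (lker phi)))); rewrite -/A'.
rewrite [X in (_ <= \dim X)%N](_ : _ = limg ((psi - c *: phi) \o incl A')); last first.
  by rewrite limg_comp limg_incl.
rewrite limg_dim_eq ?dim_subvs //; apply/eqP; rewrite -subv0; apply/subvP => u.
rewrite memv_cap memvf memv_ker memv0 comp_lfunE add_lfunE opp_lfunE scale_lfunE subr_eq0 /=.
move/eqP => e; apply/eqP/hc; rewrite comp_lfunE /h comp_lfunE e linearZ /=.
by congr (_ *: _); rewrite -[phi _]comp_lfunE lker0_lfunK.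
Qed.

Lemma pencil_generic_rank_inv :
  exists rs : seq k, forall c, c != 0 -> c \notin rs ->
    (\dim (phi @: A) <= \dim ((phi - c *: psi)%R @: A))%N.
Proof.
have [rs hrs] := pencil_generic_rank; exists [seq z^-1 | z <- rs] => // c c0 cr.
have : c^-1 \notin rs by apply: contra cr => h; rewrite -[c]invrK map_f.
move/hrs/leq_trans; apply; apply/dimvS/subvP => _ /memv_imgP[v vA ->].
have -> : (psi - c^-1 *: phi) v = (phi - c *: psi) (- c^-1 *: v).
  rewrite !(add_lfunE, opp_lfunE, scale_lfunE) !linearZ /= !scalerA.
  by rewrite mulrN mulfV // scaleN1r opprK scalerN scaleNr addrC.
by rewrite memv_img // memvZ.
Qed.

Lemma avoid_finite (rs : seq k) : exists c, c \notin rs.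
Proof.
have p0 : \prod_(z <- rs) ('X - z%:P) != 0 by apply/monic_neq0/monic_prod_XsubC.
have [c] := closed_nonrootP _ p0.
by rewrite root_prod_XsubC; exists c.
Qed.
End GenericRank.

(** * Graded decompositions *)

Section Graded.
Variables (k : fieldType) (M : superspace k).
Implicit Types (U : {vspace M}) (e : 'End(M)) (es : seq 'End(M)).

Definition homog U := forall i u, u \in U -> prj M i u \in U.
Definition oddend e := forall i v, v \in gr M i -> e v \in gr M (~~ i).

Lemma prj_odd e i v : oddend e -> prj M i (e v) = e (prj M (~~ i) v).
Proof.
move=> oe; rewrite -[in LHS](prj_add v) !linearD /=.
have h j : prj M i (e (prj M j v)) = if ~~ j == i then e (prj M j v) else 0.
  exact: prj_gr (oe _ _ (memv_prj _ _)).
by rewrite !h; clear h; case: i => /=; rewrite ?addr0 ?add0r.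
Qed.

Lemma homogE U : homog U -> (U :&: gr M false + U :&: gr M true)%VS = U.
Proof.
move=> hU; apply/eqP; rewrite eqEsubv subv_add !capvSl /=; apply/subvP => u uU.
by rewrite -(prj_add u) memv_add // memv_cap memv_prj hU.
Qed.

Lemma dim_homog U : homog U ->
  \dim U = (\dim (U :&: gr M false) + \dim (U :&: gr M true))%N.
Proof.
move=> hU; rewrite -[in LHS](homogE hU) dimv_disjoint_sum //.
apply/eqP; rewrite -subv0 -(gr_cap M) capvS ?capvSr //.
Qed.

Lemma dim_gr : \dim {:M} = (\dim (gr M false) + \dim (gr M true))%N.
Proof. by rewrite dim_homog ?capfv // => i u _; rewrite memvf. Qed.

Lemma homog_compl U : homog U -> exists N, [/\ homog N, (U :&: N = 0)%VS & (U + N)%VS = fullv].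
Proof.
move=> hU; pose D i := (gr M i :\: U)%VS; exists (D false + D true)%VS.
have prD i j u : u \in D i -> prj M j u = if i == j then u else 0.
  by move=> uD; apply: prj_gr; apply: (subvP (diffvSl _ U)).
split.
- move=> i u /memv_addP[a aD [b bD ->]]; rewrite linearD /= (prD _ _ _ aD) (prD _ _ _ bD).
  case: i; rewrite /= ?addr0 ?add0r; first exact: (subvP (addvSr _ _)).
  exact: (subvP (addvSl _ _)).
- apply/eqP; rewrite -subv0; apply/subvP => u /memv_capP[uU].
  case/memv_addP => a aD [b bD uE].
  have z i c : c \in D i -> prj M i u = c -> c = 0.
    move=> cD pc; apply/eqP; rewrite -memv0 -(capv_diff (gr M i) U) memv_cap cD -pc.
    exact: hU.
  have a0 : a = 0.
    by apply: (z _ _ aD); rewrite uE linearD /= (prD _ _ _ aD) (prD _ _ _ bD) addr0.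
  have b0 : b = 0.
    by apply: (z _ _ bD); rewrite uE linearD /= (prD _ _ _ aD) (prD _ _ _ bD) add0r.
  by rewrite uE a0 b0 addr0 mem0v.
apply/eqP; rewrite eqEsubv subvf -(gr_add M) subv_add.
have sub i : (gr M i <= U + (D false + D true))%VS.
  rewrite -(addv_diff_cap (gr M i) U) subv_add; apply/andP; split.
    rewrite (subv_trans _ (addvSr _ _)) //.
    by case: i; [exact: addvSr|exact: addvSl].
  by rewrite (subv_trans (capvSr _ _)) ?addvSl.
by rewrite !sub.
Qed.

Lemma homog_freeext es U : {in es, forall e, oddend e} -> homog U -> homog (freeext es U).
Proof.
elim: es => //= e es IH oe hU; have {}IH : homog (freeext es U).
  by apply: IH => // f fe; apply: oe; rewrite inE fe orbT.
move=> i u /memv_addP[a aL [_ /memv_imgP[b bL ->] ->]].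
rewrite linearD /= memv_add ?IH // prj_odd; last by apply: oe; rewrite mem_head.
by rewrite memv_img // IH.
Qed.

Lemma homog_cofree es U : {in es, forall e, oddend e} -> homog U -> homog (cofree es U).
Proof.
elim: es => //= e es IH oe hU; have {}IH : homog (cofree es U).
  by apply: IH => // f fe; apply: oe; rewrite inE fe orbT.
move=> i u; rewrite !memv_cap -!memv_preim => /andP[uN euN]; rewrite IH //=.
have -> : e (prj M i u) = prj M (~~ i) (e u).
  by rewrite prj_odd ?negbK //; apply: oe; rewrite mem_head.
exact: IH.
Qed.

Lemma prj_prodop es i v : {in es, forall e, oddend e} ->
  prj M i (prodop es v) = prodop es (prj M (i (+) odd (size es)) v).
Proof.
elim: es i => [|e es IH] i oe; first by rewrite /= !id_lfunE addbF.
rewrite !prodop_cons prj_odd; last by apply: oe; rewrite mem_head.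
rewrite IH => [|f fe]; last by apply: oe; rewrite inE fe orbT.
by rewrite /= addNb addbN.
Qed.

(** The decomposition of [ext_decomp] can be made homogeneous, since the kernel and the image of
    the top product have homogeneous complements. *)
Lemma graded_ext_decomp es : anticomm es -> {in es, forall e, oddend e} ->
  exists L0 N, let L := freeext es L0 in
  [/\ homog L0 /\ homog N, (L0 :&: lker (prodop es) = 0)%VS, stable es N,
      (L :&: N)%VS = 0%VS /\ (L + N)%VS = fullv
    & \dim L0 = \dim (limg (prodop es)) /\
      forall v, v \in N -> prodop es v = 0].
Proof.
move=> ac oe.
have hk : homog (lker (prodop es)).
  move=> i u; rewrite !memv_ker => /eqP pu.
  have := prj_prodop (i (+) odd (size es)) u oe.
  by rewrite pu linear0 -addbA addbb addbF => <-.
have hi : homog (limg (prodop es)).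
  by move=> i _ /memv_imgP[u _ ->]; rewrite prj_prodop // memv_img ?memvf.
have [L0 [hL0 kL0 sL0]] := homog_compl hk; have [N0 [hN0 iN0 sN0]] := homog_compl hi.
have cL0 : (L0 :&: lker (prodop es) = 0)%VS by rewrite capvC.
have img : (prodop es @: L0)%VS = limg (prodop es).
  rewrite -sL0 limgD; have -> : (prodop es @: lker (prodop es) = 0)%VS.
    by apply/eqP; rewrite -lkerE.
  by rewrite add0v.
have [a b _ d] := ext_decomp ac cL0 img iN0 sN0.
exists L0, (cofree es N0); split=> //.
- by split=> //; apply: homog_cofree.
- exact: stable_cofree.
- by split=> //; rewrite -img limg_dim_eq.
Qed.
End Graded.

(** * Products of two operators *)

Section RankTwo.
Variables (k : closedFieldType) (V : vectType k) (M : superspace k) (E : 'Hom(V, 'End(M))).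
Hypothesis sqE : forall x v, E x (E x v) = 0.
Hypothesis oddE : forall x, oddend (E x).

Definition rho i x := \dim (E x @: gr M i).

(** Rank is lower semicontinuous, so the ranks on the even and on the odd part can both only
    grow at a generic point of the line through x and y; as their sum is constant, neither does. *)
Lemma rho_const c : (forall x, x != 0 -> (rho false x + rho true x)%N = c) ->
  forall i x y, x != 0 -> y != 0 -> rho i x = rho i y.
Proof.
move=> h; suff le i x y : x != 0 -> y != 0 -> (rho i x <= rho i y)%N.
  by move=> i x y x0 y0; apply/eqP; rewrite eqn_leq !le.
move=> x0 y0.
have [r1 h1] := pencil_generic_rank (E x) (E y) (gr M i).
have [r2 h2] := pencil_generic_rank_inv (E y) (E x) (gr M (~~ i)).
have [t] := avoid_finite (0 :: r1 ++ r2).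
rewrite inE mem_cat !negb_or => /and3P[t0 t1 t2].
have := h1 t t1; have := h2 t t0 t2; rewrite -linearZ -linearB /=.
rewrite -/(rho _ _) -/(rho i _) -/(rho (~~ i) (y - t *: x)) -/(rho i (y - t *: x)).
have [->|n0] := eqVneq (y - t *: x) 0.
  by rewrite /rho linear0 !lim0g !dimv0; lia.
have := h _ n0; have := h _ y0; case: (i) => /=; lia.
Qed.

Lemma img_homog x (U : {vspace M}) i j : (U <= gr M i)%VS -> j = ~~ i -> (E x @: U <= gr M j)%VS.
Proof.
move=> sU ->; apply/subvP => _ /memv_imgP[u uU ->]; apply: oddE; exact: (subvP sU).
Qed.

(** Split off the free part L for x1 and x2, of rank g.  On the complement N the product is zero,
    and the pencil of x1 and x2 maps the top A_i of N in degree i to the image I_(i+1) with rank at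
    least q = p - g.  As dim N = 4 q + 1, one of the pairs (A_0, I_1) and (A_1, I_0) has both
    dimensions equal to q; this square pencil is never singular, so q = 0. *)
Lemma has_rank2 p : (forall i x, x != 0 -> rho i x = p) -> \dim {:M} = (4 * p).+1 ->
  has_rank E 2.
Proof.
move=> rp dM [//|x1 [//|x2 [|//]]] fX _; set X := [:: x1; x2].
set es := [seq E x | x <- X].
have ac : anticomm es by apply: fam_anticomm.
have oe : {in es, forall e, oddend e} by move=> _ /mapP[x _ ->]; apply: oddE.
have [L0 [N [[hL0 hN] kL0 stN [cap0 sumf] [dL0 pN]]]] := graded_ext_decomp ac oe.
set L := freeext es L0 in cap0 sumf; set g := \dim (limg (prodop es)) in dL0 *.
have hL : homog L by apply: homog_freeext.
have [dL _] := freeext_free ac kL0; rewrite -/L dL0 /= in dL.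
have dLN : (\dim L + \dim N = \dim {:M})%N by rewrite -dimv_disjoint_sum // sumf.
have nz s t : (s, t) != (0, 0) -> s *: x1 + t *: x2 != 0.
  move=> st; apply: contra st => /eqP e; have /freeP := fX.
  move/(_ (fun i : 'I_2 => if val i == 0%N then s else t)).
  rewrite big_ord_recl big_ord1 /= => /(_ e) h.
  by have := h ord0; have := h (lift ord0 ord0); rewrite /= => -> ->.
have nx1 : x1 != 0 by have := nz 1 0; rewrite scale1r scale0r addr0; apply; rewrite xpair_eqE oner_eq0.
have grE i : gr M i = (L :&: gr M i + N :&: gr M i)%VS.
  apply/eqP; rewrite eqEsubv subv_add !capvSr !andbT; apply/subvP => u ui.
  have : u \in (L + N)%VS by rewrite sumf memvf.
  case/memv_addP => a aL [b bN uE]; rewrite -(prj_id ui) uE linearD /=.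
  by rewrite memv_add // memv_cap ?hL ?hN ?memv_prj.
have an := fam_anti sqE.
pose v s t := s *: x1 + t *: x2.
have vE s t u : E (v s t) u = s *: E x1 u + t *: E x2 u.
  by rewrite linearD !linearZ add_lfunE !scale_lfunE.
(* on the free part a nonzero element of the pencil has rank at most g in each degree *)
have vL s t i : (\dim (E (v s t) @: (L :&: gr M i)) <= g)%N.
  pose D := (E (v s t) @: (L0 :&: gr M i) + prodop es @: (L0 :&: gr M (~~ i)))%VS.
  suff sD : (E (v s t) @: (L :&: gr M i) <= D)%VS.
    apply: leq_trans (dimvS sD) _; rewrite -dL0 (dim_homog hL0) /D.
    set a := (_ @: _)%VS; set b := (_ @: _)%VS.
    have : (\dim a <= \dim (L0 :&: gr M i))%N by apply: dim_limg_le.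
    have : (\dim b <= \dim (L0 :&: gr M (~~ i)))%N by apply: dim_limg_le.
    by have := dimv_sum_cap a b; case: (i) => /=; lia.
  apply/subvP => _ /memv_imgP[u /memv_capP[uL ui] ->].
  move: uL; rewrite /L /= => /memv_addP[w wL [_ /memv_imgP[w' w'L ->] uE]].
  move: wL w'L uE => /memv_addP[a aL [_ /memv_imgP[b bL ->] ->]].
  move=> /memv_addP[c cL [_ /memv_imgP[d dL' ->] ->]] uE.
  have -> : E (v s t) u = E (v s t) (prj M i a) +
      prodop es (prj M (~~ i) (s *: b - t *: c)).
    rewrite -(prj_id ui) uE !linearD /= !(prj_odd _ _ (@oddE _)) negbK.
    rewrite !comp_lfunE id_lfunE linearN !linearZ /=.
    rewrite -!addrA; congr (_ + _); rewrite id_lfunE !(add_lfunE, scale_lfunE).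
    rewrite [E x2 (E x1 (E x2 _))]an [E x2 (E x1 _)]an !sqE !linearN linear0 /=.
    by rewrite !(linear0, oppr0, scaler0, addr0, add0r, subr0).
  apply: memv_add; apply: memv_img; rewrite memv_cap memv_prj hL0 //.
  by rewrite memvB // memvZ.
have gp : (g <= p)%N.
  have := dimvS (subvf L); rewrite dL dM; lia.
pose Ni i := (N :&: gr M i)%VS; pose I i := (E x1 @: Ni (~~ i) + E x2 @: Ni (~~ i))%VS.
pose A i := (Ni i :\: I i)%VS.
have vN s t i : (s, t) != (0, 0) -> (p - g <= \dim (E (v s t) @: Ni i))%N.
  move=> st; have := rp i _ (nz s t st); rewrite /rho grE limgD -/(v s t) -/(Ni i).
  by have := vL s t i; set a := (_ @: _)%VS; set b := (_ @: _)%VS; have := dimv_sum_cap a b; lia.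
have sNI i : (I i <= Ni i)%VS.
  have h x : x \in X -> (E x @: Ni (~~ i) <= Ni i)%VS.
    move=> xX; rewrite subv_cap (img_homog _ (capvSr _ _)) ?negbK // andbT.
    by rewrite (subv_trans (limgS _ (capvSl _ _))) // stN // map_f.
  by rewrite subv_add !h // !inE eqxx ?orbT.
have xI x i : x \in X -> (E x @: I i = 0)%VS.
  move=> xX; have p0 u : u \in Ni (~~ i) -> E x1 (E x2 u) = 0 /\ E x2 (E x1 u) = 0.
    case/memv_capP => uN _; have := pN u uN; rewrite !prodop_cons id_lfunE => h.
    by split=> //; rewrite an h oppr0.
  apply/eqP; rewrite -lkerE subv_add; apply/andP; split; apply/subvP => _ /memv_imgP[u uN ->];
    have [a b] := p0 u uN; rewrite memv_ker;
    by move: xX; rewrite !inE => /orP[]/eqP->; rewrite ?sqE ?a ?b.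
have dAI i : (\dim (A i) + \dim (I i) = \dim (Ni i))%N.
  by have := dimv_cap_compl (Ni i) (I i); rewrite (capv_idPr (sNI i)) addnC.
have vA s t i : (E (v s t) @: A i = E (v s t) @: Ni i)%VS.
  rewrite -[in RHS](addv_diff_cap (Ni i) (I i)) limgD (capv_idPr (sNI i)).
  rewrite (_ : (_ @: I i)%VS = 0%VS) ?addv0 //; apply/eqP; rewrite -lkerE; apply/subvP => u uI.
  rewrite memv_ker vE; have h x : x \in X -> E x u = 0.
    by move=> xX; apply/eqP; rewrite -memv0 -(xI x i xX) memv_img.
  by rewrite !h ?scaler0 ?addr0 // !inE eqxx ?orbT.
have sAI x i : x \in X -> (E x @: A i <= I (~~ i))%VS.
  move=> xX; rewrite (subv_trans (limgS _ (diffvSl _ _))) // /I negbK.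
  by move: xX; rewrite !inE => /orP[]/eqP->; rewrite ?addvSl ?addvSr.
have vA' s t i : (s, t) != (0, 0) -> (p - g <= \dim ((s *: E x1 + t *: E x2)%R @: A i))%N.
  move=> st; rewrite -!linearZ -linearD vA; exact: vN.
have [i1 i2] : x1 \in X /\ x2 \in X by rewrite !inE !eqxx orbT.
have dAge i : (p - g <= \dim (A i))%N.
  have := vA' 1 0 i; rewrite xpair_eqE oner_eq0 => /(_ isT) /leq_trans; apply.
  exact: dim_limg_le.
have dIge i : (p - g <= \dim (I i))%N.
  have := vA' 1 0 (~~ i); rewrite xpair_eqE oner_eq0 => /(_ isT) /leq_trans; apply.
  apply: dimvS; apply: img_comb2_sub; rewrite -[i in I i]negbK; exact: sAI.
have q0 i : \dim (A i) = (p - g)%N -> \dim (I (~~ i)) = (p - g)%N -> (p - g)%N = 0%N.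
  move=> eA eI; rewrite -eA; apply: (square_pencil_trivial _ (sAI x1 i i1) (sAI x2 i i2)).
    by rewrite eA eI.
  by rewrite eA => s t; apply: vA'.
have dN := dim_homog hN; rewrite -/(Ni false) -/(Ni true) -!dAI in dN.
suff : (p - g)%N = 0%N.
  by rewrite dM; have := gp; lia.
have := dAge false; have := dAge true; have := dIge false; have := dIge true.
have := q0 true; have := q0 false; move=> /= qf qt.
have [a|a] := eqVneq (\dim (A false)) (p - g)%N; have [b|b] := eqVneq (\dim (I true)) (p - g)%N;
  try by move=> *; apply: qf.
all: move=> *; apply: qt; lia.
Qed.
End RankTwo.

(** * Morphisms and submodules *)

Section Homs.
Variables (k : fieldType) (g : lieSuper k).
Implicit Types M N P W : smod g.

Lemma hom_id M : is_hom (\1%VF : 'Hom(M, M)).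
Proof. by split=> [i v|x v]; rewrite !id_lfunE. Qed.

Lemma hom_comp M N P (f : 'Hom(N, P)) (h : 'Hom(M, N)) :
  is_hom f -> is_hom h -> is_hom (f \o h)%VF.
Proof.
move=> [f1 f2] [h1 h2]; split=> [i v vi|x v]; rewrite !comp_lfunE; first by apply/f1/h1.
by rewrite h2 f2.
Qed.

Lemma hom_add M N (f h : 'Hom(M, N)) : is_hom f -> is_hom h -> is_hom (f + h).
Proof.
move=> [f1 f2] [h1 h2]; split=> [i v vi|x v]; rewrite !add_lfunE.
  by rewrite memvD ?f1 ?h1.
by rewrite f2 h2 linearD.
Qed.

Lemma hom_scale M N c (f : 'Hom(M, N)) : is_hom f -> is_hom (c *: f).
Proof.
move=> [f1 f2]; split=> [i v vi|x v]; rewrite !scale_lfunE; first by rewrite memvZ ?f1.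
by rewrite f2 linearZ.
Qed.

Lemma hom_opp M N (f : 'Hom(M, N)) : is_hom f -> is_hom (- f).
Proof. by rewrite -scaleN1r; apply: hom_scale. Qed.

Lemma hom_sub M N (f h : 'Hom(M, N)) : is_hom f -> is_hom h -> is_hom (f - h).
Proof. by move=> hf hh; apply: hom_add => //; apply: hom_opp. Qed.

Lemma hom_zero M N : is_hom (0 : 'Hom(M, N)).
Proof. by split=> [i v vi|x v]; rewrite !zero_lfunE ?mem0v ?linear0. Qed.

Lemma hom_prj M N (f : 'Hom(M, N)) i v : is_hom f -> f (prj M i v) = prj N i (f v).
Proof.
move=> [f1 _]; rewrite -[in RHS](prj_add v) !linearD /=.
have h j : prj N i (f (prj M j v)) = if j == i then f (prj M j v) else 0.
  exact: prj_gr (f1 _ _ (memv_prj _ _)).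
by rewrite !h; clear h; case: i => /=; rewrite ?addr0 ?add0r.
Qed.

Lemma sgnE M v : sgn M true v = prj M false v - prj M true v.
Proof. by rewrite /sgn add_lfunE opp_lfunE. Qed.

Lemma hom_sgn M N (f : 'Hom(M, N)) v : is_hom f -> f (sgn M true v) = sgn N true (f v).
Proof. by move=> hf; rewrite !sgnE linearB /= !hom_prj. Qed.

Lemma sgnK M v : sgn M true (sgn M true v) = v.
Proof. by rewrite sgn_sgn /sgn id_lfunE. Qed.

Lemma odd_act_sgn M x v : x \in gr g true -> act M x (sgn M true v) = - sgn M true (act M x v).
Proof. by move=> hx; rewrite (act_sgn _ _ hx) /= expr1 scaleN1r. Qed.

Lemma even_act_sgn M t v : t \in gr g false -> act M t (sgn M true v) = sgn M true (act M t v).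
Proof. by move=> ht; rewrite (act_sgn _ _ ht) andbF expr0 scale1r. Qed.

Lemma iso_inverse M N (f : 'Hom(M, N)) : is_hom f -> lker f = 0%VS -> limg f = fullv ->
  exists h : 'Hom(N, M), [/\ is_hom h, (h \o f)%VF = \1%VF & (f \o h)%VF = \1%VF].
Proof.
move=> hf k0 i1; have inj : lker f == 0%VS by rewrite k0.
have fK v : (f^-1)%VF (f v) = v by rewrite lker0_lfunK.
have Kf v : f ((f^-1)%VF v) = v by apply: limg_lfunVK; rewrite i1 memvf.
exists (f^-1)%VF; split; last 2 first.
- by apply/lfunP => v; rewrite comp_lfunE id_lfunE.
- by apply/lfunP => v; rewrite comp_lfunE id_lfunE.
split=> [i v vi|x v].
  by have := hom_prj i ((f^-1)%VF v) hf; rewrite Kf (prj_id vi) => <-; rewrite fK memv_prj.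
by rewrite -[v in LHS]Kf -(proj2 hf) fK.
Qed.

Lemma iso_from_inverse M N (f : 'Hom(M, N)) (h : 'Hom(N, M)) : is_hom f ->
  (h \o f)%VF = \1%VF -> (f \o h)%VF = \1%VF -> smod_iso M N.
Proof.
move=> hf hfK fhK; exists f; split=> //.
  apply/eqP/lker0P => u v e; rewrite -[u]id_lfunE -[v]id_lfunE -hfK !comp_lfunE.
  by rewrite e.
apply/eqP; rewrite eqEsubv subvf; apply/subvP => v _.
by rewrite -[v]id_lfunE -fhK comp_lfunE memv_img ?memvf.
Qed.

Lemma tens_suml M N I (r : seq I) (F : I -> M) (n : N) :
  tens (\sum_(i <- r) F i) n = \sum_(i <- r) tens (F i) n.
Proof. by elim/big_rec2: _ => [|i x y _ <-]; rewrite ?tens0l // tensDl. Qed.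

Lemma tens_sumr M N I (r : seq I) (F : I -> N) (m : M) :
  tens m (\sum_(i <- r) F i) = \sum_(i <- r) tens m (F i).
Proof. by elim/big_rec2: _ => [|i x y _ <-]; rewrite ?tens0r // tensDr. Qed.

End Homs.

Section Submodules.
Variables (k : fieldType) (g : lieSuper k) (M : smod g) (U : {vspace M}).
Hypothesis sU : submod U.

Let stp i : (prj M i @: U <= U)%VS.
Proof. by apply/subvP => _ /memv_imgP[v vU ->]; case: sU => h _; apply: h. Qed.
Let sta x : (act M x @: U <= U)%VS.
Proof. by apply/subvP => _ /memv_imgP[v vU ->]; case: sU => _ h; apply: h. Qed.

Fact sub_proj_comp i j :
  (restr U (prj M i) \o restr U (prj M j))%VF = if i == j then restr U (prj M i) else 0.
Proof.
apply/lfunP => u; rewrite comp_lfunE; apply: subvs_inj; rewrite !restrE //.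
rewrite -comp_lfunE prj_comp; case: eqP => _; first by rewrite restrE.
by rewrite !zero_lfunE linear0.
Qed.

Fact sub_proj_add : restr U (prj M false) + restr U (prj M true) = \1%VF.
Proof.
apply/lfunP => u; rewrite add_lfunE id_lfunE; apply: subvs_inj.
by rewrite linearD /= !restrE // prj_add.
Qed.

Definition sub_space : superspace k := proj_superspace sub_proj_comp sub_proj_add.

Lemma sub_grP i (u : subvs_of U) : (u \in gr sub_space i) = (vsval u \in gr M i).
Proof.
apply/(limg_projP sub_proj_comp)/idP => [<-|ui]; first by rewrite restrE // memv_prj.
by apply: subvs_inj; rewrite restrE // prj_id.
Qed.

Definition sub_act : 'Hom(g, 'End(sub_space)) := linfun (fun x => restr U (act M x)).

Fact sub_actE x (u : subvs_of U) : vsval (sub_act x u) = act M x (vsval u).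
Proof.
rewrite /sub_act linfun_lin ?restrE // => c y z.
by rewrite linearP restr_linear.
Qed.

Fact sub_act_gr i j x v : x \in gr g i -> v \in gr sub_space j ->
  sub_act x v \in gr sub_space (i (+) j).
Proof. by move=> hx; rewrite !sub_grP sub_actE => hv; apply: act_gr. Qed.

Fact sub_act_br i j x y v : x \in gr g i -> y \in gr g j ->
  sub_act (br g x y) v =
  sub_act x (sub_act y v) - (-1) ^+ (i && j) *: sub_act y (sub_act x v).
Proof.
move=> hx hy; apply: subvs_inj.
by rewrite linearB linearZ /= !sub_actE (act_br _ hx hy) scalerN.
Qed.

Definition sub_smod : smod g := Smod sub_act_gr sub_act_br.

Definition sub_incl : 'Hom(sub_smod, M) := incl U.

Lemma sub_incl_hom : is_hom sub_incl.
Proof.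
split=> [i v|x v]; first by rewrite inclE sub_grP.
by rewrite !inclE sub_actE.
Qed.

Definition corestr (N : smod g) (f : 'Hom(N, M)) : 'Hom(N, sub_smod) :=
  linfun (fun v => vsproj U (f v)).

Lemma corestrE (N : smod g) (f : 'Hom(N, M)) v : (limg f <= U)%VS ->
  vsval (corestr f v) = f v.
Proof.
move=> sf; rewrite /corestr linfun_lin => [|c x y]; last by rewrite !linearP.
by rewrite vsprojK // (subvP sf) // memv_img ?memvf.
Qed.

Lemma corestr_hom (N : smod g) (f : 'Hom(N, M)) : (limg f <= U)%VS -> is_hom f ->
  is_hom (corestr f).
Proof.
move=> sf [f1 f2]; split=> [i v vi|x v].
  by rewrite sub_grP corestrE // f1.
by apply: subvs_inj; rewrite corestrE // f2 sub_actE corestrE.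
Qed.

Lemma sub_incl_corestr (N : smod g) (f : 'Hom(N, M)) : (limg f <= U)%VS ->
  (sub_incl \o corestr f)%VF = f.
Proof. by move=> sf; apply/lfunP => v; rewrite comp_lfunE inclE corestrE. Qed.

Lemma corestr_sub_incl (f : 'End(M)) : (limg f <= U)%VS ->
  (forall u, u \in U -> f u = u) -> (corestr f \o sub_incl)%VF = \1%VF.
Proof.
move=> sf h; apply/lfunP => v; rewrite comp_lfunE id_lfunE; apply: subvs_inj.
by rewrite corestrE // inclE h // subvsP.
Qed.

End Submodules.

(** * Contractions *)

Section Contractible.
Variables (k : fieldType) (a : lieSuper k).
Hypothesis two_neq0 : (2%:R : k) != 0.
Implicit Types M N P W : smod a.

(** Weight zero; such a module is one over the exterior algebra of a_1. *)
Definition wz M := forall t v, t \in gr a false -> act M t v = 0.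

(** A null-homotopy of the degree one class y of the relative cohomology ring, for the Koszul
    differential. *)
Definition contraction M (y : 'Hom(a, k^o)) (H : 'End(M)) : Prop :=
  (forall t v, t \in gr a false -> H (act M t v) = act M t (H v)) /\
  (forall x v, x \in gr a true -> act M x (H v) + H (act M x v) = y x *: v).

Definition contractible M := forall y, exists H, contraction (M := M) y H.

Lemma contraction_retract M W (i : 'Hom(M, W)) (p : 'Hom(W, M)) y H : is_hom i -> is_hom p ->
  (p \o i)%VF = \1%VF -> contraction (M := W) y H -> contraction (M := M) y (p \o H \o i)%VF.
Proof.
move=> [_ i2] [_ p2] pi [H1 H2]; split=> [t v ht|x v hx]; rewrite !comp_lfunE.
  by rewrite i2 H1 // p2.
by rewrite i2 -p2 -linearD H2 // linearZ /= -comp_lfunE pi id_lfunE.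
Qed.

Lemma contr_retract M W (i : 'Hom(M, W)) (p : 'Hom(W, M)) : is_hom i -> is_hom p ->
  (p \o i)%VF = \1%VF -> contractible W -> contractible M.
Proof.
move=> hi hp pi cW y; have [H hH] := cW y.
by exists (p \o H \o i)%VF; apply: contraction_retract.
Qed.

(** Replacing H by half of H - s H s, with s the parity operator, keeps the equation because
    odd elements anticommute with s. *)
Lemma contraction_odd M y H : contraction (M := M) y H ->
  exists2 H, contraction (M := M) y H & forall v, H (sgn M true v) = - sgn M true (H v).
Proof.
move=> [H1 H2]; pose s := sgn M true.
exists (2%:R^-1 *: (H - (s \o H \o s)%VF)).
  split=> [t v ht|x v hx].
    rewrite !scale_lfunE !add_lfunE !opp_lfunE !comp_lfunE.
    rewrite -[s (act M t v)]even_act_sgn // !H1 // -/s -[s (act M t _)]even_act_sgn //.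
    by rewrite -linearB -linearZ.
  rewrite !scale_lfunE !add_lfunE !opp_lfunE !comp_lfunE linearZ linearB /=.
  rewrite [act M x (s _)]odd_act_sgn // -/s -scalerDr.
  have -> : s (H (s (act M x v))) = - s (H (act M x (s v))).
    by rewrite [act M x (s v)]odd_act_sgn // -/s !linearN opprK.
  rewrite !opprK [X in _ *: X]addrACA H2 // -linearD H2 // linearZ /= [s (s v)]sgnK.
  by rewrite -mulr2n -scaler_nat !scalerA mulVf // mul1r.
have ss u : s (s u) = u by apply: sgnK.
have e u : (2^-1 *: (H - (s \o H \o s)%VF)) u = 2^-1 *: (H u - s (H (s u))).
  by rewrite scale_lfunE add_lfunE opp_lfunE !comp_lfunE.
move=> v; rewrite -/s !e ss.
by rewrite [s (_ *: _)]linearZ /= [s (_ - _)]linearB /= ss -scalerN opprB.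
Qed.

Lemma sgn_eigen (V : superspace k) (j : bool) (w : V) :
  sgn V true w = (-1) ^+ j *: w -> w \in gr V j.
Proof.
move=> e; have pe : prj V (~~ j) (sgn V true w) = (-1) ^+ (~~ j) *: prj V (~~ j) w.
  rewrite -{1}(prj_add w) !linearD /= !(sgn_gr _ (memv_prj _ _)) !linearZ /=.
  rewrite !(prj_gr _ (memv_prj _ _)).
  by case: j {e}; rewrite /= ?scaler0 ?addr0 ?add0r.
have p0 : prj V (~~ j) w = 0.
  apply/eqP; move/eqP: pe; rewrite e linearZ /= -subr_eq0 -scalerBl scaler_eq0.
  case: j {e} => /=; rewrite ?expr0 ?expr1 ?opprK -?opprD ?oppr_eq0 -mulr2n (negPf two_neq0) //.
by rewrite -(prj_add w); case: j p0 {e pe} => /= ->; rewrite ?add0r ?addr0 memv_prj.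
Qed.

Lemma anti_sgn_odd M (H : 'End(M)) : (forall v, H (sgn M true v) = - sgn M true (H v)) ->
  oddend H.
Proof.
move=> Ho i v vi; apply: sgn_eigen; have := Ho v; rewrite (sgn_gr _ vi) linearZ /= => e.
by apply: oppr_inj; rewrite -e; case: (i); rewrite /= ?expr0 ?expr1 ?scaleN1r ?scale1r ?opprK.
Qed.

Lemma contr_odd M y : contractible M ->
  exists2 H, contraction (M := M) y H & forall v, H (sgn M true v) = - sgn M true (H v).
Proof. by move=> cM; have [H hH] := cM y; apply: contraction_odd hH. Qed.

Lemma contraction_tensor_l P N y H0 : contraction (M := P) y H0 ->
  exists H, contraction (M := tensor P N) y H.
Proof.
move=> /contraction_odd[H [H1 H2] Ho].
pose K : 'End(tensor P N) := tmap H \1%VF; exists K.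
have KE m n : K (tens m n) = tens (H m) n by rewrite /K tmap_tens id_lfunE.
split=> [t|x] v h; rewrite -!comp_lfunE.
  congr (fun_of_lfun _ v); apply: tens_ext => m n.
  rewrite !comp_lfunE !(tens_act_gr_tens _ _ h) KE linearD /= !KE !(tens_act_gr_tens _ _ h).
  by rewrite H1 // /sgn !id_lfunE.
rewrite -add_lfunE -[v in RHS]id_lfunE -scale_lfunE.
congr (fun_of_lfun _ v); apply: tens_ext => m n.
rewrite add_lfunE scale_lfunE id_lfunE !comp_lfunE KE !(tens_act_gr_tens _ _ h) linearD /= !KE Ho.
rewrite addrACA -tensDl H2 // -tensZl -tensDl addrN tens0l addr0.
by [].
Qed.

Lemma contr_tensor_l P N : contractible P -> contractible (tensor P N).
Proof. by move=> cP y; have [H hH] := cP y; apply: contraction_tensor_l hH. Qed.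

Lemma contraction_comb M y1 y2 H1 H2 c : contraction (M := M) y1 H1 ->
  contraction (M := M) y2 H2 -> contraction (M := M) (c *: y1 + y2) (c *: H1 + H2).
Proof.
move=> [a1 b1] [a2 b2]; split=> [t v ht|x v hx].
  by rewrite !add_lfunE !scale_lfunE a1 // a2 // linearD linearZ.
rewrite !add_lfunE !scale_lfunE linearD linearZ /= addrACA -scalerDr b1 // b2 //.
by rewrite scalerA -scalerDl.
Qed.

Lemma contraction_eq M (y1 y2 : 'Hom(a, k^o)) H : {in gr a true, y1 =1 y2} ->
  contraction (M := M) y1 H -> contraction (M := M) y2 H.
Proof. by move=> e [a1 b1]; split=> // x v hx; rewrite b1 // e. Qed.

(** The sign operator on N compensates the sign with which odd elements pass it. *)
Lemma contraction_tensor_r P N y H : contraction (M := P) y H ->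
  contraction (M := tensor N P) y (tmap (M := N) (N := P) (sgn N true) H).
Proof.
move=> [H1 H2]; set K := tmap _ _.
have KE m n : K (tens m n) = tens (sgn N true m) (H n) by rewrite /K tmap_tens.
split=> [t|x] v h; rewrite -!comp_lfunE.
  congr (fun_of_lfun _ v); apply: tens_ext => m n.
  rewrite !comp_lfunE !(tens_act_gr_tens _ _ h) KE linearD /= !KE !(tens_act_gr_tens _ _ h).
  by rewrite H1 // /sgn !id_lfunE -!/(sgn N true) even_act_sgn.
rewrite -add_lfunE -[v in RHS]id_lfunE -scale_lfunE.
congr (fun_of_lfun _ v); apply: tens_ext => m n.
rewrite add_lfunE scale_lfunE id_lfunE !comp_lfunE KE !(tens_act_gr_tens _ _ h) linearD /= !KE.
rewrite odd_act_sgn // sgnK addrACA -tensDl addNr tens0l add0r -tensDr H2 //.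
by rewrite tensZr.
Qed.

Lemma contr_tensor_r P N : contractible P -> contractible (tensor N P).
Proof.
move=> cP y; have [H hH] := cP y; exists (tmap (sgn N true) H).
exact: contraction_tensor_r.
Qed.

Lemma contr_dsum P N : contractible P -> contractible N -> contractible (dsum P N).
Proof.
move=> cP cN y; have [H [H1 H2]] := cP y; have [K [K1 K2]] := cN y.
pose F : 'End(dsum P N) := linfun (fun u : P * N => (H u.1, K u.2)).
have FE u : F u = (H u.1, K u.2).
  by rewrite /F linfun_lin // => c u1 u2; congr (_, _); rewrite linearP.
exists F; split=> [t|x] v h; rewrite !FE /= !dsum_actE /dsum_act_fun /=.
  by rewrite H1 // K1.
by congr (_, _); [apply: H2|apply: K2].
Qed.

End Contractible.

(** * The category F and lifting along contractible modules *)

Section LinearAlgebra.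
Variables (k : closedFieldType).

Lemma endo_eigenvector (T : vectType k) (G : 'End(T)) : (0 < \dim {:T})%N ->
  exists c, exists2 u, u != 0 & G u = c *: u.
Proof.
move=> T0; pose X := vbasis {:T}; have bX : basis_of {:T} X := vbasisP _.
have [c [w w0 wE]] := eigenvector_exists (passmx.mxof X X G) T0.
exists c, (passmx.vecof X w); first by rewrite passmx.vecof_eq0.
rewrite (passmx.hom_vecof _ bX) wE -[c *: w]addr0 passmx.vecof_linear.
by rewrite (_ : passmx.vecof X 0 = 0) ?addr0 //; apply/eqP; rewrite passmx.vecof_eq0.
Qed.

Lemma eigenvector_in (T : vectType k) (U : {vspace T}) (G : 'End(T)) :
  U != 0%VS -> (G @: U <= U)%VS -> exists c, exists2 u, u != 0 & u \in U /\ G u = c *: u.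
Proof.
move=> U0 sU; have [|c [u u0 Gu]] := @endo_eigenvector _ (restr U G).
  by rewrite dim_subvs lt0n dimv_eq0.
exists c, (vsval u); last by rewrite -restrE // Gu subvsP.
by apply: contra u0 => /eqP e; apply/eqP/subvs_inj; rewrite e linear0.
Qed.

(** Steinitz exchange with the spanning set restricted to X: when X consists of weight vectors,
    the complement of K which it provides is spanned by weight vectors. *)
Lemma span_complement (T : vectType k) (K : {vspace T}) (X : seq T) : exists C,
  [/\ {subset C <= X}, free C, (K :&: <<C>>)%VS = 0%VS & (K + <<X>> <= K + <<C>>)%VS].
Proof.
elim: X => [|x X [C [sC fC KC gC]]].
  by exists [::]; rewrite nil_free span_nil capv0 subvv.
have [xC|xC] := boolP (x \in (K + <<C>>)%VS).
  exists C; split=> // [c cC|]; first by rewrite inE sC ?orbT.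
  by rewrite span_cons subv_add addvSl subv_add -memvE xC (subv_trans (addvSr K _) gC).
exists (x :: C); split.
- by move=> c; rewrite !inE => /orP[->//|/sC ->]; rewrite orbT.
- by rewrite free_cons fC andbT; apply: contra xC; apply: (subvP (addvSr _ _)).
- apply/eqP; rewrite -subv0; apply/subvP => v /memv_capP[vK]; rewrite span_cons.
  case/memv_addP => _ /vlineP[c ->] [w wC vE].
  have [c0|c0] := eqVneq c 0.
    by rewrite -KC memv_cap vK vE c0 scale0r add0r.
  case/negP: xC; rewrite -[x](scalerK c0) memvZ //.
  have -> : c *: x = v - w by rewrite vE addrK.
  by rewrite memv_add // memvN.
rewrite !span_cons subv_add addvSl subv_add addvA [(K + <[x]>)%VS]addvC -!addvA addvSl.
by rewrite (subv_trans (addvSr K _)) // (subv_trans gC) // addvSr.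
Qed.

End LinearAlgebra.

Section CategoryF.
Variables (k : closedFieldType) (a : lieSuper k).
Hypothesis two_neq0 : (2%:R : k) != 0.
Hypothesis central : forall t x, t \in gr a false -> br a t x = 0.
Implicit Types M N P W : smod a.

Lemma act_even_comm M t x v : t \in gr a false -> act M t (act M x v) = act M x (act M t v).
Proof.
move=> ht; rewrite -(prj_add x) linearD !add_lfunE linearD /=.
have h i : act M t (act M (prj a i x) v) = act M (prj a i x) (act M t v).
  have := act_br v ht (memv_prj i x); rewrite central // linear0 zero_lfunE /= expr0 scale1r.
  by move/esym/eqP; rewrite subr_eq0 => /eqP.
by rewrite !h.
Qed.

Lemma act_odd_anti M x y v : x \in gr a true -> y \in gr a true ->
  act M x (act M y v) = act M (br a x y) v - act M y (act M x v).
Proof.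
by move=> hx hy; rewrite (act_br _ hx hy) /= expr1 scaleN1r opprK addrK.
Qed.

Lemma act_odd_sq M x v : x \in gr a true ->
  act M x (act M x v) = 2%:R^-1 *: act M (br a x x) v.
Proof.
move=> hx; rewrite (act_br _ hx hx) /= expr1 scaleN1r opprK -mulr2n -scaler_nat.
by rewrite scalerA mulVf // scale1r.
Qed.

(** A homogeneous common eigenvector of a_0. *)
Definition wvec M (v : M) : Prop := (exists d, v \in gr M d) /\
  (forall t, t \in gr a false -> act M t v \in <[v]>%VS).
Definition wspan M : Prop :=
  exists2 X : seq M, (forall v, v \in X -> wvec v) & <<X>>%VS = fullv.

Lemma wvec_line_submod0 M (v : M) : wvec v -> submod0 <[v]>%VS.
Proof.
move=> [[d vd] hv]; split=> [i _ /vlineP[c ->]|t _ ht /vlineP[c ->]]; rewrite linearZ memvZ //=.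
  by rewrite (prj_gr _ vd); case: eqP => _; rewrite ?memv_line ?mem0v.
exact: hv.
Qed.

(** The operators of a_0 commute and are even, so they have a common homogeneous eigenvector in
    any homogeneous stable subspace, and the line through it is the whole simple module. *)
Lemma simple0_line M (U : {vspace M}) : simple0 U -> exists2 v, wvec v & U = <[v]>%VS.
Proof.
move=> [U0 [Up Ut] Umin].
have [d Ud0] : exists d, (U :&: gr M d)%VS != 0%VS.
  have := homogE Up; have [-> e|] := eqVneq (U :&: gr M false)%VS 0%VS; last by exists false.
  by exists true; apply/eqP => e'; rewrite e' add0v in e; apply: U0.
pose T : seq a := vbasis (gr a false).
have [v v0 [vU vT]] : exists2 v, v != 0 &
    v \in (U :&: gr M d)%VS /\ forall t, t \in T -> act M t v \in <[v]>%VS.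
  have sT : {subset T <= gr a false} by move=> t; apply: vbasis_mem.
  have stU : forall t, t \in gr a false -> (act M t @: (U :&: gr M d) <= U :&: gr M d)%VS.
    move=> t ht; apply/subvP => _ /memv_imgP[v /memv_capP[vU vd] ->].
    by rewrite memv_cap Ut //= -[d]addFb act_gr.
  elim: T sT (U :&: gr M d)%VS Ud0 stU => [|t T' IH] sT U' U'0 st.
    by exists (vpick U'); rewrite ?vpick0 //; split=> //; apply: memv_pick.
  have ht : t \in gr a false by apply: sT; rewrite mem_head.
  have [c [u u0 [uU' uE]]] := eigenvector_in U'0 (st t ht).
  pose U2 := (U' :&: lker (act M t - c *: \1%VF))%VS.
  have U2E v : (v \in U2) = (v \in U') && (act M t v == c *: v).
    by rewrite memv_cap memv_ker add_lfunE opp_lfunE scale_lfunE id_lfunE subr_eq0.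
  have sT' : {subset T' <= gr a false} by move=> t' t'T; apply: sT; rewrite inE t'T orbT.
  have [||v v0 [vU2 vT]] := IH sT' U2.
  - by apply: contraNneq u0 => e; rewrite -memv0 -e U2E uU' uE eqxx.
  - move=> t' ht'; apply/subvP => _ /memv_imgP[v vU2 ->].
    move: vU2; rewrite !U2E => /andP[vU' /eqP vE].
    by rewrite (subvP (st t' ht')) ?memv_img //= act_even_comm // vE linearZ.
  exists v => //; move: vU2; rewrite U2E => /andP[vU' /eqP vE]; split=> // t'.
  by rewrite inE => /orP[/eqP->|/vT//]; rewrite vE memvZ // memv_line.
have wv : wvec v.
  move: vU; rewrite memv_cap => /andP[vU vd]; split; first by exists d.
  move=> t ht; rewrite (coord_vbasis ht) linear_sum sum_lfunE memv_suml // => i _.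
  by rewrite linearZ scale_lfunE memvZ // vT // mem_nth // size_tuple.
exists v => //; move: vU; rewrite memv_cap => /andP[vU _].
have [e|<-//] := Umin _ (wvec_line_submod0 wv) vU.
by case/eqP: v0; apply/eqP; rewrite -memv0 -e memv_line.
Qed.

(** Membership in F is thus a spanning condition, which unlike complete reducibility passes
    visibly to tensor products and quotients. *)
Lemma in_F_wspan M : in_F M -> wspan M.
Proof.
case=> n [S [hS sS _]].
have [v hv] : exists v : 'I_n -> M, forall i, wvec (v i) /\ S i = <[v i]>%VS.
  have h i : exists v, wvec v /\ S i = <[v]>%VS.
    by have [v wv e] := simple0_line (hS i); exists v.
  have : forall s : seq 'I_n, exists v : 'I_n -> M, forall i, i \in s -> wvec (v i) /\ S i = <[v i]>%VS.
    elim=> [|i s [v hv]]; first by exists (fun _ => 0).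
    have [w hw] := h i; exists (fun j => if j == i then w else v j) => j.
    by rewrite inE; case: eqP => [->//|_] /=; apply: hv.
  by move/(_ (enum 'I_n)) => [v hv]; exists v => i; apply: hv; rewrite mem_enum.
exists [seq v i | i : 'I_n].
  by move=> _ /mapP[i _ ->]; case: (hv i).
apply/eqP; rewrite eqEsubv subvf -sS /=; apply/subv_sumP => i _.
by rewrite (proj2 (hv i)) -memvE memv_span //; apply/mapP; exists i; rewrite ?mem_enum.
Qed.

Lemma wspan_in_F M : wspan M -> in_F M.
Proof.
case=> X hX sX; have [C [sC fC _ gC]] := span_complement 0%VS X.
rewrite !add0v sX in gC.
exists (size C), (fun i => <[C`_i]>%VS).
have Cn (i : 'I_(size C)) : C`_i \in C by rewrite mem_nth.
have Cw (i : 'I_(size C)) : wvec C`_i by apply/hX/sC.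
have sumE : (\sum_(i < size C) <[C`_i]> = <<C>>)%VS by rewrite span_def (big_nth 0) big_mkord.
have C0 (i : 'I_(size C)) : C`_i != 0 by apply: free_not0 fC (Cn i).
split.
- move=> i; split; [|exact: wvec_line_submod0|].
    by move/eqP; rewrite -dimv_eq0 dim_vline C0.
  move=> W _ sW; have [->|W0] := eqVneq W 0%VS; [by left|right].
  by apply/eqP; rewrite eqEdim sW dim_vline C0 lt0n dimv_eq0.
- by apply/eqP; rewrite sumE eqEsubv subvf.
rewrite directvE /= sumE (eqP fC).
by rewrite (eq_bigr (fun _ => 1%N)) ?sum1_card ?card_ord // => i _; rewrite dim_vline C0.
Qed.

Lemma wspan_img M N (f : 'Hom(M, N)) : (forall i v, v \in gr M i -> f v \in gr N i) ->
  (forall t v, t \in gr a false -> f (act M t v) = act N t (f v)) ->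
  limg f = fullv -> wspan M -> wspan N.
Proof.
move=> f1 f2 sf [X hX sX]; exists (map f X); last by rewrite -limg_span sX.
move=> _ /mapP[x xX ->]; have [[d xd] hx] := hX x xX.
split; first by exists d; apply: f1.
by move=> t ht; rewrite -f2 //; have /vlineP[c ->] := hx t ht; rewrite linearZ memvZ ?memv_line.
Qed.

Lemma in_F_retract M N (p : 'Hom(M, N)) (i : 'Hom(N, M)) : is_hom p ->
  (p \o i)%VF = \1%VF -> in_F M -> in_F N.
Proof.
move=> [p1 p2] pi /in_F_wspan wM; apply/wspan_in_F/(wspan_img p1 _ _ wM).
  by move=> t v _; apply: p2.
apply/eqP; rewrite eqEsubv subvf; apply/subvP => v _.
by rewrite -[v]id_lfunE -pi comp_lfunE memv_img ?memvf.
Qed.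

Lemma in_F_tensor M N : in_F M -> in_F N -> in_F (tensor M N).
Proof.
move=> /in_F_wspan[X hX sX] /in_F_wspan[Y hY sY]; apply: wspan_in_F.
exists [seq tens x y | x <- X, y <- Y].
  move=> _ /allpairsP[[x y] [/= xX yY ->]].
  have [[d xd] hx] := hX x xX; have [[d' yd] hy] := hY y yY.
  split; first by exists (d (+) d'); apply: tens_gr.
  move=> t ht; rewrite [act _ t _](tens_act_gr_tens _ _ ht) /sgn id_lfunE.
  have /vlineP[c ->] := hx t ht; have /vlineP[c' ->] := hy t ht.
  by rewrite tensZl tensZr memvD // memvZ // memv_line.
have sub x y : tens x y \in <<[seq tens x y | x <- X, y <- Y]>>%VS.
  have : x \in <<X>>%VS by rewrite sX memvf.
  move/(coord_span (X := in_tuple X)) ->.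
  rewrite tens_suml memv_suml // => i _.
  rewrite tensZl memvZ //; have : y \in <<Y>>%VS by rewrite sY memvf.
  move/(coord_span (X := in_tuple Y)) ->.
  rewrite tens_sumr memv_suml // => j _.
  rewrite tensZr memvZ // memv_span //; apply/allpairsP.
  by exists (X`_i, Y`_j); rewrite !mem_nth.
apply/eqP; rewrite eqEsubv subvf; apply/subvP => A _; rewrite (tens_sumE A).
by apply: memv_suml => i _; apply: memv_suml => j _; rewrite memvZ.
Qed.

Lemma in_F_dsum M N : in_F M -> in_F N -> in_F (dsum M N).
Proof.
move=> /in_F_wspan[X hX sX] /in_F_wspan[Y hY sY]; apply: wspan_in_F.
pose l := linfun (fun x : M => (x, 0 : N)); pose r := linfun (fun y : N => (0 : M, y)).
have lE x : l x = (x, 0).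
  by rewrite /l linfun_lin // => c u v; congr (_, _); rewrite /= scaler0 addr0.
have rE x : r x = (0, x).
  by rewrite /r linfun_lin // => c u v; congr (_, _); rewrite /= scaler0 addr0.
exists ([seq l x | x <- X] ++ [seq r y | y <- Y]).
  move=> v; rewrite mem_cat => /orP[] /mapP[u uX ->].
    have [[d ud] hu] := hX u uX; split.
      by exists d; apply/dsum_grP; rewrite lE mem0v.
    move=> t ht; have /vlineP[c e] := hu t ht; apply/vlineP; exists c.
    by rewrite lE [LHS]dsum_actE /dsum_act_fun /= e linear0; congr (_, _); rewrite /= scaler0.
  have [[d ud] hu] := hY u uX; split.
    by exists d; apply/dsum_grP; rewrite rE mem0v.
  move=> t ht; have /vlineP[c e] := hu t ht; apply/vlineP; exists c.
  by rewrite rE [LHS]dsum_actE /dsum_act_fun /= e linear0; congr (_, _); rewrite /= scaler0.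
apply/eqP; rewrite eqEsubv subvf span_cat -!limg_span sX sY; apply/subvP => -[x y] _.
have -> : (x, y) = l x + r y :> (M * N)%type.
  by rewrite lE rE; congr (_, _); rewrite /= ?addr0 ?add0r.
by rewrite memv_add // memv_img ?memvf.
Qed.

Lemma in_F_wz M : wz M -> in_F M.
Proof.
move=> zM; apply: wspan_in_F; exists (vbasis (gr M false) ++ vbasis (gr M true)).
  move=> v; rewrite mem_cat => h; split; last by move=> t ht; rewrite zM ?mem0v.
  by case/orP: h => /vbasis_mem vd; [exists false|exists true].
by rewrite span_cat !(span_basis (vbasisP _)) gr_add.
Qed.

(** A complement of ker q spanned by weight vectors is stable under a_0 and under the
    projections to degrees; invert q on it. *)
Lemma even_section M N (q : 'Hom(M, N)) : in_F M -> is_hom q -> limg q = fullv ->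
  exists s : 'Hom(N, M), [/\ (q \o s)%VF = \1%VF,
    forall i v, v \in gr N i -> s v \in gr M i
    & forall t v, t \in gr a false -> s (act N t v) = act M t (s v)].
Proof.
move=> /in_F_wspan[X hX sX] hq sq.
have [C [sC fC iC gC]] := span_complement (lker q) X.
pose S := <<C>>%VS; pose f := (q \o incl S)%VF.
have kf : lker f == 0%VS.
  rewrite -subv0; apply/subvP => u; rewrite memv_ker comp_lfunE inclE => fu.
  have : vsval u \in (lker q :&: S)%VS by rewrite memv_cap subvsP memv_ker fu.
  by rewrite iC !memv0 => /eqP e; apply/eqP/subvs_inj; rewrite e linear0.
have lf : limg f = fullv.
  rewrite limg_comp limg_incl; apply/eqP; rewrite eqEsubv subvf -sq.
  have -> : (q @: S = q @: (lker q + S))%VS.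
    by rewrite limgD (_ : (q @: lker q)%VS = 0%VS) ?add0v //; apply/eqP; rewrite -lkerE.
  by apply: limgS; rewrite (subv_trans _ gC) // sX addvf.
exists (incl S \o f^-1)%VF.
have qs v : q (vsval (f^-1%VF v)) = v.
  by rewrite -inclE -[q _]comp_lfunE limg_lfunVK // lf memvf.
have sq' u : u \in S -> vsval (f^-1%VF (q u)) = u.
  by move=> uS; have := lker0_lfunK kf (vsproj S u); rewrite comp_lfunE inclE vsprojK // => ->; rewrite vsprojK.
have hom_S (F : 'End(M)) (F' : 'End(N)) : (forall u, q (F u) = F' (q u)) ->
    (forall c, c \in C -> F c \in S) -> forall v, vsval (f^-1%VF (F' v)) = F (vsval (f^-1%VF v)).
  move=> h1 h2 v; rewrite -[v in LHS]qs -h1 sq' //.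
  set u := vsval _; have : u \in S by apply: subvsP.
  move/(coord_span (X := in_tuple C)) ->; rewrite linear_sum memv_suml // => i _.
  by rewrite linearZ memvZ // h2 // mem_nth.
have wC c : c \in C -> wvec c by move=> cC; apply/hX/sC.
split.
- by apply/lfunP => v; rewrite !comp_lfunE id_lfunE inclE qs.
- move=> i v vi; rewrite comp_lfunE inclE -[v](prj_id vi) (hom_S (prj M i)) ?memv_prj //.
    by move=> u; rewrite hom_prj.
  move=> c cC; have [[d cd] _] := wC c cC; rewrite (prj_gr _ cd).
  by case: eqP => _; rewrite ?mem0v ?memv_span.
move=> t v ht; rewrite !comp_lfunE !inclE (hom_S (act M t)) //.
  by move=> u; case: hq.
move=> c cC; have [_ /(_ t ht)/vlineP[d ->]] := wC c cC.
by rewrite memvZ ?memv_span.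
Qed.

(** Start from a lift g = s f which commutes with a_0 only.  If H contracts the functional dual to
    the basis vector x of a_1, then x g H + g H x is again a lift, because x H + H x = 1 on P; it
    commutes with x since x^2 is in a_0, and it still commutes with the basis vectors treated
    before, on which that functional vanishes. *)
Lemma contractible_lift P M N (q : 'Hom(M, N)) (f : 'Hom(P, N)) : contractible P ->
  in_F M -> is_hom q -> limg q = fullv -> is_hom f ->
  exists2 h : 'Hom(P, M), is_hom h & (q \o h)%VF = f.
Proof.
move=> cP fM hq sq hf; have [s [qs s1 s2]] := even_section fM hq sq.
pose n := \dim (gr a true); pose X := vbasis (gr a true).
have Xo i : (i < n)%N -> X`_i \in gr a true by move=> h; apply: vbasis_mem; rewrite mem_nth ?size_tuple.
have step m : (m <= n)%N -> exists g : 'Hom(P, M),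
    [/\ (q \o g)%VF = f, forall i v, v \in gr P i -> g v \in gr M i,
        forall t v, t \in gr a false -> g (act P t v) = act M t (g v)
      & forall i v, (i < m)%N -> g (act P X`_i v) = act M X`_i (g v)].
  elim: m => [|m IH] hm.
    exists (s \o f)%VF; split=> //.
    - by apply/lfunP => v; rewrite !comp_lfunE -[q _]comp_lfunE qs id_lfunE.
    - by move=> i v vi; rewrite comp_lfunE s1 //; case: hf => h _; apply: h.
    - by move=> t v ht; rewrite !comp_lfunE -s2 //; case: hf => _ ->.
  have [g [qg g1 g2 g3]] := IH (ltnW hm).
  pose y : 'Hom(a, k^o) := linfun (fun v : a => coord X (Ordinal hm) v : k^o).
  have yE v : y v = coord X (Ordinal hm) v by rewrite /y linfun_lin // => c u w; rewrite linearP.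
  have yX i : (i < n)%N -> y X`_i = (i == m)%:R.
    move=> hi; rewrite yE; have := coord_free (Ordinal hi) (Ordinal hm) (basis_free (vbasisP (gr a true))).
    by move=> /= ->.
  have [H [H1 H2] Ho] := contr_odd two_neq0 y cP.
  pose x := X`_m; have hx : x \in gr a true by apply: Xo.
  have gE v : ((act M x \o g \o H)%VF + (g \o H \o act P x)%VF) v =
      act M x (g (H v)) + g (H (act P x v)).
    by rewrite add_lfunE !comp_lfunE.
  have Hgr := anti_sgn_odd two_neq0 Ho.
  have yx : y x = 1 by rewrite yX // eqxx.
  have xx v : act M x (act M x v) = 2%:R^-1 *: act M (br a x x) v by apply: act_odd_sq.
  have hxx : br a x x \in gr a false by rewrite -[false]/(true (+) true) br_gr.
  have gHt t v : t \in gr a false -> g (H (act P t v)) = act M t (g (H v)).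
    by move=> ht; rewrite H1 // g2.
  exists ((act M x \o g \o H)%VF + (g \o H \o act P x)%VF); split.
  - apply/lfunP => v; rewrite comp_lfunE gE linearD /= (proj2 hq) -![q (g _)]comp_lfunE qg.
    by rewrite -(proj2 hf) -linearD H2 // yx scale1r.
  - move=> i v vi; rewrite gE; apply: memvD.
      by have := act_gr hx (g1 _ _ (Hgr _ _ vi)); rewrite addTb negbK.
    by apply: g1; rewrite -[i]negbK; apply: Hgr; rewrite -addTb; apply: act_gr.
  - move=> t v ht; rewrite !gE linearD /= gHt // -[act P x (act P t v)]act_even_comm // gHt //.
    by rewrite [act M t (act M x _)]act_even_comm.
  move=> i v; rewrite ltnS leq_eqVlt => /orP[/eqP->|im]; rewrite -/x !gE.
    rewrite linearD /= xx [act P x (act P x v)]act_odd_sq // !linearZ /=.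
    by rewrite [g (H (act P (br a x x) v))]gHt // addrC.
  have hi : X`_i \in gr a true by apply: Xo; apply: ltn_trans im (hm).
  have yi : y X`_i = 0 by rewrite yX ?(ltn_trans im) ?(ltn_eqF im).
  have gx u : g (H (act P X`_i u)) = - act M X`_i (g (H u)).
    rewrite -g3 // -linearN /= ; congr (g _).
    by have := H2 _ u hi; rewrite yi scale0r => /eqP; rewrite addrC addr_eq0 => /eqP.
  have hxi : br a x X`_i \in gr a false by rewrite -[false]/(true (+) true) br_gr.
  have e1 : g (H (act P x (act P X`_i v))) =
      act M (br a x X`_i) (g (H v)) + act M X`_i (g (H (act P x v))).
    by rewrite (act_odd_anti (M := P) _ hx hi) linearB linearB /= (gHt _ _ hxi) gx opprK.
  rewrite e1 gx linearN /= linearD /= (act_odd_anti (M := M) _ hx hi).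
  by rewrite opprB addrA subrK.
have [g [qg g1 g2 g3]] := step n (leqnn n).
exists g => //; split=> // x v; rewrite -(prj_add x) linearD add_lfunE linearD linearD add_lfunE /=.
rewrite g2 ?memv_prj //; congr (_ + _).
rewrite (coord_vbasis (memv_prj true x)) linear_sum !sum_lfunE linear_sum /= linear_sum sum_lfunE.
apply: eq_bigr => i _; rewrite !linearZ !scale_lfunE linearZ /=; congr (_ *: _).
by apply: g3; apply: ltn_ord.
Qed.

Lemma contractible_projective P : in_F P -> contractible P -> projective P.
Proof.
move=> fP cP; split=> // M N q f fM fN hq sq hf.
exact: contractible_lift.
Qed.

End CategoryF.

(** * Bilinear maps out of a tensor product *)

Section TensorLift.
Variables (k : fieldType) (g : lieSuper k) (M N : smod g) (W : vectType k).
Variable b : M -> N -> W.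
Hypothesis bl : forall n, linear (b^~ n).
Hypothesis br' : forall m, linear (b m).

Definition tlift_fun (A : tensor M N) : W :=
  \sum_i \sum_j A i j *: b (vbasis {:M})`_i (vbasis {:N})`_j.
Definition tlift : 'Hom(tensor M N, W) := linfun tlift_fun.

Lemma tliftE m n : tlift (tens m n) = b m n.
Proof.
pose bm n' := linfun (b^~ n'); pose bn m' := linfun (b m').
have bmE n' m' : bm n' m' = b m' n' by rewrite /bm linfun_lin.
have bnE m' n' : bn m' n' = b m' n' by rewrite /bn linfun_lin.
rewrite /tlift linfun_lin => [|w x y]; last first.
  rewrite /tlift_fun scaler_sumr -big_split /=.
  apply: eq_bigr => i _; rewrite scaler_sumr -big_split /=.
  by apply: eq_bigr => j _; rewrite !mxE scalerDl scalerA.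
rewrite -bmE [in RHS](coord_vbasis (memvf m)) linear_sum; apply: eq_bigr => i _.
rewrite linearZ /= bmE -bnE [in RHS](coord_vbasis (memvf n)) linear_sum scaler_sumr.
by apply: eq_bigr => j _; rewrite linearZ /= bnE !mxE scalerA.
Qed.
End TensorLift.

(** * The Koszul module of a functional *)

Section KoszulFactor.
Variables (k : fieldType) (a : lieSuper k).
Hypothesis central : forall t x, t \in gr a false -> br a t x = 0.
Variable y : 'Hom(a, k^o).

Let Vs := pair_space k^o k^o.
Let eta x : k := y (prj a true x).

(** The module k + k, the first summand even, on which an odd x maps (u, v) to (0, y(x) u).  The
    projection to the odd part makes a_0 act by zero. *)
Definition kos_fun (x : a) (u : Vs) : Vs := (0, eta x * u.1).
Definition kos_act : 'Hom(a, 'End(Vs)) := bilfun kos_fun.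

Fact kos_actE x u : kos_act x u = kos_fun x u.
Proof.
rewrite bilfunE // => w c z z'; congr (_, _); rewrite /= ?scaler0 ?addr0 //.
  by rewrite mulrDr scalerAr.
by rewrite /eta !linearP /= mulrDl; congr (_ + _); apply: (esym (mulrA _ _ _)).
Qed.

Fact eta_even x : x \in gr a false -> eta x = 0.
Proof. by move=> hx; rewrite /eta (prj_gr _ hx) linear0. Qed.

Fact kos_act_gr i j x v : x \in gr a i -> v \in gr Vs j ->
  kos_act x v \in gr Vs (i (+) j).
Proof.
move=> hx /pair_grE->; apply/(limg_projP (@pair_proj_comp _ _ _)).
rewrite kos_actE pair_projE /kos_fun; case: i hx => hx; last first.
  by rewrite eta_even // mul0r; case: j.
by case: j => //=; rewrite mulr0.
Qed.

Fact eta_br i j x z : x \in gr a i -> z \in gr a j -> eta (br a x z) = 0.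
Proof.
move=> hx hz; case: i hx => hx; last by rewrite central // /eta !linear0.
case: j hz => hz; last first.
  by rewrite (br_skew hx hz) central // scaler0 oppr0 /eta !linear0.
by apply: eta_even; apply: (br_gr hx hz).
Qed.

Fact kos_act_br i j x z v : x \in gr a i -> z \in gr a j ->
  kos_act (br a x z) v = kos_act x (kos_act z v) - (-1) ^+ (i && j) *: kos_act z (kos_act x v).
Proof.
move=> hx hz; rewrite !kos_actE /kos_fun /= (eta_br hx hz) !mulr0 mul0r.
by congr (_, _); rewrite /= scaler0 subr0.
Qed.

Definition koszul : smod a := Smod kos_act_gr kos_act_br.

Lemma koszul_wz : wz koszul.
Proof. by move=> t v ht; rewrite [LHS]kos_actE /kos_fun eta_even // mul0r. Qed.

Definition kos_contr : 'End(koszul) := linfun (fun u : Vs => (u.2, 0) : Vs).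

Lemma koszul_contraction : contraction (M := koszul) y kos_contr.
Proof.
have hE u : kos_contr u = (u.2, 0).
  by rewrite /kos_contr linfun_lin // => c u1 u2; congr (_, _); rewrite /= scaler0 addr0.
split=> [t v ht|x v hx].
  by rewrite !koszul_wz // linear0.
rewrite !hE [act _ x _]kos_actE [act _ x v]kos_actE /kos_fun /= /eta (prj_id hx).
by case: v => v1 v2; congr (_, _); rewrite /= ?add0r ?addr0.
Qed.

Variable M : smod a.
(** The quotient of M (x) K by M tensored with the odd, trivial submodule of K. *)
Definition kos_cover : 'Hom(tensor M koszul, M) := tlift (fun m (u : koszul) => (u : Vs).1 *: m).

Lemma kos_coverE m (u : koszul) : kos_cover (tens m u) = (u : Vs).1 *: m.
Proof.
rewrite /kos_cover tliftE //.
  by move=> n c x z; rewrite scalerDr !scalerA mulrC.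
by move=> n c x z; rewrite scalerDl scalerA.
Qed.

Lemma kos_cover_hom : is_hom kos_cover.
Proof.
split=> [i v|x v].
  move/(limg_projP (@tens_proj_comp _ _ _ _)) => <-.
  suff -> : kos_cover (tens_proj M koszul i v) = prj M i (kos_cover v) by apply: memv_prj.
  rewrite -!comp_lfunE; congr (fun_of_lfun _ v); apply: tens_ext_gr => i' j' m n hm hn.
  rewrite !comp_lfunE (tens_proj_tens _ hm hn) kos_coverE linearZ /= (prj_gr _ hm).
  rewrite (pair_grE hn); case: j' hn => hn /=; last first.
    by rewrite addbF; case: eqP => _; rewrite ?kos_coverE ?linear0 ?scaler0.
  by case: eqP => _; rewrite ?kos_coverE ?linear0 /= ?scale0r.
rewrite -(prj_add x) !linearD !add_lfunE linearD /=.
have h i : kos_cover (act (tensor M koszul) (prj a i x) v) = act M (prj a i x) (kos_cover v).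
  rewrite -!comp_lfunE; congr (fun_of_lfun _ v); apply: tens_ext => m n.
  rewrite !comp_lfunE kos_coverE [act (tensor M koszul) _ _](tens_act_gr_tens _ _ (memv_prj _ _)).
  rewrite linearD /= !kos_coverE linearZ /= [act koszul _ _]kos_actE /kos_fun /=.
  by rewrite scale0r addr0.
by rewrite !h.
Qed.

Lemma kos_cover_onto : limg kos_cover = fullv.
Proof.
apply/eqP; rewrite eqEsubv subvf; apply/subvP => m _.
have -> : m = kos_cover (tens m ((1, 0) : koszul)) by rewrite kos_coverE scale1r.
by rewrite memv_img ?memvf.
Qed.

End KoszulFactor.

(** * Projective modules are contractible *)

Section Projectives.
Variables (k : closedFieldType) (a : lieSuper k).
Hypothesis two_neq0 : (2%:R : k) != 0.
Hypothesis central : forall t x, t \in gr a false -> br a t x = 0.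
Implicit Types M N P W : smod a.

(** P is a direct summand of P (x) K, and K is contractible for y. *)
Lemma projective_contractible P : projective P -> contractible P.
Proof.
move=> [fP lP] y; pose K := koszul central y.
have fK : in_F (tensor P K).
  by apply: in_F_tensor => //; apply/in_F_wz/koszul_wz.
have [i hi pi] := lP _ _ (kos_cover central y P) \1%VF fK fP (kos_cover_hom central y P)
   (kos_cover_onto central y P) (hom_id P).
have hK := contraction_tensor_r P (koszul_contraction central y).
exists (kos_cover central y P \o tmap (M := P) (N := K) (sgn P true) (kos_contr central y) \o i)%VF.
exact: (contraction_retract hi (kos_cover_hom central y P) pi hK).
Qed.

Lemma wz_tensor M N : wz M -> wz N -> wz (tensor M N).
Proof.
move=> zM zN t v ht; have -> : act (tensor M N) t = 0; last by rewrite zero_lfunE.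
apply: tens_ext => m n; rewrite [LHS](tens_act_gr_tens _ _ ht) zM // zN //.
by rewrite tens0l tens0r addr0 zero_lfunE.
Qed.

(** Tensoring with the Koszul modules of all coordinate functionals makes each of them
    contractible, hence all their linear combinations. *)
Lemma wz_projective_over M : wz M -> exists P (p : 'Hom(P, M)),
  [/\ wz P, contractible P, is_hom p & limg p = fullv].
Proof.
move=> zM; pose X := vbasis (gr a true); pose n := \dim (gr a true).
pose y (i : 'I_n) : 'Hom(a, k^o) := linfun (fun v : a => coord X i v : k^o).
have yE i v : y i v = coord X i v by rewrite /y linfun_lin // => c u w; rewrite linearP.
have [P [p [zP cP hp sp]]] : exists P (p : 'Hom(P, M)), [/\ wz P,
    forall i, i \in enum 'I_n -> exists H, contraction (M := P) (y i) H, is_hom p & limg p = fullv].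
  elim: (enum 'I_n) => [|j s [P [p [zP cP hp sp]]]].
    by exists M, \1%VF; split=> //; [exact: hom_id|rewrite lim1g].
  pose K := koszul central (y j).
  exists (tensor P K), (p \o kos_cover central (y j) P)%VF; split.
  - exact/wz_tensor/koszul_wz.
  - move=> i; rewrite inE => /orP[/eqP->|/cP[H hH]]; last exact: contraction_tensor_l hH.
    eexists; exact: (contraction_tensor_r P (koszul_contraction central (y j))).
  - exact/hom_comp/kos_cover_hom.
  - by rewrite limg_comp kos_cover_onto.
exists P, p; split=> // z.
have : exists H, contraction (M := P) (\sum_(i <- enum 'I_n) z X`_i *: y i) H.
  elim: (enum 'I_n) cP => [|j s IH] cP.
    exists 0; rewrite big_nil; split=> *; rewrite !zero_lfunE ?linear0 //.
    by rewrite addr0 scale0r.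
  rewrite big_cons; have [|H hH] := IH; first by move=> i si; apply: cP; rewrite inE si orbT.
  have [H' hH'] := cP j (mem_head _ _).
  by exists (z X`_j *: H' + H); apply: contraction_comb.
case=> H hH; exists H; apply: contraction_eq hH => x hx.
rewrite sum_lfunE [in RHS](coord_vbasis hx) linear_sum big_enum /=.
by apply: eq_bigr => i _; rewrite scale_lfunE yE linearZ; apply: mulrC.
Qed.

End Projectives.

(** * Morphisms between tensor products *)

Section TensorHoms.
Variables (k : fieldType) (a : lieSuper k).
Implicit Types M N P W L : smod a.

Lemma sgn_tens M N i (m : M) (n : N) :
  sgn (tensor M N) i (tens m n) = tens (sgn M i m) (sgn N i n).
Proof.
case: i; last by rewrite /sgn !id_lfunE.
rewrite -(prj_add m) -(prj_add n) !(tensDl, tensDr, linearD) /=.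
rewrite !(sgn_gr _ (memv_prj _ _)).
have h i j : sgn (tensor M N) true (tens (prj M i m) (prj N j n)) =
    tens ((-1) ^+ i *: prj M i m) ((-1) ^+ j *: prj N j n).
  rewrite (sgn_gr _ (tens_gr (memv_prj _ _) (memv_prj _ _))) tensZl tensZr scalerA -exprD.
  by case: i j => -[]; rewrite /= ?expr2 ?mulN1r ?opprK.
by rewrite !h.
Qed.

Lemma tlift_parity M N W (b : M -> N -> W) d
    (bl : forall n, linear (b^~ n)) (br' : forall m, linear (b m)) :
  (forall i j m n, m \in gr M i -> n \in gr N j -> b m n \in gr W (i (+) j (+) d)) ->
  forall i A, A \in gr (tensor M N) i -> tlift b A \in gr W (i (+) d).
Proof.
move=> hb i A /(limg_projP (@tens_proj_comp _ _ _ _)) <-.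
suff -> : tlift b (tens_proj M N i A) = prj W (i (+) d) (tlift b A) by apply: memv_prj.
rewrite -!comp_lfunE; congr (fun_of_lfun _ A); apply: tens_ext_gr => i' j' m n hm hn.
rewrite !comp_lfunE (tens_proj_tens _ hm hn) tliftE // (prj_gr _ (hb _ _ _ _ hm hn)).
have -> : (i' (+) j' (+) d == i (+) d) = (i' (+) j' == i).
  by case: i i' j' d {hb hm hn} => [] [] [] [].
by case: eqP => _; rewrite ?tliftE ?linear0.
Qed.

Lemma tlift_hom M N W (b : M -> N -> W)
    (bl : forall n, linear (b^~ n)) (br' : forall m, linear (b m)) :
  (forall i j m n, m \in gr M i -> n \in gr N j -> b m n \in gr W (i (+) j)) ->
  (forall i x m n, x \in gr a i ->
     b (act M x m) n + b (sgn M i m) (act N x n) = act W x (b m n)) ->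
  is_hom (tlift b : 'Hom(tensor M N, W)).
Proof.
move=> h1 h2; split=> [i A hA|x A].
  rewrite -[i]addbF; apply: tlift_parity hA => // i' j m n hm hn.
  by rewrite addbF; apply: h1.
rewrite -(prj_add x) !linearD !add_lfunE linearD /=.
have h i : tlift b (act (tensor M N) (prj a i x) A) = act W (prj a i x) (tlift b A).
  rewrite -!comp_lfunE; congr (fun_of_lfun _ A); apply: tens_ext => m n.
  rewrite !comp_lfunE tliftE // [act (tensor M N) _ _](tens_act_gr_tens _ _ (memv_prj _ _)).
  by rewrite linearD /= !tliftE // h2 // memv_prj.
by rewrite !h.
Qed.

(** Functoriality of the tensor product; for even f and h no sign is involved. *)
Definition tmor M M' N N' (f : 'Hom(M, M')) (h : 'Hom(N, N')) : 'Hom(tensor M N, tensor M' N') :=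
  tlift (fun m n => tens (f m) (h n)).

Lemma tmorE M M' N N' (f : 'Hom(M, M')) (h : 'Hom(N, N')) m n :
  tmor f h (tens m n) = tens (f m) (h n).
Proof.
rewrite /tmor tliftE // => z c x y; rewrite linearP; first exact: tens_linear_l.
exact: tens_linear_r.
Qed.

Lemma tmor_hom M M' N N' (f : 'Hom(M, M')) (h : 'Hom(N, N')) : is_hom f -> is_hom h ->
  is_hom (tmor f h).
Proof.
move=> hf hh; apply: tlift_hom.
- by move=> z c x y; rewrite linearP; exact: tens_linear_l.
- by move=> z c x y; rewrite linearP; exact: tens_linear_r.
- by move=> i j m n hm hn; apply: tens_gr; [apply: (proj1 hf)|apply: (proj1 hh)].
move=> i x m n hx; rewrite [RHS](tens_act_gr_tens _ _ hx) (proj2 hf) (proj2 hh).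
congr (_ + tens _ _); case: (i); last by rewrite /sgn !id_lfunE.
by rewrite hom_sgn.
Qed.

Lemma tmor_comp M M' M'' N N' N'' (f' : 'Hom(M', M'')) (f : 'Hom(M, M'))
    (h' : 'Hom(N', N'')) (h : 'Hom(N, N')) :
  (tmor f' h' \o tmor f h)%VF = tmor (f' \o f)%VF (h' \o h)%VF.
Proof. by apply: tens_ext => m n; rewrite comp_lfunE !tmorE !comp_lfunE. Qed.

Lemma tmor_id M N : tmor (\1%VF : 'Hom(M, M)) (\1%VF : 'Hom(N, N)) = \1%VF.
Proof. by apply: tens_ext => m n; rewrite tmorE !id_lfunE. Qed.

Lemma tmor_subl M M' N N' (f f' : 'Hom(M, M')) (h : 'Hom(N, N')) :
  tmor f h - tmor f' h = tmor (f - f') h.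
Proof.
apply: tens_ext => m n; rewrite add_lfunE opp_lfunE !tmorE add_lfunE opp_lfunE.
by rewrite tensDl -[- f' m]scaleN1r tensZl scaleN1r.
Qed.

Lemma tmor_subr M M' N N' (f : 'Hom(M, M')) (h h' : 'Hom(N, N')) :
  tmor f h - tmor f h' = tmor f (h - h').
Proof.
apply: tens_ext => m n; rewrite add_lfunE opp_lfunE !tmorE add_lfunE opp_lfunE.
by rewrite tensDr -[- h' n]scaleN1r tensZr scaleN1r.
Qed.

Lemma act_triv d x (v : triv a d) : act (triv a d) x v = 0.
Proof. by rewrite /= !zero_lfunE. Qed.

Lemma tensor_unit_r M : smod_iso (tensor M (k_ev a)) M.
Proof.
pose b (m : M) (c : k_ev a) : M := (c : k) *: m.
have bl c : linear (b^~ c) by move=> d x y; rewrite /b scalerDr !scalerA mulrC.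
have br' m : linear (b m) by move=> d x y; rewrite /b scalerDl scalerA.
pose h : 'Hom(M, tensor M (k_ev a)) := linfun (fun m => tens m (1 : k_ev a)).
have hE m : h m = tens m (1 : k_ev a).
  by rewrite /h linfun_lin // => c x y; apply: tens_linear_l.
apply: (@iso_from_inverse _ _ _ _ (tlift b) h).
- apply: tlift_hom => //.
    move=> i [] m n hm; rewrite /= /triv_gr /= ?addbF => hn; last exact: memvZ.
    by move: hn; rewrite memv0 => /eqP->; rewrite /b scale0r mem0v.
  move=> i x m n hx; rewrite act_triv.
  by rewrite /b scale0r addr0 linearZ.
- apply: tens_ext => m n; rewrite comp_lfunE tliftE // hE id_lfunE /b tensZl -tensZr.
  by congr tens; rewrite /GRing.scale /= mulr1.
by apply/lfunP => m; rewrite comp_lfunE hE tliftE // id_lfunE /b scale1r.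
Qed.

Lemma tensor_unit_l M : smod_iso (tensor (k_ev a) M) M.
Proof.
pose b (c : k_ev a) (m : M) : M := (c : k) *: m.
have br' c : linear (b c) by move=> d x y; rewrite /b scalerDr !scalerA mulrC.
have bl m : linear (b^~ m) by move=> d x y; rewrite /b scalerDl scalerA.
pose h : 'Hom(M, tensor (k_ev a) M) := linfun (tens (1 : k_ev a)).
have hE m : h m = tens (1 : k_ev a) m.
  by rewrite /h linfun_lin // => c x y; apply: tens_linear_r.
have sgk i (c : k_ev a) : sgn (k_ev a) i c = c.
  have : c \in gr (k_ev a) false by rewrite /= /triv_gr /= memvf.
  by move/(sgn_gr i) ->; rewrite andbF expr0 scale1r.
apply: (@iso_from_inverse _ _ _ _ (tlift b) h).
- apply: tlift_hom => //.
    move=> [] j m n; rewrite /= /triv_gr /= => hm hn; last exact: memvZ.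
    by move: hm; rewrite memv0 => /eqP->; rewrite /b scale0r mem0v.
  move=> i x m n hx; rewrite act_triv sgk.
  by rewrite /b scale0r add0r linearZ.
- apply: tens_ext => m n; rewrite comp_lfunE tliftE // hE id_lfunE /b tensZr -tensZl.
  by congr tens; rewrite /GRing.scale /= mulr1.
by apply/lfunP => m; rewrite comp_lfunE hE tliftE // id_lfunE /b scale1r.
Qed.

Section Assoc.
Variables M N L : smod a.

Let f1 (l : L) (m : M) (n : N) : tensor M (tensor N L) := tens m (tens n l : tensor N L).
Let f1l l n : linear ((f1 l)^~ n).
Proof. by move=> c x y; apply: tens_linear_l. Qed.
Let f1r l m : linear (f1 l m).
Proof. by move=> c x y; rewrite /f1 tens_linear_l; apply: tens_linear_r. Qed.
Let f2 (A : tensor M N) (l : L) : tensor M (tensor N L) := tlift (f1 l) A.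
Let f2E m n l : f2 (tens m n) l = tens m (tens n l : tensor N L).
Proof. by rewrite /f2 tliftE. Qed.
Let f2l l : linear (f2^~ l).
Proof. by move=> c x y; rewrite /f2 linearP. Qed.
Let f2r A : linear (f2 A).
Proof.
move=> c x y; rewrite /f2 -scale_lfunE -add_lfunE; congr (fun_of_lfun _ A).
apply: tens_ext => m n; rewrite add_lfunE scale_lfunE !tliftE // /f1.
by rewrite tens_linear_r tens_linear_r.
Qed.

Lemma f2_hom : is_hom (tlift f2 : 'Hom(tensor (tensor M N) L, tensor M (tensor N L))).
Proof.
apply: tlift_hom => //.
  move=> i j A l hA hl; apply: tlift_parity hA => // i' j' m n hm hn.
  by rewrite /f1 -addbA; do 2 apply: tens_gr => //.
move=> i x A l hx; rewrite /f2.
rewrite -[tlift (f1 (act L x l)) _]comp_lfunE -!comp_lfunE -add_lfunE.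
congr (fun_of_lfun _ A); apply: tens_ext => m n.
rewrite add_lfunE !comp_lfunE sgn_tens [act (tensor M N) x _](tens_act_gr_tens _ _ hx).
rewrite linearD /= !tliftE // /f1 (tens_act_gr_tens m (tens n l : tensor N L) hx).
by rewrite [act (tensor N L) x _](tens_act_gr_tens _ _ hx) tensDr addrA.
Qed.

Let h1 (m : M) (n : N) (l : L) : tensor (tensor M N) L := tens (tens m n : tensor M N) l.
Let h1l m l : linear ((h1 m)^~ l).
Proof. by move=> c x y; rewrite /h1 tens_linear_r; apply: tens_linear_l. Qed.
Let h1r m n : linear (h1 m n).
Proof. by move=> c x y; apply: tens_linear_r. Qed.
Let h2 (m : M) (B : tensor N L) : tensor (tensor M N) L := tlift (h1 m) B.
Let h2r m : linear (h2 m).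
Proof. by move=> c x y; rewrite /h2 linearP. Qed.
Let h2l B : linear (h2^~ B).
Proof.
move=> c x y; rewrite /h2 -scale_lfunE -add_lfunE; congr (fun_of_lfun _ B).
apply: tens_ext => n l; rewrite add_lfunE scale_lfunE !tliftE // /h1.
by rewrite tens_linear_l tens_linear_l.
Qed.

Lemma tensor_assoc : smod_iso (tensor (tensor M N) L) (tensor M (tensor N L)).
Proof.
apply: (iso_from_inverse (f := tlift f2) (h := tlift h2)); first exact: f2_hom.
- apply: tens_ext => A l; rewrite comp_lfunE tliftE // id_lfunE.
  pose F : 'Hom(tensor M N, tensor (tensor M N) L) := linfun (fun A : tensor M N => tens A l).
  have FE B : F B = tens B l by rewrite /F linfun_lin // => c x y; apply: tens_linear_l.
  rewrite -FE /f2 -comp_lfunE; congr (fun_of_lfun _ A); apply: tens_ext => m n.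
  by rewrite comp_lfunE tliftE // tliftE // /h2 tliftE // FE.
apply: tens_ext => m B; rewrite comp_lfunE tliftE // id_lfunE.
pose F : 'Hom(tensor N L, tensor M (tensor N L)) := linfun (fun B : tensor N L => tens m B).
have FE C : F C = tens m C by rewrite /F linfun_lin // => c x y; apply: tens_linear_r.
rewrite -FE /h2 -comp_lfunE; congr (fun_of_lfun _ B); apply: tens_ext => n l.
by rewrite comp_lfunE tliftE // tliftE // /f2 tliftE // FE.
Qed.
End Assoc.

Section DirectSumMaps.
Variables M P Q : smod a.

Definition dpair (f : 'Hom(M, P)) (h : 'Hom(M, Q)) : 'Hom(M, dsum P Q) :=
  linfun (fun m => (f m, h m) : P * Q).
Definition dcopair (f : 'Hom(P, M)) (h : 'Hom(Q, M)) : 'Hom(dsum P Q, M) :=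
  linfun (fun u : P * Q => f u.1 + h u.2).

Lemma dpairE f h m : dpair f h m = (f m, h m).
Proof. by rewrite /dpair linfun_lin // => c x y; congr (_, _); rewrite linearP. Qed.

Lemma dcopairE f h u : dcopair f h u = f u.1 + h u.2.
Proof. by rewrite /dcopair linfun_lin // => c x y; rewrite !linearP scalerDr addrACA. Qed.

Lemma dpair_hom f h : is_hom f -> is_hom h -> is_hom (dpair f h).
Proof.
move=> [f1 f2] [h1 h2]; split=> [i v vi|x v]; rewrite !dpairE.
  by apply/dsum_grP; split; [apply: f1|apply: h1].
by rewrite [RHS]dsum_actE /dsum_act_fun /= f2 h2.
Qed.

Lemma dcopair_hom f h : is_hom f -> is_hom h -> is_hom (dcopair f h).
Proof.
move=> [f1 f2] [h1 h2]; split=> [i v /dsum_grP[v1 v2]|x v]; rewrite !dcopairE.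
  by rewrite memvD ?f1 ?h1.
by rewrite [act _ x v]dsum_actE /dsum_act_fun /= f2 h2 linearD.
Qed.
End DirectSumMaps.
End TensorHoms.

(** * Stable isomorphism *)

Section StableIso.
Variables (k : closedFieldType) (a : lieSuper k).
Hypothesis two_neq0 : (2%:R : k) != 0.
Hypothesis central : forall t x, t \in gr a false -> br a t x = 0.
Implicit Types M N P W L : smod a.

Lemma projective_dsum P W : projective P -> projective W -> projective (dsum P W).
Proof.
move=> pP pW; apply: contractible_projective => //.
  by apply: in_F_dsum => //; [case: pP|case: pW].
by apply: contr_dsum; apply: projective_contractible.
Qed.

Lemma wz_triv d : wz (triv a d).
Proof. by move=> t v _; apply: act_triv. Qed.

(** Needed for reflexivity: the zero map has to factor through some projective module. *)
Lemma projective_exists : exists P : smod a, projective P.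
Proof.
have [P [p [zP cP _ _]]] := wz_projective_over two_neq0 central (@wz_triv false).
by exists P; apply: contractible_projective => //; apply: in_F_wz.
Qed.

Lemma stable_eq_add M N (f f' h h' : 'Hom(M, N)) : stable_eq f f' -> stable_eq h h' ->
  stable_eq (f + h) (f' + h').
Proof.
move=> [P [u [v [pP hu hv e]]]] [Q [u' [v' [pQ hu' hv' e']]]].
exists (dsum P Q), (dpair u u'), (dcopair v v'); split.
- exact: projective_dsum.
- exact: dpair_hom.
- exact: dcopair_hom.
rewrite opprD addrACA e e'; apply/lfunP => m.
by rewrite add_lfunE !comp_lfunE dpairE dcopairE.
Qed.

Lemma stable_eq_refl M N (f : 'Hom(M, N)) : stable_eq f f.
Proof.
have [P pP] := projective_exists; exists P, 0, 0.
by split=> //; [exact: hom_zero|exact: hom_zero|rewrite subrr comp_lfun0r].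
Qed.

Lemma stable_eq_trans M N (f f' f'' : 'Hom(M, N)) : stable_eq f f' -> stable_eq f' f'' ->
  stable_eq f f''.
Proof.
move=> h /(stable_eq_add h) [P [u [v [pP hu hv e]]]]; exists P, u, v; split=> //.
by rewrite -e opprD addrA addrK.
Qed.

Lemma stable_eq_comp M N L W (f f' : 'Hom(N, L)) (l : 'Hom(L, W)) (r : 'Hom(M, N)) :
  is_hom l -> is_hom r -> stable_eq f f' -> stable_eq (l \o f \o r)%VF (l \o f' \o r)%VF.
Proof.
move=> hl hr [P [u [v [pP hu hv e]]]]; exists P, (u \o r)%VF, (l \o v)%VF.
split=> //; [exact: hom_comp|exact: hom_comp|].
apply/lfunP => m; have /lfunP/(_ (r m)) := e.
rewrite !add_lfunE !opp_lfunE !comp_lfunE => e'; rewrite -linearB /=.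
by congr (l _); rewrite -e'.
Qed.

Lemma stable_iso_refl M : stable_iso M M.
Proof.
exists \1%VF, \1%VF; rewrite comp_lfun1l.
by split; try exact: hom_id; apply: stable_eq_refl.
Qed.

Lemma stable_iso_sym M N : stable_iso M N -> stable_iso N M.
Proof. by move=> [f [h [hf hh e1 e2]]]; exists h, f. Qed.

Lemma stable_iso_trans M N L : stable_iso M N -> stable_iso N L -> stable_iso M L.
Proof.
move=> [f [h [hf hh e1 e2]]] [f' [h' [hf' hh' e1' e2']]].
exists (f' \o f)%VF, (h \o h')%VF; split; try exact: hom_comp.
  apply: stable_eq_trans e1; have := stable_eq_comp hh hf e1'.
  by rewrite comp_lfun1r !comp_lfunA.
apply: stable_eq_trans e2'; have := stable_eq_comp hf' hh' e2.
by rewrite comp_lfun1r !comp_lfunA.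
Qed.

Lemma iso_stable_iso M N : smod_iso M N -> stable_iso M N.
Proof.
move=> [f [hf k0 i1]]; have [h [hh e1 e2]] := iso_inverse hf k0 i1.
by exists f, h; rewrite e1 e2; split=> //; apply: stable_eq_refl.
Qed.

Lemma projective_tensor_l P N : projective P -> in_F N -> projective (tensor P N).
Proof.
move=> pP fN; apply: contractible_projective => //.
  by apply: in_F_tensor => //; case: pP.
by apply: contr_tensor_l => //; apply: projective_contractible.
Qed.

Lemma projective_tensor_r P N : projective P -> in_F N -> projective (tensor N P).
Proof.
move=> pP fN; apply: contractible_projective => //.
  by apply: in_F_tensor => //; case: pP.
by apply: contr_tensor_r => //; apply: projective_contractible.
Qed.

Lemma stable_iso_tensor_l M M' N : in_F N -> stable_iso M M' ->
  stable_iso (tensor M N) (tensor M' N).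
Proof.
move=> fN [f [h [hf hh e1 e2]]]; pose i : 'Hom(N, N) := \1%VF.
exists (tmor f i), (tmor h i); split; try by apply: tmor_hom => //; exact: hom_id.
  case: e1 => P [u [v [pP hu hv e]]]; exists (tensor P N), (tmor u i), (tmor v i).
  split; try by apply: tmor_hom => //; exact: hom_id.
    exact: projective_tensor_l.
  by rewrite !tmor_comp comp_lfun1l -[X in _ - X]tmor_id tmor_subl e.
case: e2 => P [u [v [pP hu hv e]]]; exists (tensor P N), (tmor u i), (tmor v i).
split; try by apply: tmor_hom => //; exact: hom_id.
  exact: projective_tensor_l.
by rewrite !tmor_comp comp_lfun1l -[X in _ - X]tmor_id tmor_subl e.
Qed.

Lemma stable_iso_tensor_r M M' N : in_F N -> stable_iso M M' ->
  stable_iso (tensor N M) (tensor N M').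
Proof.
move=> fN [f [h [hf hh e1 e2]]]; pose i : 'Hom(N, N) := \1%VF.
exists (tmor i f), (tmor i h); split; try by apply: tmor_hom => //; exact: hom_id.
  case: e1 => P [u [v [pP hu hv e]]]; exists (tensor N P), (tmor i u), (tmor i v).
  split; try by apply: tmor_hom => //; exact: hom_id.
    exact: projective_tensor_r.
  by rewrite !tmor_comp comp_lfun1l -[X in _ - X]tmor_id tmor_subr e.
case: e2 => P [u [v [pP hu hv e]]]; exists (tensor N P), (tmor i u), (tmor i v).
split; try by apply: tmor_hom => //; exact: hom_id.
  exact: projective_tensor_r.
by rewrite !tmor_comp comp_lfun1l -[X in _ - X]tmor_id tmor_subr e.
Qed.

Lemma stable_iso_tensor M M' N N' : in_F M' -> in_F N ->
  stable_iso M M' -> stable_iso N N' -> stable_iso (tensor M N) (tensor M' N').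
Proof.
move=> fM' fN e e'; apply: (@stable_iso_trans _ (tensor M' N)).
  exact: stable_iso_tensor_l.
exact: stable_iso_tensor_r.
Qed.

Lemma stable_iso_dsum M N P : projective P -> smod_iso M (dsum N P) -> stable_iso M N.
Proof.
move=> pP e; apply: stable_iso_trans (iso_stable_iso e) _.
exists (dcopair \1%VF 0), (dpair \1%VF 0); split.
- by apply: dcopair_hom; [exact: hom_id|exact: hom_zero].
- by apply: dpair_hom; [exact: hom_id|exact: hom_zero].
- exists P, (- dcopair 0 \1%VF), (dpair 0 \1%VF); split=> //.
  + by apply: hom_opp; apply: dcopair_hom; [exact: hom_zero|exact: hom_id].
  + by apply: dpair_hom; [exact: hom_zero|exact: hom_id].
  apply/lfunP => -[n p]; rewrite add_lfunE !opp_lfunE !comp_lfunE !opp_lfunE !dcopairE !dpairE.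
  rewrite /= !id_lfunE !zero_lfunE addr0 add0r.
  by congr (_, _); rewrite /= ?subrr ?sub0r.
rewrite (_ : (_ \o _)%VF = \1%VF); first exact: stable_eq_refl.
by apply/lfunP => n; rewrite comp_lfunE dpairE dcopairE /= !id_lfunE zero_lfunE addr0.
Qed.
End StableIso.

(** * Ranks and dimensions of modules of weight zero *)

(** The contraction H makes the two-periodic complex (Z, e) exact. *)
Lemma contraction_dim (k : fieldType) (T : vectType k) (Z : bool -> {vspace T}) (e H : 'End(T)) i :
  (forall i, e @: Z i <= Z (~~ i))%VS -> (forall i, H @: Z i <= Z (~~ i))%VS ->
  (forall i v, v \in Z i -> e (e v) = 0) ->
  (forall i v, v \in Z i -> e (H v) + H (e v) = v) ->
  \dim (Z i) = (\dim (e @: Z i) + \dim (e @: Z (~~ i)))%N.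
Proof.
move=> eZ HZ ee eH; rewrite -(limg_ker_dim e (Z i)) addnC; congr (_ + \dim _)%N.
apply/vspaceP => v; rewrite memv_cap memv_ker; apply/andP/memv_imgP.
  case=> vZ /eqP ev; exists (H v); first by apply: (subvP (HZ i)); rewrite memv_img.
  by rewrite -[LHS](eH i v vZ) ev linear0 addr0.
case=> w wZ ->; rewrite (ee (~~ i)) // eqxx; split=> //.
by have := eZ (~~ i); rewrite negbK => /subvP; apply; rewrite memv_img.
Qed.

Section Ranks.
Variables (k : closedFieldType) (a : lieSuper k).
Hypothesis two_neq0 : (2%:R : k) != 0.
Hypothesis central : forall t x, t \in gr a false -> br a t x = 0.
Implicit Types M N P W L : smod a.

Lemma wz_sq M x v : wz M -> x \in gr a true -> act M x (act M x v) = 0.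
Proof.
move=> zM hx; rewrite (act_odd_sq two_neq0) // zM ?scaler0 //.
by rewrite -[false]/(true (+) true) br_gr.
Qed.

Lemma wz_anti M x y v : wz M -> x \in gr a true -> y \in gr a true ->
  act M x (act M y v) = - act M y (act M x v).
Proof.
move=> zM hx hy; rewrite (act_odd_anti _ hx hy) zM ?sub0r //.
by rewrite -[false]/(true (+) true) br_gr.
Qed.

Definition rk M i (x : a) := \dim (act M x @: gr M i).
Definition gdim M i := \dim (gr M i).

Lemma act_odd_img M x i : x \in gr a true -> (act M x @: gr M i <= gr M (~~ i))%VS.
Proof.
by move=> hx; apply/subvP => _ /memv_imgP[v vi ->]; rewrite -addTb act_gr.
Qed.

(** Locally one-dimensional: the homology of every nonzero odd element, which has square zero on
    a module of weight zero, is of dimension one. *)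
Definition lod M := wz M /\ forall x, x \in gr a true -> x != 0 ->
  \dim {:M} = (2 * (rk M false x + rk M true x)).+1.

Lemma gdim_add M : \dim {:M} = (gdim M false + gdim M true)%N.
Proof. exact: dim_gr. Qed.

Lemma rk_le M i x : wz M -> x \in gr a true -> (rk M i x + rk M (~~ i) x <= gdim M i)%N.
Proof.
move=> zM hx; rewrite /gdim -(limg_ker_dim (act M x) (gr M i)) addnC leq_add2r.
apply: dimvS; rewrite subv_cap -{2}[i]negbK act_odd_img //=.
by apply/subvP => _ /memv_imgP[v _ ->]; rewrite memv_ker wz_sq.
Qed.

Lemma functional_1 (x : a) : x != 0 -> exists y : 'Hom(a, k^o), y x = 1.
Proof.
move=> x0; pose X := [tuple x]; have fX : free X by rewrite seq1_free.
exists (linfun (fun v : a => coord X ord0 v : k^o)).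
rewrite linfun_lin; last by move=> c u v; rewrite linearP.
by have := coord_free ord0 ord0 fX; rewrite /= => ->.
Qed.

Lemma functional_01 (x w : a) : free [:: x; w] -> exists y : 'Hom(a, k^o), y x = 0 /\ y w = 1.
Proof.
move=> fX; pose X := [tuple x; w]; pose i1 : 'I_2 := Ordinal (isT : 1 < 2)%N.
exists (linfun (fun v : a => coord X i1 v : k^o)).
rewrite linfun_lin; last by move=> c u v; rewrite linearP.
rewrite linfun_lin; last by move=> c u v; rewrite linearP.
have fX' : free X by [].
by have := coord_free ord0 i1 fX'; have := coord_free i1 i1 fX'; rewrite /= => -> ->.
Qed.

(** For y(x) = 1 the contraction makes the complex of x exact. *)
Lemma contractible_gdim P x i : wz P -> contractible P -> x \in gr a true -> x != 0 ->
  gdim P i = (rk P i x + rk P (~~ i) x)%N.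
Proof.
move=> zP cP hx x0; have [y yx] := functional_1 x0.
have [H [H1 H2] /(anti_sgn_odd two_neq0) Ho] := contr_odd two_neq0 y cP.
apply: (@contraction_dim _ _ (gr P) (act P x) H).
- by move=> j; apply: act_odd_img.
- by move=> j; apply/subvP => _ /memv_imgP[v vj ->]; apply: Ho.
- by move=> j v _; apply: wz_sq.
by move=> j v _; rewrite H2 // yx scale1r.
Qed.

(** For y(x) = 0 and y(w) = 1 the contraction anticommutes with x, so it makes the complex of w
    on the image of x exact; the two degrees of an exact two-periodic complex have equal dimension.
    This uses an element w independent of x, and is the reason for assuming rank at least two. *)
Lemma contractible_rk P x w i : wz P -> contractible P -> x \in gr a true -> w \in gr a true ->
  free [:: x; w] -> rk P i x = rk P (~~ i) x.
Proof.
move=> zP cP hx hw fxw; have [y [yx yw]] := functional_01 fxw.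
have [H [H1 H2] /(anti_sgn_odd two_neq0) Ho] := contr_odd two_neq0 y cP.
pose Z j := (act P x @: gr P (~~ j))%VS.
have ZE j : \dim (Z j) = (\dim (act P w @: Z j) + \dim (act P w @: Z (~~ j)))%N.
  apply: (@contraction_dim _ _ Z (act P w) H).
  - move=> l; apply/subvP => _ /memv_imgP[_ /memv_imgP[v vl ->] ->].
    rewrite wz_anti // -linearN memv_img // memvN -addTb; exact: act_gr.
  - move=> l; apply/subvP => _ /memv_imgP[_ /memv_imgP[v vl ->] ->].
    have := H2 x v hx; rewrite yx scale0r => /eqP; rewrite addrC addr_eq0 => /eqP->.
    by rewrite -linearN memv_img // memvN; apply: Ho.
  - by move=> l v _; apply: wz_sq.
  by move=> l v _; rewrite H2 // yw scale1r.
by have := ZE (~~ i); have := ZE i; rewrite /Z /rk negbK => -> ->; rewrite addnC.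
Qed.

Section Biprod.
Variables (W M X : smod a).
Variables (i : 'Hom(M, W)) (p : 'Hom(W, M)) (j : 'Hom(X, W)) (q : 'Hom(W, X)).
Hypotheses (hi : is_hom i) (hp : is_hom p) (hj : is_hom j) (hq : is_hom q).
Hypotheses (pi : (p \o i)%VF = \1%VF) (qj : (q \o j)%VF = \1%VF).
Hypothesis full : (i \o p)%VF + (j \o q)%VF = \1%VF.

Let piE m : p (i m) = m. Proof. by rewrite -comp_lfunE pi id_lfunE. Qed.
Let qjE m : q (j m) = m. Proof. by rewrite -comp_lfunE qj id_lfunE. Qed.
Let fullE w : i (p w) + j (q w) = w.
Proof. by rewrite -!comp_lfunE -add_lfunE full id_lfunE. Qed.
Let pj x : p (j x) = 0.
Proof.
have := fullE (j x); rewrite qjE => /eqP; rewrite -subr_eq0 addrK => /eqP e.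
by rewrite -[LHS]piE e linear0.
Qed.

Lemma biprod_dim (A : {vspace M}) (B : {vspace X}) :
  \dim (i @: A + j @: B)%VS = (\dim A + \dim B)%N.
Proof.
have i0 : lker i == 0%VS by apply/lker0P => u v e; rewrite -[u]piE e piE.
have j0 : lker j == 0%VS by apply/lker0P => u v e; rewrite -[u]qjE e qjE.
rewrite dimv_disjoint_sum ?limg_dim_eq ?(eqP i0) ?(eqP j0) ?capv0 //.
apply/eqP; rewrite -subv0; apply/subvP => _ /memv_capP[/memv_imgP[u _ ->] /memv_imgP[v _ e]].
by rewrite -[u]piE e pj !linear0 mem0v.
Qed.

Lemma biprod_gr d : gr W d = (i @: gr M d + j @: gr X d)%VS.
Proof.
apply/eqP; rewrite eqEsubv subv_add; apply/and3P; split.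
- apply/subvP => w wd; rewrite -(fullE w) memv_add // memv_img //.
    exact: (proj1 hp).
  exact: (proj1 hq).
- by apply/subvP => _ /memv_imgP[m md ->]; apply: (proj1 hi).
- by apply/subvP => _ /memv_imgP[m md ->]; apply: (proj1 hj).
Qed.

Lemma biprod_gdim d : gdim W d = (gdim M d + gdim X d)%N.
Proof. by rewrite /gdim biprod_gr biprod_dim. Qed.

Lemma biprod_rk d x : rk W d x = (rk M d x + rk X d x)%N.
Proof.
rewrite /rk -biprod_dim biprod_gr limgD -!limg_comp; congr (\dim (_ + _)).
  by apply: eq_in_limg => m _; rewrite !comp_lfunE (proj2 hi).
by apply: eq_in_limg => m _; rewrite !comp_lfunE (proj2 hj).
Qed.
End Biprod.

Lemma iso_gdim_rk M N : smod_iso M N ->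
  (forall d, gdim M d = gdim N d) /\ (forall d x, rk M d x = rk N d x).
Proof.
move=> [f [hf k0 i1]]; have f0 : lker f == 0%VS by rewrite k0.
have grE d : gr N d = (f @: gr M d)%VS.
  apply/eqP; rewrite eqEsubv; apply/andP; split; apply/subvP => v; last first.
    by case/memv_imgP => m md ->; apply: (proj1 hf).
  move=> vd; have : v \in limg f by rewrite i1 memvf.
  case/memv_imgP => m _ vE; rewrite -(prj_id vd) vE -hom_prj // memv_img ?memv_prj //.
split=> [d|d x]; first by rewrite /gdim grE limg_dim_eq // k0 capv0.
rewrite /rk grE -limg_comp.
have -> : ((act N x \o f) @: gr M d = f @: (act M x @: gr M d))%VS.
  by rewrite -limg_comp; apply: eq_in_limg => m _; rewrite !comp_lfunE (proj2 hf).
by rewrite [RHS]limg_dim_eq // k0 capv0.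
Qed.

Lemma dsum_gdim_rk M N : (forall d, gdim (dsum M N) d = (gdim M d + gdim N d)%N) /\
  (forall d x, rk (dsum M N) d x = (rk M d x + rk N d x)%N).
Proof.
pose i : 'Hom(M, dsum M N) := dpair \1%VF 0; pose j : 'Hom(N, dsum M N) := dpair 0 \1%VF.
pose p : 'Hom(dsum M N, M) := dcopair \1%VF 0; pose q : 'Hom(dsum M N, N) := dcopair 0 \1%VF.
have hi : is_hom i by apply: dpair_hom; [exact: hom_id|exact: hom_zero].
have hj : is_hom j by apply: dpair_hom; [exact: hom_zero|exact: hom_id].
have hp : is_hom p by apply: dcopair_hom; [exact: hom_id|exact: hom_zero].
have hq : is_hom q by apply: dcopair_hom; [exact: hom_zero|exact: hom_id].
have pi : (p \o i)%VF = \1%VF.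
  by apply/lfunP => v; rewrite comp_lfunE dpairE dcopairE /= !id_lfunE zero_lfunE addr0.
have qj : (q \o j)%VF = \1%VF.
  by apply/lfunP => v; rewrite comp_lfunE dpairE dcopairE /= !id_lfunE zero_lfunE add0r.
have full : (i \o p)%VF + (j \o q)%VF = \1%VF.
  apply/lfunP => -[u v]; rewrite add_lfunE !comp_lfunE !dpairE !dcopairE /=.
  by rewrite !id_lfunE !zero_lfunE; congr (_, _); rewrite /= ?addr0 ?add0r.
split; first exact: (biprod_gdim hi hp hj hq pi qj full).
exact: (biprod_rk hi hp hj hq pi qj full).
Qed.

(** The weight space of weight zero for a_0. *)
Definition wzpart M : {vspace M} := (\bigcap_(t <- vbasis (gr a false)) lker (act M t))%VS.

Lemma wzpartP M v : reflect (forall t, t \in gr a false -> act M t v = 0) (v \in wzpart M).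
Proof.
apply: (iffP idP) => [h t ht|h].
  rewrite (coord_vbasis ht) linear_sum sum_lfunE big1 // => i _.
  rewrite linearZ scale_lfunE; suff -> : act M (vbasis (gr a false))`_i v = 0 by rewrite scaler0.
  have ti : (vbasis (gr a false))`_i \in vbasis (gr a false) by rewrite mem_nth ?size_tuple.
  apply/eqP; rewrite -memv_ker; apply: subvP h.
  by rewrite /wzpart (big_rem _ ti) /= capvSl.
rewrite /wzpart big_seq; elim/big_rec: _ => [|t U tT IH]; first exact: memvf.
by rewrite memv_cap IH andbT memv_ker h //; apply: vbasis_mem.
Qed.

Lemma act_even_prj M t i v : t \in gr a false -> act M t (prj M i v) = prj M i (act M t v).
Proof.
move=> ht; rewrite -[in RHS](prj_add v) !linearD /=.
have h j : prj M i (act M t (prj M j v)) = if j == i then act M t (prj M j v) else 0.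
  by apply: prj_gr; rewrite -[j]addFb act_gr // memv_prj.
by rewrite !h; clear h; case: i => /=; rewrite ?addr0 ?add0r.
Qed.

Lemma wzpart_submod M : submod (wzpart M).
Proof.
split=> [i v /wzpartP h|x v /wzpartP h]; apply/wzpartP => t ht.
  by rewrite act_even_prj // h // linear0.
by rewrite act_even_comm // h // linear0.
Qed.

Definition wzmod M : smod a := sub_smod (wzpart_submod M).

Lemma wzmod_wz M : wz (wzmod M).
Proof.
move=> t v ht; apply: subvs_inj; rewrite sub_actE linear0.
by have /wzpartP/(_ t ht) := subvsP v.
Qed.

Lemma contractible_wzmod M : contractible M -> contractible (wzmod M).
Proof.
move=> cM y; have [H [H1 H2]] := cM y.
have st : (H @: wzpart M <= wzpart M)%VS.
  apply/subvP => _ /memv_imgP[v /wzpartP h ->]; apply/wzpartP => t ht.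
  by rewrite -H1 // h // linear0.
exists (restr (wzpart M) H); split=> [t v ht|x v hx].
  by rewrite !wzmod_wz // linear0.
apply: subvs_inj; rewrite linearD linearZ /= !restrE // !sub_actE restrE //.
by rewrite H2.
Qed.

Lemma hom_to_wzpart M N (f : 'Hom(M, N)) : wz M -> is_hom f -> (limg f <= wzpart N)%VS.
Proof.
move=> zM [_ f2]; apply/subvP => _ /memv_imgP[v _ ->]; apply/wzpartP => t ht.
by rewrite -f2 zM ?linear0.
Qed.

(** Schanuel argument: if h f - 1 factors through P by u and v, then (f, u) embeds M as a direct
    summand of N + P.  The complement X is contractible because 1 - i p factors through a projective
    module.  Replacing P by its part of weight zero keeps everything in weight zero. *)
Lemma stable_iso_wz M N : wz M -> wz N -> stable_iso M N ->
  exists P X : smod a, [/\ wz P /\ contractible P, wz X /\ contractible X,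
    forall d, (gdim N d + gdim P d = gdim M d + gdim X d)%N
  & forall d x, (rk N d x + rk P d x = rk M d x + rk X d x)%N].
Proof.
move=> zM zN [f [h [hf hh [P0 [b [c [pP hb hc e1]]]] [Q [b' [c' [pQ hb' hc' e2]]]]]]].
have cP0 := projective_contractible central pP.
have cQ := projective_contractible central pQ.
pose P := wzmod P0; have zP : wz P by apply: wzmod_wz.
have cP : contractible P by apply: contractible_wzmod.
have lb : (limg b <= wzpart P0)%VS by apply: hom_to_wzpart.
pose u : 'Hom(M, P) := corestr (wzpart_submod P0) b.
pose v : 'Hom(P, M) := (c \o sub_incl (wzpart_submod P0))%VF.
have hu : is_hom u by apply: corestr_hom.
have hv : is_hom v by apply: hom_comp => //; apply: sub_incl_hom.
have vu : (v \o u)%VF = (h \o f)%VF - \1%VF.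
  by rewrite e1 /v -comp_lfunA sub_incl_corestr.
have vuE m : v (u m) = h (f m) - m.
  by rewrite -[v _]comp_lfunE vu add_lfunE opp_lfunE comp_lfunE id_lfunE.
have cbE n : c' (b' n) = f (h n) - n.
  by rewrite -[c' _]comp_lfunE -e2 add_lfunE opp_lfunE comp_lfunE id_lfunE.
pose W := dsum N P; pose i : 'Hom(M, W) := dpair f u; pose p : 'Hom(W, M) := dcopair h (- v).
have hi : is_hom i by apply: dpair_hom.
have hp : is_hom p by apply: dcopair_hom => //; apply: hom_opp.
have pi : (p \o i)%VF = \1%VF.
  apply/lfunP => m; rewrite comp_lfunE dpairE dcopairE id_lfunE /= opp_lfunE vuE.
  by rewrite opprB addrC subrK.
pose e : 'End(W) := \1%VF - (i \o p)%VF.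
have he : is_hom e by apply: hom_sub; [exact: hom_id|apply: hom_comp].
have eE w : e w = w - i (p w) by rewrite /e add_lfunE opp_lfunE comp_lfunE id_lfunE.
have ker_sub : submod (lker p).
  split=> [d w|x w]; rewrite !memv_ker => /eqP pw; first by rewrite (hom_prj _ _ hp) pw linear0.
  by rewrite (proj2 hp) pw linear0.
have le : (limg e <= lker p)%VS.
  apply/subvP => _ /memv_imgP[w _ ->]; rewrite memv_ker eE linearB /= -[p (i _)]comp_lfunE pi.
  by rewrite id_lfunE subrr.
have eid w : w \in lker p -> e w = w by rewrite memv_ker eE => /eqP->; rewrite linear0 subr0.
pose X := sub_smod ker_sub; pose j : 'Hom(X, W) := sub_incl ker_sub.
pose q : 'Hom(W, X) := corestr ker_sub e.
have hj : is_hom j by apply: sub_incl_hom.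
have hq : is_hom q by apply: corestr_hom.
have qj : (q \o j)%VF = \1%VF by apply: corestr_sub_incl.
have full : (i \o p)%VF + (j \o q)%VF = \1%VF.
  by rewrite sub_incl_corestr // /e addrC subrK.
have zW : wz W.
  by move=> t [n m] ht; rewrite [LHS]dsum_actE /dsum_act_fun /= zN // zP.
have zX : wz X.
  by move=> t w ht; apply: subvs_inj; rewrite sub_actE zW // linear0.
have cX : contractible X.
  (* 1 - i p factors through Q + P + P: Q accounts for f h - 1, the two copies
     of P for the terms of 1 - i p that involve the summand P *)
  pose R := dsum Q (dsum P P).
  pose prN : 'Hom(W, N) := dcopair \1%VF 0; pose prP : 'Hom(W, P) := dcopair 0 \1%VF.
  have hprN : is_hom prN by apply: dcopair_hom; [exact: hom_id|exact: hom_zero].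
  have hprP : is_hom prP by apply: dcopair_hom; [exact: hom_zero|exact: hom_id].
  pose alpha : 'Hom(W, R) := dpair (b' \o prN)%VF (dpair prP (u \o h \o prN)%VF).
  pose l1 : 'Hom(Q, W) := dpair (- c') 0.
  pose l2 : 'Hom(P, W) := dpair (f \o v)%VF (\1%VF + (u \o v)%VF).
  pose l3 : 'Hom(P, W) := dpair 0 (- \1%VF).
  pose beta : 'Hom(R, W) := dcopair l1 (dcopair l2 l3).
  have halpha : is_hom alpha.
    by do !apply: dpair_hom => //; do ?apply: hom_comp => //; apply: hom_comp.
  have hbeta : is_hom beta.
    apply: dcopair_hom; first by apply: dpair_hom; [apply: hom_opp|apply: hom_zero].
    apply: dcopair_hom; first by apply: dpair_hom; [apply: hom_comp|apply: hom_add; [apply: hom_id|apply: hom_comp]].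
    by apply: dpair_hom; [apply: hom_zero|apply: hom_opp; apply: hom_id].
  have be w : beta (alpha w) = e w.
    case: w => n m; have pN : prN (n, m) = n.
      by rewrite /prN dcopairE /= id_lfunE zero_lfunE addr0.
    have pP' : prP (n, m) = m by rewrite /prP dcopairE /= id_lfunE zero_lfunE add0r.
    have aE : alpha (n, m) = (b' n, (m, u (h n))).
      by rewrite /alpha !dpairE pP' !comp_lfunE pN.
    have pE : p (n, m) = h n - v m by rewrite /p dcopairE opp_lfunE.
    have lE : beta (b' n, (m, u (h n))) =
        ((n - f (h n)) + f (v m), (m + u (v m)) - u (h n)) :> (N * P)%type.
      have l1E z : l1 z = (- c' z, 0) by rewrite /l1 dpairE opp_lfunE zero_lfunE.
      have l2E z : l2 z = (f (v z), z + u (v z)).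
        by rewrite /l2 dpairE add_lfunE !comp_lfunE id_lfunE.
      have l3E z : l3 z = (0, - z) by rewrite /l3 dpairE opp_lfunE zero_lfunE id_lfunE.
      rewrite /beta !dcopairE /= l1E l2E l3E cbE.
      by congr (_, _); rewrite /= ?addr0 ?add0r ?opprB.
    rewrite aE lE eE pE /i dpairE; congr (_, _); rewrite /= linearB opprB.
      by rewrite addrA addrAC.
    by rewrite addrA.
  apply: (contr_retract (i := (alpha \o j)%VF) (p := (q \o beta)%VF) (W := R)).
  - exact: hom_comp.
  - exact: hom_comp.
  - apply/lfunP => w; rewrite !comp_lfunE be eid; last first.
      by rewrite /j /sub_incl inclE subvsP.
    by rewrite -[q _]comp_lfunE qj.
  by apply: contr_dsum => //; apply: contr_dsum.
exists P, X; split=> // [d|d x].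
  have [g1 _] := dsum_gdim_rk N P; rewrite -g1.
  exact: (biprod_gdim hi hp hj hq pi qj full).
have [_ g2] := dsum_gdim_rk N P; rewrite -g2.
exact: (biprod_rk hi hp hj hq pi qj full).
Qed.

End Ranks.

(** * Adapted bases of locally one-dimensional modules *)

Section Adapted.
Variables (k : closedFieldType) (a : lieSuper k).
Hypothesis two_neq0 : (2%:R : k) != 0.
Hypothesis central : forall t x, t \in gr a false -> br a t x = 0.
Implicit Types M N P W L : smod a.

(** N = k z + U + x U: the vector z represents the homology of x, and x maps the span of U
    isomorphically onto its image.  The dimension forces z, U and x U to be linearly independent. *)
Definition adapted N (x : a) (e : bool) (z : N) (U : bool -> seq N) : Prop :=
  [/\ z \in gr N e /\ act N x z = 0, forall d u, u \in U d -> u \in gr N d,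
      (<[z]> + (<<U false>> + <<U true>>) + act N x @: (<<U false>> + <<U true>>))%VS = fullv
    & \dim {:N} = (2 * (size (U false) + size (U true))).+1].

Lemma adapted_ranks N x e (z : N) U : wz N -> x \in gr a true -> adapted x e z U ->
  [/\ forall d, rk N d x = size (U d),
      gdim N e = (size (U false) + size (U true)).+1
    & gdim N (~~ e) = (size (U false) + size (U true))%N].
Proof.
move=> zN hx [[ze xz] hU full dN]; set s := (_ + _)%N in dN *.
have xx v : act N x (act N x v) = 0 by apply: wz_sq.
have sU d : (<<U d>> <= gr N d)%VS by apply/span_subvP => u; apply: hU.
have xU d : (act N x @: <<U d>> <= gr N (~~ d))%VS.
  by apply: subv_trans (limgS _ (sU d)) (act_odd_img _ _ hx).
(* degree d of the spanning set: z if e = d, the part of U in degree d, and x applied to the other part *)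
have grd d : (gr N d <= (if d == e then <[z]> else 0) + (<<U d>> + act N x @: <<U (~~ d)>>))%VS.
  apply/subvP => v vd; have : v \in fullv by apply: memvf.
  rewrite -full => /memv_addP[_ /memv_addP[_ /vlineP[c ->] [_ /memv_addP[u0 hu0 [u1 hu1 ->]] ->]]].
  case=> _ /memv_imgP[_ /memv_addP[w0 hw0 [w1 hw1 ->]] ->] vE.
  rewrite -(prj_id vd) vE !linearD linearZ /= (prj_gr _ ze).
  rewrite (prj_gr _ (subvP (sU _) _ hu0)) (prj_gr _ (subvP (sU _) _ hu1)).
  rewrite (prj_gr _ (subvP (xU _) _ (memv_img _ hw0))) (prj_gr _ (subvP (xU _) _ (memv_img _ hw1))).
  rewrite -addrA; apply: memv_add.
    by clear vd vE; case: d; case: (e); rewrite /= ?scaler0 ?mem0v // memvZ ?memv_line.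
  by clear vd vE; case: d; rewrite /= ?addr0 ?add0r memv_add // memv_img.
have gd d : (gdim N d <= (d == e) + (size (U d) + rk N (~~ d) x))%N.
  rewrite /gdim /rk; apply: leq_trans (dimvS (grd d)) _.
  set A := (if _ then _ else _); set B := <<U d>>%VS; set C := (_ @: _)%VS.
  have dA : (\dim A <= (d == e))%N by rewrite /A; case: eqP => _; rewrite ?dimv0 // dim_vline leq_b1.
  have dB : (\dim B <= size (U d))%N by apply: dim_span.
  have dC : (\dim C <= \dim (act N x @: gr N (~~ d)))%N by apply/dimvS/limgS.
  have := dimv_sum_cap A (B + C)%VS; have := dimv_sum_cap B C.
  by move: (dimv _) dA dB dC => *; lia.
have rkU d : (rk N d x <= size (U d))%N.
  rewrite /rk; have s1 : (act N x @: gr N d <= act N x @: <<U d>>)%VS.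
    apply/subvP => _ /memv_imgP[v vd ->]; have := subvP (grd d) v vd.
    case/memv_addP => v0 hv0 [_ /memv_addP[u uU [_ /memv_imgP[w wU ->] ->]] ->].
    rewrite !linearD /= xx addr0 (_ : act N x v0 = 0) ?add0r ?memv_img //.
    by move: hv0; case: eqP => _; [case/vlineP => c ->; rewrite linearZ /= xz scaler0
                                  |rewrite memv0 => /eqP->; rewrite linear0].
  apply: leq_trans (dimvS s1) _; apply: leq_trans (dim_limg_le _ _) _; exact: dim_span.
have tot : (s <= rk N false x + rk N true x)%N.
  have : (\dim {:N} <= 1 + s + (rk N false x + rk N true x))%N.
    rewrite -full; set A := <[z]>%VS; set B := (<<U false>> + <<U true>>)%VS; set C := (act N x @: B)%VS.
    have dA : (\dim A <= 1)%N by rewrite dim_vline leq_b1.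
    have dB : (\dim B <= s)%N.
      have := dim_span (U false); have := dim_span (U true).
      by rewrite /B; have := dimv_sum_cap <<U false>> <<U true>>; rewrite /s; lia.
    have dC : (\dim C <= rk N false x + rk N true x)%N.
      rewrite /C limgD; set C0 := (_ @: _)%VS; set C1 := (_ @: _)%VS.
      have d0 : (\dim C0 <= rk N false x)%N by apply/dimvS/limgS.
      have d1 : (\dim C1 <= rk N true x)%N by apply/dimvS/limgS.
      by have := dimv_sum_cap C0 C1; lia.
    have := dimv_sum_cap (A + B)%VS C; have := dimv_sum_cap A B; lia.
  by rewrite dN; lia.
have rkE d : rk N d x = size (U d).
  by have := rkU false; have := rkU true; rewrite /s in tot; case: d; lia.
have := gdim_add N; have := gd false; have := gd true; rewrite !rkE /= dN.
by rewrite /s => h0 h1 h2; split=> //; move: h0 h1 h2; case: (e) => /=; rewrite ?eqxx ?add0n; lia.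
Qed.

Lemma lod_gdim N x : lod N -> x \in gr a true -> x != 0 ->
  exists e, gdim N e = (rk N false x + rk N true x).+1 /\
    gdim N (~~ e) = (rk N false x + rk N true x)%N.
Proof.
move=> [zN hN] hx x0; have := hN x hx x0; rewrite gdim_add.
have := rk_le two_neq0 false zN hx; have := rk_le two_neq0 true zN hx; rewrite /= => h1 h0 h.
have [e|e] := eqVneq (gdim N true) (rk N false x + rk N true x)%N; [exists false|exists true]; split=> /=; lia.
Qed.

Lemma lod_adapted N x : lod N -> x \in gr a true -> x != 0 ->
  exists e z U, adapted (N := N) x e z U.
Proof.
move=> lN hx x0; have [zN hN] := lN; have [e [ge gne]] := lod_gdim lN hx x0.
pose K := lker (act N x); pose C d := (gr N d :\: K)%VS.
have xx v : act N x (act N x v) = 0 by apply: wz_sq.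
have dC d : \dim (C d) = rk N d x.
  have := dimv_cap_compl (gr N d) K; have := limg_ker_dim (act N x) (gr N d).
  by rewrite -/K -/(rk N d x) -/(C d); lia.
have sK d : (act N x @: gr N (~~ d) <= K :&: gr N d)%VS.
  rewrite subv_cap; apply/andP; split.
    by apply/subvP => _ /memv_imgP[v _ ->]; rewrite memv_ker xx.
  by have := act_odd_img N (~~ d) hx; rewrite negbK; apply.
have dK d : (\dim (K :&: gr N d) + rk N d x)%N = gdim N d.
  by rewrite capvC /rk limg_ker_dim.
have imC d : (act N x @: C d = act N x @: gr N d)%VS by rewrite limg_ker_compl.
(* the homology of x sits in degree e only; the image of x is the whole kernel in the other degree *)
pose D := ((K :&: gr N e) :\: (act N x @: gr N (~~ e)))%VS.
have dD : \dim D = 1%N.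
  have := dimv_cap_compl (K :&: gr N e)%VS (act N x @: gr N (~~ e))%VS.
  rewrite (capv_idPr (sK e)) -/(rk N (~~ e) x) -/D; have := dK e; rewrite ge.
  by case: (e) => /=; clear; lia.
have D0 : D != 0%VS by rewrite -dimv_eq0 dD.
pose z := vpick D; have z0 : z != 0 by rewrite vpick0.
have zD : z \in D := memv_pick D.
have Dz : D = <[z]>%VS by apply/eqP; rewrite eq_sym eqEdim -memvE zD dD dim_vline z0.
have /memv_capP[zK ze] : z \in (K :&: gr N e)%VS by apply: subvP zD; apply: diffvSl.
have eqK : (K :&: gr N (~~ e) = act N x @: gr N e)%VS.
  apply/eqP; rewrite eq_sym eqEdim; have := sK (~~ e); rewrite negbK => -> /=.
  rewrite -/(rk N e x); have := dK (~~ e); rewrite gne.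
  by case: (e) => /=; lia.
exists e, z, (fun d => vbasis (C d) : seq N); split.
- by split=> //; apply/eqP; rewrite -memv_ker.
- by move=> d u /vbasis_mem; apply: (subvP (diffvSl _ _)).
- rewrite !(span_basis (vbasisP _)); apply/eqP; rewrite eqEsubv subvf /= -(gr_add N).
  set S := (_ + _ @: _)%VS.
  have sx d : (act N x @: gr N d <= S)%VS.
    rewrite -imC /S limgD; apply: subv_trans (addvSr _ _).
    by case: d; [exact: addvSr|exact: addvSl].
  have sC d : (C d <= S)%VS.
    apply: subv_trans (addvSl _ _); apply: subv_trans (addvSr _ _).
    by case: d; [exact: addvSr|exact: addvSl].
  have sz : (<[z]> <= S)%VS by apply: subv_trans (addvSl _ _); apply: addvSl.
  have sKe d : (K :&: gr N d <= S)%VS.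
    have [->|/negPf de] := eqVneq d e.
      rewrite -(addv_diff_cap (K :&: gr N e)%VS (act N x @: gr N (~~ e))) -/D Dz.
      by rewrite subv_add sz (subv_trans (capvSr _ _)).
    have -> : d = ~~ e by case: d e de {ge gne D dD D0 z z0 zD Dz zK ze eqK S sx sC sz} => [] [].
    by rewrite eqK.
  have sg d : (gr N d <= S)%VS.
    by rewrite -(addv_diff_cap (gr N d) K) subv_add sC capvC sKe.
  by rewrite subv_add !sg.
by rewrite !size_tuple !dC; apply: hN.
Qed.

End Adapted.

(** * Annihilators *)

Section Annihilator.
Variables (k : fieldType) (N : vectType k).

Lemma dim_functionals : \dim {:'Hom(N, k^o)} = \dim {:N}.
Proof. by rewrite !dimvf; apply: muln1. Qed.

(** As a kernel, so that dimensions follow from the rank formula. *)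
Definition ann (A : {vspace N}) : {vspace 'Hom(N, k^o)} :=
  lker (linfun (fun f : 'Hom(N, k^o) => (f \o incl A)%VF)).

Lemma annP (A : {vspace N}) (f : 'Hom(N, k^o)) : reflect (forall v, v \in A -> f v = 0) (f \in ann A).
Proof.
rewrite /ann memv_ker linfun_lin => [|c u v]; last by rewrite comp_lfunDl comp_lfunZl.
apply: (iffP eqP) => [/lfunP e v vA|h].
  by have := e (vsproj A v); rewrite comp_lfunE inclE vsprojK // zero_lfunE.
by apply/lfunP => u; rewrite comp_lfunE inclE zero_lfunE h // subvsP.
Qed.
End Annihilator.

Lemma dim_ann (k : fieldType) (N : vectType k) (A : {vspace N}) :
  (\dim (ann A) + \dim A)%N = \dim {:N}.
Proof.
set L := linfun (fun f : 'Hom(N, k^o) => (f \o incl A)%VF).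
have := limg_ker_dim L fullv; rewrite capfv dim_functionals -/(ann A) => <-.
congr (_ + _)%N; rewrite -dim_subvs -dim_functionals; congr (\dim _).
apply/eqP; rewrite eq_sym eqEsubv subvf; apply/subvP => f _.
have LE h : L h = (h \o incl A)%VF.
  by rewrite /L linfun_lin // => c u v; rewrite comp_lfunDl comp_lfunZl.
pose r : 'Hom(N, subvs_of A) := linfun (vsproj A).
have -> : f = L (f \o r)%VF; last by rewrite memv_img ?memvf.
apply/lfunP => u; rewrite LE !comp_lfunE inclE; congr (f _).
by rewrite /r linfun_lin ?vsvalK // => c x y; rewrite linearP.
Qed.

(** * The invariant in Z x Z_2 *)

Section Invariants.
Variables (k : closedFieldType) (a : lieSuper k).
Hypothesis two_neq0 : (2%:R : k) != 0.
Hypothesis central : forall t x, t \in gr a false -> br a t x = 0.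
Implicit Types M N P W L : smod a.

(** The parity e of the homology of x, and the number of steps by which N differs from a trivial
    module: each application of Omega changes the difference of the ranks by one and flips e. *)
Definition lod_inv (x : a) N (n : int) (e : bool) : Prop :=
  [/\ gdim N e = (rk N false x + rk N true x).+1,
      gdim N (~~ e) = (rk N false x + rk N true x)%N
    & n = (-1) ^+ e * ((rk N true x)%:Z - (rk N false x)%:Z)].

Lemma lod_inv_exists N x : lod N -> x \in gr a true -> x != 0 -> exists n e, lod_inv x N n e.
Proof.
move=> lN hx x0; have [e [h1 h2]] := lod_gdim two_neq0 lN hx x0.
by exists ((-1) ^+ e * ((rk N true x)%:Z - (rk N false x)%:Z)), e.
Qed.

Lemma lod_inv_uniq N x n e n' e' : lod_inv x N n e -> lod_inv x N n' e' -> n = n' /\ e = e'.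
Proof.
move=> [h1 h2 ->] [h1' h2' ->]; suff -> : e = e' by [].
by move: h1 h2 h1' h2'; clear; case: e e' => [] [] //=; lia.
Qed.

(** U (x) N' together with z (x) U' is an adapted basis, because U + x U is free over the exterior
    algebra of x and stays so after tensoring. *)
Lemma adapted_tensor N N' x e e' (z : N) (z' : N') U U' : wz N -> wz N' -> x \in gr a true ->
  adapted x e z U -> adapted x e' z' U' ->
  exists U'', adapted (N := tensor N N') x (e (+) e') (tens z z') U'' /\
    forall d, size (U'' d) = (size (U false) * gdim N' d + size (U true) * gdim N' (~~ d) +
       size (U' (e (+) d)))%N.
Proof.
move=> zN zN' hx ad ad'.
have [_ ge gne] := adapted_ranks two_neq0 zN hx ad.
have [_ ge' gne'] := adapted_ranks two_neq0 zN' hx ad'.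
have [[ze xz] hU full dN] := ad; have [[ze' xz'] hU' full' dN'] := ad'.
pose B d : seq N' := vbasis (gr N' d).
have sB d : size (B d) = gdim N' d by rewrite size_tuple.
pose U'' d : seq (tensor N N') := [seq tens u n | u <- U false, n <- B d] ++
  ([seq tens u n | u <- U true, n <- B (~~ d)] ++ [seq tens z u | u <- U' (e (+) d)]).
have sU'' d : size (U'' d) = (size (U false) * gdim N' d + size (U true) * gdim N' (~~ d) +
       size (U' (e (+) d)))%N.
  by rewrite /U'' !size_cat !size_allpairs size_map !sB addnA.
exists U''; split=> //.
have act_tens u n : act (tensor N N') x (tens u n) =
    tens (act N x u) n + tens (sgn N true u) (act N' x n) := tens_act_gr_tens u n hx.
split.
- split; first exact: tens_gr.
  by rewrite act_tens xz xz' tens0l tens0r addr0.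
- move=> d u; rewrite !mem_cat => /or3P[/allpairsP[[v w] [/= vU wB ->]]
    |/allpairsP[[v w] [/= vU wB ->]]|/mapP[v vU ->]].
  + rewrite -[d]addFb; apply: tens_gr; [exact: hU|exact: vbasis_mem].
  + by rewrite -[d]negbK -addTb; apply: tens_gr; [exact: hU|exact: vbasis_mem].
  + have -> : d = e (+) (e (+) d) by rewrite addbA addbb addFb.
    by apply: tens_gr => //; apply: hU'.
- set S := (_ + _)%VS; apply/eqP; rewrite eqEsubv subvf /=.
  have S1 d : (<<U'' d>> <= S)%VS.
    apply: subv_trans (addvSl _ _); apply: subv_trans (addvSr _ _).
    by case: d; [exact: addvSr|exact: addvSl].
  have S2 d : (act (tensor N N') x @: <<U'' d>> <= S)%VS.
    rewrite /S limgD; apply: subv_trans (addvSr _ _).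
    by case: d; [exact: addvSr|exact: addvSl].
  have uB d u j n : u \in U d -> n \in gr N' j -> tens u n \in <<U'' (d (+) j)>>%VS.
    move=> uU hn; rewrite (coord_vbasis hn) tens_sumr memv_suml // => i _.
    rewrite tensZr memvZ // memv_span // !mem_cat.
    have iB : (vbasis (gr N' j))`_i \in B j by rewrite mem_nth // size_tuple.
    case: d uU => uU; rewrite ?addTb ?addFb ?negbK.
      by rewrite [X in _ || (X || _)](_ : _ = true) ?orbT //; apply/allpairsP;
        exists (u, (vbasis (gr N' j))`_i); rewrite ?negbK.
    by apply/orP; left; apply/allpairsP; exists (u, (vbasis (gr N' j))`_i).
  have zU d u : u \in U' d -> tens z u \in <<U'' (e (+) d)>>%VS.
    move=> uU; rewrite memv_span // !mem_cat; apply/orP; right; apply/orP; right.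
    by apply: map_f; rewrite addbA addbb addFb.
  pose F n : 'Hom(N, tensor N N') := linfun (fun m => tens m n).
  have FE n m : F n m = tens m n by rewrite /F linfun_lin // => c u v; apply: tens_linear_l.
  pose G : 'Hom(N', tensor N N') := linfun (tens z).
  have GE n : G n = tens z n by rewrite /G linfun_lin // => c u v; apply: tens_linear_r.
  have uS d u n : u \in U d -> tens u n \in S.
    move=> uU; rewrite -(prj_add n) tensDr memvD //.
      by apply: (subvP (S1 (d (+) false))); apply: uB => //; apply: memv_prj.
    by apply: (subvP (S1 (d (+) true))); apply: uB => //; apply: memv_prj.
  have xuS d u n : u \in U d -> act (tensor N N') x (tens u n) \in S.
    move=> uU; rewrite -(prj_add n) tensDr linearD /= memvD //.
      by apply: (subvP (S2 (d (+) false))); rewrite memv_img // uB ?memv_prj.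
    by apply: (subvP (S2 (d (+) true))); rewrite memv_img // uB ?memv_prj.
  have xuS' d u n : u \in U d -> tens (act N x u) n \in S.
    move=> uU; have -> : tens (act N x u) n =
        act (tensor N N') x (tens u n) - tens (sgn N true u) (act N' x n).
      by rewrite act_tens addrK.
    by rewrite memvB ?(xuS d) // (sgn_gr _ (hU d u uU)) tensZl memvZ // (uS d).
  have zS n : tens z n \in S.
    rewrite -GE; have h : n \in (<[z']> + (<<U' false>> + <<U' true>>) +
        act N' x @: (<<U' false>> + <<U' true>>))%VS by rewrite full' memvf.
    apply: (subvP _ _ (memv_img G h)).
    rewrite !limgD -!limg_comp limg_line !subv_add; apply/andP; split; first (apply/andP; split).
    + rewrite GE -memvE (subvP (addvSl _ _)) // (subvP (addvSl _ _)) //; exact: memv_line.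
    + rewrite !limg_span; apply/andP; split; apply/span_subvP => _ /mapP[u uU ->]; rewrite GE.
        by apply: (subvP (S1 _)); apply: zU uU.
      by apply: (subvP (S1 _)); apply: zU uU.
    + have h' d u : u \in U' d -> tens z (act N' x u) \in S.
        move=> uU; have := act_tens z u; rewrite xz tens0l add0r (sgn_gr _ ze) tensZl => E.
        have -> : tens z (act N' x u) = (-1) ^+ (true && e) *: act (tensor N N') x (tens z u).
          by rewrite E scalerA -expr2 sqrr_sign scale1r.
        rewrite memvZ //; apply: (subvP (S2 (e (+) d))).
        by rewrite memv_img // (zU _ _ uU).
      rewrite !limg_span; apply/andP; split; apply/span_subvP => _ /mapP[u uU ->].
        by rewrite comp_lfunE GE (h' false).
      by rewrite comp_lfunE GE (h' true).
  apply/subvP => A _; rewrite (tens_sumE A); apply: memv_suml => i _; apply: memv_suml => j _.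
  rewrite memvZ //; set m := _`_i; set n := _`_j; rewrite -FE.
  have h : m \in (<[z]> + (<<U false>> + <<U true>>) +
      act N x @: (<<U false>> + <<U true>>))%VS by rewrite full memvf.
  apply: (subvP _ _ (memv_img (F n) h)).
  rewrite !limgD -!limg_comp limg_line !subv_add; apply/andP; split; first (apply/andP; split).
  + by rewrite FE -memvE.
  + rewrite !limg_span; apply/andP; split; apply/span_subvP => _ /mapP[u uU ->]; rewrite FE.
      exact: uS uU.
    exact: uS uU.
  rewrite !limg_span; apply/andP; split; apply/span_subvP => _ /mapP[u uU ->].
    by rewrite comp_lfunE FE (xuS' false).
  by rewrite comp_lfunE FE (xuS' true).
rewrite !sU''; have -> : \dim {:tensor N N'} = (\dim {:N} * \dim {:N'})%N.
  by rewrite dimvf dim_matrix.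
rewrite dN dN'; move: gne ge gne' ge'.
by case: e {ze ad U'' sU''} => /=; case: e' {ze' ad'} => /= _ _ -> ->; lia.
Qed.

Lemma lod_tensor N N' : lod N -> lod N' -> lod (tensor N N').
Proof.
move=> lN lN'; have [zN _] := lN; have [zN' _] := lN'.
split=> [|x hx x0]; first exact: wz_tensor.
have [e [z [U ad]]] := lod_adapted two_neq0 lN hx x0.
have [e' [z' [U' ad']]] := lod_adapted two_neq0 lN' hx x0.
have [U'' [ad'' _]] := adapted_tensor zN zN' hx ad ad'.
have [rkE _ _] := adapted_ranks two_neq0 (wz_tensor zN zN') hx ad''.
by have [_ _ _ ->] := ad''; rewrite !rkE.
Qed.

Lemma lod_inv_adapted N x e (z : N) U : wz N -> x \in gr a true -> adapted x e z U ->
  lod_inv x N ((-1) ^+ e * ((size (U true))%:Z - (size (U false))%:Z)) e.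
Proof.
move=> zN hx ad; have [rkE ge gne] := adapted_ranks two_neq0 zN hx ad.
by split; rewrite ?rkE.
Qed.

Lemma lod_inv_tensor N N' x n n' e e' : lod N -> lod N' -> x \in gr a true -> x != 0 ->
  lod_inv x N n e -> lod_inv x N' n' e' -> lod_inv x (tensor N N') (n + n') (e (+) e').
Proof.
move=> lN lN' hx x0 iN iN'; have [zN _] := lN; have [zN' _] := lN'.
have [f [z [U ad]]] := lod_adapted two_neq0 lN hx x0.
have [f' [z' [U' ad']]] := lod_adapted two_neq0 lN' hx x0.
have [U'' [ad'' sU]] := adapted_tensor zN zN' hx ad ad'.
have [-> ->] := lod_inv_uniq iN (lod_inv_adapted zN hx ad).
have [-> ->] := lod_inv_uniq iN' (lod_inv_adapted zN' hx ad').
have := lod_inv_adapted (wz_tensor zN zN') hx ad''; rewrite !sU.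
suff -> : (-1) ^+ (f (+) f') * ((size (U false) * gdim N' true + size (U true) * gdim N' (~~ true)
     + size (U' (f (+) true)))%N%:Z - (size (U false) * gdim N' false
     + size (U true) * gdim N' (~~ false) + size (U' (f (+) false)))%N%:Z) =
   (-1) ^+ f * ((size (U true))%:Z - (size (U false))%:Z) +
   (-1) ^+ f' * ((size (U' true))%:Z - (size (U' false))%:Z) :> int by [].
have [_ ge gne] := adapted_ranks two_neq0 zN' hx ad'.
clear ad ad'' sU; case: f; case: f' {ad'} ge gne => /= -> ->; rewrite !(PoszD, PoszM, intS); ring.
Qed.

Lemma gdim_dual N d : gdim (dual N) d = gdim N d.
Proof.
rewrite /gdim; have -> : gr (dual N) d = ann (gr N (~~ d)).
  by apply/vspaceP => f; apply/idP/idP => [/dual_grP h|/annP h]; [apply/annP|apply/dual_grP].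
by have := dim_ann (gr N (~~ d)); have := gdim_add N; rewrite /gdim; case: d => /=; lia.
Qed.

Lemma wz_dual N : wz N -> wz (dual N).
Proof.
move=> zN t f ht; apply/lfunP => v.
by rewrite [LHS](dual_act_gr_fun _ _ ht) zN // !linear0 ?oppr0 zero_lfunE.
Qed.

(** The kernel of x on the dual is the annihilator of the image of x; degree d of the dual consists
    of the functionals on degree d of N. *)
Lemma rk_dual N d x : wz N -> x \in gr a true -> rk (dual N) d x = rk N (~~ d) x.
Proof.
move=> zN hx; have := limg_ker_dim (act (dual N) x) (gr (dual N) d).
rewrite -/(rk (dual N) d x) -/(gdim (dual N) d) gdim_dual.
have -> : (gr (dual N) d :&: lker (act (dual N) x))%VS =
    ann (gr N (~~ d) + act N x @: gr N (~~ d)).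
  apply/vspaceP => f; rewrite memv_cap memv_ker; apply/andP/annP.
    case=> /dual_grP fd /eqP xf _ /memv_addP[v vd [_ /memv_imgP[w wd ->] ->]].
    rewrite linearD /= fd // add0r.
    have /lfunP/(_ w) := xf; rewrite zero_lfunE [LHS](dual_act_gr_fun _ _ hx).
    have xw : act N x w \in gr N d by rewrite -[d]negbK -addTb act_gr.
    rewrite (sgn_gr _ xw) linearZ /= => /eqP; rewrite oppr_eq0 scaler_eq0.
    by rewrite expf_eq0 oppr_eq0 oner_eq0 andbF /= => /eqP.
  move=> h; have fd v : v \in gr N (~~ d) -> f v = 0.
    by move=> vd; apply: h; apply: (subvP (addvSl _ _)).
  split; first by apply/dual_grP.
  apply/eqP/lfunP => v; rewrite zero_lfunE [LHS](dual_act_gr_fun _ _ hx).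
  suff e i : f (sgn N true (act N x (prj N i v))) = 0.
    by rewrite -(prj_add v) !linearD /= !(e, oppr0, addr0).
  have xi : act N x (prj N i v) \in gr N (~~ i) by rewrite -addTb act_gr ?memv_prj.
  rewrite (sgn_gr _ xi) linearZ /=; have [E|E] := eqVneq i d.
    by rewrite fd ?scaler0 // -E.
  rewrite h ?scaler0 // (subvP (addvSr _ _)) // memv_img //.
  by have -> : ~~ d = i by [case: (i) (d) E => [] []|]; apply: memv_prj.
have := dim_ann (gr N (~~ d) + act N x @: gr N (~~ d))%VS.
rewrite dimv_disjoint_sum -/(gdim N _) -/(rk N _ _).
  by have := gdim_add N; case: d => /=; lia.
apply/eqP; rewrite -subv0 -(gr_capb N (~~ d)) capvS // act_odd_img //.
Qed.

Lemma lod_dual N : lod N -> lod (dual N).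
Proof.
move=> [zN hN]; split=> [|x hx x0]; first exact: wz_dual.
rewrite !rk_dual // [in RHS]addnC -hN //.
by rewrite gdim_add !gdim_dual -gdim_add.
Qed.

Lemma lod_inv_dual N x n e : wz N -> x \in gr a true -> lod_inv x N n e ->
  lod_inv x (dual N) (- n) e.
Proof.
move=> zN hx [h1 h2 ->]; split; rewrite ?gdim_dual !rk_dual //=; last by rewrite -mulrN opprB.
  by rewrite addnC.
by rewrite addnC.
Qed.

Hypothesis rank_ge2 : (2 <= \dim (gr a true))%N.

Lemma independent_partner x : x != 0 -> exists2 w, w \in gr a true & free [:: x; w].
Proof.
move=> x0; have [sub|/subvPn[w hw nw]] := boolP (gr a true <= <[x]>)%VS.
  by have := dimvS sub; have := rank_ge2; rewrite dim_vline x0; clear; lia.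
exists w => //; rewrite (perm_free (Y := [:: w; x])); last exact: (permEl (perm_catC [:: x] [:: w])).
by rewrite free_cons seq1_free span_seq1 nw x0.
Qed.

(** Adding contractible modules of weight zero changes both ranks by the same amount. *)
Lemma lod_inv_stable M N x n e : lod M -> wz N -> stable_iso M N -> x \in gr a true -> x != 0 ->
  lod_inv x M n e -> lod N /\ lod_inv x N n e.
Proof.
move=> [zM hM] zN MN hx x0 [h1 h2 ->].
have [P [X [[zP cP] [zX cX] eg er]]] := stable_iso_wz central zM zN MN.
have bal Q y : wz Q -> contractible Q -> y \in gr a true -> y != 0 ->
    rk Q true y = rk Q false y /\ forall d, gdim Q d = (2 * rk Q false y)%N.
  move=> zQ cQ hy y0; have [w hw fw] := independent_partner y0.
  have e1 : rk Q true y = rk Q false y := contractible_rk two_neq0 true zQ cQ hy hw fw.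
  split=> // d; rewrite (contractible_gdim two_neq0 d zQ cQ hy y0).
  by case: d => /=; rewrite e1; lia.
split.
  split=> // y hy y0; have := hM y hy y0.
  have [p1 p2] := bal P y zP cP hy y0; have [x1 x2] := bal X y zX cX hy y0.
  have := eg false; have := eg true; have := er false y; have := er true y.
  by rewrite !gdim_add !p2 !x2 p1 x1; lia.
have [p1 p2] := bal P x zP cP hx x0; have [x1 x2] := bal X x zX cX hx x0.
have g1 := eg false; have g2 := eg true; have r1 := er false x; have r2 := er true x.
rewrite !p2 !x2 p1 x1 in g1 g2 r1 r2.
split.
- by case: e h1 h2 => /=; lia.
- by case: e h1 h2 => /=; lia.
by congr (_ * _); lia.
Qed.
End Invariants.

(** * Splitting off a trivial summand *)

Section FreeContraction.
Variables (k : fieldType) (T V : vectType k) (E : 'Hom(V, 'End(T))).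
Hypothesis anE : forall X : seq V, anticomm [seq E x | x <- X].
Variable y : V -> k.

(** On L + x L, with L free for the remaining operators and contracted by H, the operator
    a + x b |-> H a + y(x) b - x H b is a contraction. *)
Lemma free_contraction (X : seq V) (L0 : {vspace T}) (es := [seq E x | x <- X]) :
  (L0 :&: lker (prodop es) = 0)%VS ->
  exists H : 'End(T), (H @: freeext es L0 <= freeext es L0)%VS /\
    forall x v, x \in X -> v \in freeext es L0 -> E x (H v) + H (E x v) = y x *: v.
Proof.
rewrite {}/es; elim: X => [|x X IH] inj.
  by exists 0; split=> //; apply/subvP => _ /memv_imgP[v _ ->]; rewrite zero_lfunE mem0v.
set es := [seq E x | x <- X] in IH *; set e := E x.
have ac := anE (x :: X); have ac' := anE X; rewrite -/es in ac'.
have inj' : (L0 :&: lker (prodop es) = 0)%VS.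
  apply/eqP; rewrite -subv0 -inj capvS //; apply/subvP => v.
  by rewrite !memv_ker prodop_cons => /eqP->; rewrite linear0.
have [H [HL HE]] := IH inj'.
have [d1 _] := freeext_free ac inj; have [d2 _] := freeext_free ac' inj'.
rewrite /= -/es -/e size_map expnS in d1; rewrite size_map in d2.
set L := freeext es L0 in d1 d2 HL HE *.
have stL : stable es L := stable_freeext _ ac'.
have [k0 c0] : (L :&: lker e = 0)%VS /\ (L :&: e @: L = 0)%VS.
  have := dimv_sum_cap L (e @: L)%VS; have := limg_ker_dim e L; rewrite d1 -mulnA -d2.
  by move=> h1 h2; split; apply/eqP; rewrite -dimv_eq0; apply/eqP; lia.
have [ee an] := ac.
have e2 v : e (e v) = 0 by apply: ee; rewrite mem_head.
have eX x' v : x' \in X -> E x' (e v) = - e (E x' v).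
  by move=> hx; apply: an; rewrite ?mem_head // inE map_f ?orbT.
pose f := (e \o incl L)%VF.
have f0 : lker f == 0%VS.
  rewrite -subv0; apply/subvP => u; rewrite memv_ker comp_lfunE inclE => fu.
  have : vsval u \in (L :&: lker e)%VS by rewrite memv_cap subvsP memv_ker.
  by rewrite k0 !memv0 => /eqP u0; apply/eqP/subvs_inj; rewrite u0 linear0.
pose p := daddv_pi L (e @: L); pose B := (incl L \o f^-1 \o (\1 - p))%VF.
have pE u v : u \in L -> v \in L -> p (u + e v) = u.
  move=> uL vL; rewrite linearD /= daddv_pi_id //.
  have evL : e v \in (e @: L)%VS by apply: memv_img.
  have := daddv_pi_add c0 (subvP (addvSr L _) _ evL).
  rewrite (daddv_pi_id _ evL); last by rewrite capvC.
  by move/(canRL (addrK _)); rewrite subrr => ->; rewrite addr0.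
have BE u v : u \in L -> v \in L -> B (u + e v) = v.
  move=> uL vL; rewrite !comp_lfunE inclE add_lfunE opp_lfunE id_lfunE pE // addrC addKr.
  have := lker0_lfunK f0 (vsproj L v); rewrite comp_lfunE inclE vsprojK // => ->.
  by rewrite vsprojK.
pose K := (H \o p)%VF + y x *: B - (e \o H \o B)%VF.
have KE u v : u \in L -> v \in L -> K (u + e v) = H u + y x *: v - e (H v).
  have -> w : K w = H (p w) + y x *: B w - e (H (B w)).
    by rewrite !add_lfunE opp_lfunE scale_lfunE !comp_lfunE.
  by move=> uL vL; rewrite pE ?BE.
have HLv v : v \in L -> H v \in L by move=> vL; apply: (subvP HL); apply: memv_img.
exists K; split.
  apply/subvP => _ /memv_imgP[_ /memv_addP[u uL [_ /memv_imgP[v vL ->] ->]] ->].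
  rewrite KE // -/L -linearN; apply: memv_add; last by rewrite memv_img // memvN HLv.
  by rewrite memvD ?HLv // memvZ.
move=> x' _ hx /memv_addP[u uL [_ /memv_imgP[v vL ->] ->]]; rewrite KE //.
have z0 : 0 = e 0 by rewrite linear0.
move: hx; rewrite inE => /orP[/eqP->|hx].
  rewrite -/e !linearD linearN /= !e2 oppr0 !addr0 linearZ /=.
  have := KE 0 u (mem0v _) uL; rewrite add0r linear0 add0r => ->.
  rewrite linear0 addr0 [RHS]addrC [X in X + _ = _]addrC -addrA; congr (_ + _).
  by rewrite addrC subrK.
have xL w : w \in L -> E x' w \in L.
  by move=> wL; apply: (stableP stL) => //; apply: map_f.
rewrite !linearD linearN /= !eX // linearZ /= opprK.
have -> : K (E x' u) + K (- e (E x' v)) = K (E x' u + e (- E x' v)).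
  by rewrite [e (- _)]linearN [RHS]linearD.
rewrite KE ?memvN ?xL // [H (- _)]linearN [e (- _)]linearN opprK scalerN.
have -> : E x' (H u) + y x *: E x' v + e (E x' (H v)) +
    (H (E x' u) - y x *: E x' v + e (H (E x' v))) =
    (E x' (H u) + H (E x' u)) + e (E x' (H v) + H (E x' v)).
  by rewrite linearD /= [LHS]addrACA [X in X + _ = _]addrACA subrr addr0.
by rewrite !HE // linearZ.
Qed.
End FreeContraction.

Section Splitting.
Variables (k : closedFieldType) (a : lieSuper k).
Hypothesis two_neq0 : (2%:R : k) != 0.
Hypothesis central : forall t x, t \in gr a false -> br a t x = 0.
Hypothesis rank_ge2 : (2 <= \dim (gr a true))%N.
Implicit Types M N P : smod a.

Lemma smod_iso_sym M N : smod_iso M N -> smod_iso N M.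
Proof.
by move=> [f [hf k0 i1]]; have [h [hh e1 e2]] := iso_inverse hf k0 i1;
  apply: (iso_from_inverse hh e2 e1).
Qed.

Lemma gdim_triv d i : gdim (triv a d) i = (i == d).
Proof.
rewrite /gdim /= /triv_gr; case: eqP => _; last by rewrite dimv0.
by rewrite dimvf.
Qed.

Lemma triv_vector N d (z : N) : wz N -> z \in gr N d ->
  (forall x, x \in gr a true -> act N x z = 0) ->
  exists f : 'Hom(triv a d, N), is_hom f /\ forall c : triv a d, f c = (c : k) *: z.
Proof.
move=> zN zd xz; exists (linfun (fun c : triv a d => (c : k) *: z)).
have fE c : linfun (fun c : triv a d => (c : k) *: z) c = (c : k) *: z.
  by rewrite linfun_lin // => w u v; rewrite scalerDl scalerA.
split=> //; split=> [i v|x v].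
  rewrite fE /= /triv_gr; case: eqP => [->|_]; first by rewrite memvZ.
  by rewrite memv0 => /eqP->; rewrite scale0r mem0v.
rewrite !fE act_triv scale0r linearZ /= -(prj_add x) linearD add_lfunE /=.
by rewrite zN ?memv_prj // xz ?memv_prj // addr0 scaler0.
Qed.

(** Since the invariant vanishes, all ranks rho are equal to (dim N - 1) / 4, so [has_rank2] starts
    the induction of [has_rank_step].  For a basis of a_1 it says that the free part of N has
    codimension one; the complement is a line, on which a_1 acts by zero. *)
Lemma lod_split N x0 e : lod N -> x0 \in gr a true -> x0 != 0 -> lod_inv x0 N 0 e ->
  exists P : smod a, [/\ wz P, contractible P & smod_iso N (dsum (triv a e) P)].
Proof.
move=> lN hx0 x00 [h1 h2 h3]; have [zN hN] := lN.
pose V := subvs_of (gr a true).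
pose E : 'Hom(V, 'End(N)) := (act N \o incl (gr a true))%VF.
have EE v u : E v u = act N (vsval v) u by rewrite comp_lfunE inclE.
have Vodd (v : V) : vsval v \in gr a true by apply: subvsP.
have sqE x v : E x (E x v) = 0 by rewrite !EE wz_sq.
have oddE x : oddend (E x).
  by move=> i v vi; rewrite EE -addTb act_gr.
set p := rk N false x0 in h1 h2 h3.
have rk1 : rk N true x0 = p.
  move/esym/eqP: h3; rewrite mulf_eq0 expf_eq0 oppr_eq0 oner_eq0 andbF /= subr_eq0 => /eqP.
  by case.
have dN : \dim {:N} = (4 * p).+1 by rewrite (hN x0 hx0 x00) rk1 -/p; lia.
have rhoE i v : rho E i v = rk N i (vsval v).
  by rewrite /rho /rk; congr (\dim _); apply: eq_in_limg => u _; apply: EE.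
have v0 (v : V) : v != 0 -> vsval v != 0.
  by apply: contra => /eqP h; apply/eqP/subvs_inj; rewrite h linear0.
pose vx0 : V := vsproj (gr a true) x0.
have vx0E : vsval vx0 = x0 by apply: vsprojK.
have vx00 : vx0 != 0 by apply: contra x00 => /eqP h; rewrite -vx0E h linear0.
have rp i v : v != 0 -> rho E i v = p.
  move=> nv; have -> : rho E i v = rho E i vx0.
    apply: (@rho_const _ _ _ E (2 * p)%N) => // u u0.
    by have := hN _ (Vodd u) (v0 u u0); rewrite dN !rhoE; lia.
  by rewrite rhoE vx0E; case: (i).
have hr2 := has_rank2 sqE oddE rp dN.
have hr j : has_rank E j.+2.
  by elim: j => // j IH; apply: has_rank_step.
pose X := vbasis {:V}; have fX : free X := basis_free (vbasisP _).
pose r := \dim {:V}; have rE : r = \dim (gr a true) by rewrite /r dim_subvs.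
have hrr : has_rank E r by have := rank_ge2; rewrite -rE; case: (r) => [|[|n]].
have := hrr X fX (size_tuple _); set es := [seq E x | x <- X] => dim_es.
have ac : anticomm es by apply: fam_anticomm.
have oe : {in es, forall f, oddend f} by move=> _ /mapP[x _ ->].
have [L0 [N1 [[hL0 hN1] kL0 stN1 [cap0 sumf] [dL0 _]]]] := graded_ext_decomp ac oe.
set L := freeext es L0 in cap0 sumf.
have hL : homog L by apply: homog_freeext.
have [dL _] := freeext_free ac kL0; rewrite -/L dL0 size_map size_tuple -/r in dL.
have stL : stable es L by apply: stable_freeext.
have dN1 : \dim N1 = 1%N.
  have := dimv_disjoint_sum cap0; rewrite sumf dL -dim_es; lia.
have subm (U : {vspace N}) : homog U -> stable es U -> submod U.
  move=> hU stU; split=> // x u uU; rewrite -(prj_add x) linearD add_lfunE /= zN ?memv_prj // add0r.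
  have -> : act N (prj a true x) u = E (vsproj (gr a true) (prj a true x)) u.
    by rewrite EE vsprojK ?memv_prj.
  apply: (subvP (stable_span (X := X) stU _)); last exact: memv_img.
  by rewrite (span_basis (vbasisP _)) memvf.
have smL := subm L hL stL; have smN1 := subm N1 hN1 stN1.
pose P := sub_smod smL.
have zP : wz P by move=> t v ht; apply: subvs_inj; rewrite sub_actE zN // linear0.
have cP : contractible P.
  move=> y; have [H [HL HE]] := free_contraction (fam_anticomm sqE) (fun v : V => y (vsval v) : k) kL0.
  exists (restr L H); split=> [t v ht|x v hx]; first by rewrite !zP // linear0.
  apply: subvs_inj; rewrite linearD linearZ /= sub_actE !restrE // sub_actE.
  set u := vsval v; have uL : u \in L by apply: subvsP.
  have xX : vsproj (gr a true) x \in <<X>>%VS by rewrite (span_basis (vbasisP _)) memvf.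
  have xE w : act N x w = \sum_(i < r) coord X i (vsproj (gr a true) x) *: E X`_i w.
    rewrite -[x in LHS](vsprojK hx) -EE {1}(coord_span xX) linear_sum sum_lfunE.
    by apply: eq_bigr => i _; rewrite linearZ scale_lfunE.
  rewrite !xE linear_sum -big_split /=.
  have -> : y x = \sum_(i < r) coord X i (vsproj (gr a true) x) * y (vsval X`_i).
    rewrite -[x in LHS](vsprojK hx) {1}(coord_span xX) !linear_sum.
    by apply: eq_bigr => i _; rewrite !linearZ.
  rewrite scaler_suml; apply: eq_bigr => i _.
  by rewrite linearZ -scalerDr HE ?scalerA // mem_nth // size_tuple.
have [d [z [z0 zd zN1]]] : exists d z, [/\ z != 0, z \in gr N d & z \in N1].
  have hh := homogE hN1.
  have [e0|e0] := eqVneq (N1 :&: gr N false)%VS 0%VS.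
    rewrite e0 add0v in hh; exists true, (vpick N1); rewrite vpick0 -dimv_eq0 dN1 memv_pick.
    by split=> //; have := memv_pick N1; rewrite -{2}hh memv_cap => /andP[].
  exists false, (vpick (N1 :&: gr N false)%VS); rewrite vpick0.
  by have /memv_capP[] := memv_pick (N1 :&: gr N false)%VS.
have N1z : N1 = <[z]>%VS by apply/eqP; rewrite eq_sym eqEdim -memvE zN1 dN1 dim_vline z0.
have xz x : x \in gr a true -> act N x z = 0.
  move=> hx; have : act N x z \in N1 by case: smN1 => _; apply.
  rewrite N1z => /vlineP[c xc]; have := wz_sq two_neq0 z zN hx.
  rewrite xc linearZ /= xc scalerA => /eqP; rewrite scaler_eq0 (negPf z0) orbF mulf_eq0 orbb.
  by move=> /eqP->; rewrite scale0r.
have [s [hs sE]] := triv_vector zN zd xz.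
pose f : 'Hom(dsum (triv a d) P, N) := dcopair s (sub_incl smL).
have hf : is_hom f by apply: dcopair_hom => //; apply: sub_incl_hom.
have fE u : f u = (u.1 : k) *: z + vsval u.2 by rewrite /f dcopairE sE /sub_incl inclE.
have isoN : smod_iso N (dsum (triv a d) P).
  apply: smod_iso_sym; exists f; split=> //.
    apply/eqP; rewrite -subv0; apply/subvP => -[c u]; rewrite memv_ker memv0 fE /= => /eqP e0.
    have : vsval u \in (L :&: N1)%VS.
      rewrite memv_cap subvsP N1z; apply/vlineP; exists (- (c : k)).
      by apply/eqP; rewrite scaleNr -addr_eq0 addrC e0.
    rewrite cap0 memv0 => /eqP u0; move: e0; rewrite u0 addr0 => /eqP.
    rewrite scaler_eq0 (negPf z0) orbF => /eqP ->; apply/eqP; congr (_, _).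
    by apply: subvs_inj; rewrite u0 linear0.
  apply/eqP; rewrite eqEsubv subvf; apply/subvP => v _.
  have : v \in (L + N1)%VS by rewrite sumf memvf.
  case/memv_addP => l lL [n]; rewrite N1z => /vlineP[c ->] ->.
  have -> : l + c *: z = f ((c : triv a d), vsproj L l) by rewrite fE /= vsprojK // addrC.
  by rewrite memv_img ?memvf.
suff de : d = e by exists P; rewrite -de.
have [g1 _] := iso_gdim_rk isoN; have [g2 _] := dsum_gdim_rk (triv a d) P.
have gP : gdim P true = gdim P false.
  have := contractible_gdim two_neq0 true zP cP hx0 x00.
  by have := contractible_gdim two_neq0 false zP cP hx0 x00 => /= -> ->; rewrite addnC.
have := g1 true; have := g1 false; rewrite !g2 !gdim_triv gP.
by case: (e) h1 h2 => /=; rewrite rk1 -/p => -> ->; case: (d) => //=; clear; lia.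
Qed.

End Splitting.

(** * The endomorphism module of an endotrivial module *)

(** When ker g and im g are complementary, the inverse of g on its image, extended by zero on the
    kernel, commutes with every operator that commutes with g.  In particular g h is the projection
    to the image and inherits all symmetries of g. *)
Lemma group_inverse (k : fieldType) (T : vectType k) (g : 'End(T)) :
  (forall w, g (g w) = 0 -> g w = 0) ->
  exists h : 'End(T), [/\ forall w, g (h (g w)) = g w, forall w, g (h w) = h (g w)
    & forall d : 'End(T), (forall w, d (g w) = g (d w)) -> forall w, d (h w) = h (d w)].
Proof.
move=> gg; set I := limg g; set K := lker g.
have cap0 : (I :&: K)%VS = 0%VS.
  apply/eqP; rewrite -subv0; apply/subvP => _ /memv_capP[/memv_imgP[w _ ->]].
  by rewrite memv_ker memv0 => /eqP/gg->.
have full : (I + K)%VS = fullv.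
  apply/eqP; rewrite eqEdim subvf /= dimv_disjoint_sum //.
  by have := limg_ker_dim g fullv; rewrite capfv -/I -/K => <-; rewrite addnC.
pose r := daddv_pi I K; pose f := (g \o incl I)%VF.
have f0 : lker f == 0%VS.
  rewrite -subv0; apply/subvP => u; rewrite memv_ker comp_lfunE inclE => fu.
  have : vsval u \in (I :&: K)%VS by rewrite memv_cap subvsP memv_ker.
  by rewrite cap0 !memv0 => /eqP u0; apply/eqP/subvs_inj; rewrite u0 linear0.
have lf : limg f = I.
  apply/eqP; rewrite eqEdim limg_comp limg_incl limgS ?subvf //=.
  by rewrite limg_dim_eq //.
pose h := (incl I \o f^-1 \o r)%VF.
have hI w : h w \in I by rewrite !comp_lfunE inclE subvsP.
have gh w : g (h w) = r w.
  rewrite !comp_lfunE -[g _]comp_lfunE limg_lfunVK // lf; exact: memv_pi.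
have rg w : r (g w) = g w by apply: daddv_pi_id => //; apply: memv_img (memvf _).
have rk w : r w = w - daddv_pi K I w.
  have := daddv_pi_add cap0 (_ : w \in (I + K)%VS); rewrite full memvf => /(_ isT) e.
  exact: (canRL (addrK _) e).
have gr w : g (r w) = g w.
  rewrite rk linearB /=; have : daddv_pi K I w \in K by apply: memv_pi.
  by rewrite memv_ker => /eqP->; rewrite subr0.
have injI u v : u \in I -> v \in I -> g u = g v -> u = v.
  move=> uI vI e; apply/eqP; rewrite -subr_eq0 -memv0 -cap0 memv_cap memvB //.
  by rewrite memv_ker linearB /= e subrr.
have hg w : h (g w) = r w.
  by apply: injI; [exact: hI|exact: memv_pi|rewrite gh rg gr].
exists h; split=> [w|w|d dg w]; first by rewrite gh rg.
  by rewrite gh hg.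
have dI u : u \in I -> d u \in I by case/memv_imgP => v _ ->; rewrite dg memv_img ?memvf.
have dr : d (r w) = r (d w).
  have dk : d (w - r w) \in K.
    by rewrite memv_ker -dg linearB /= gr subrr linear0.
  have rd : r (d (r w)) = d (r w) by apply: daddv_pi_id => //; apply/dI/memv_pi.
  rewrite -{2}[w](subrK (r w)) linearD /= linearD /= rd -[X in X = _]add0r; congr (_ + _).
  have := daddv_pi_add (etrans (capvC _ _) cap0 : (K :&: I = 0)%VS) (_ : d (w - r w) \in (K + I)%VS).
  rewrite (subvP (addvSl _ _) _ dk) => /(_ isT); rewrite daddv_pi_id //; last by rewrite capvC.
  by move/eqP; rewrite addrC -subr_eq0 addrK => /eqP.
by apply: injI; rewrite ?hI ?dI ?hI // -dg !gh dr.
Qed.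

Section EndAction.
Variables (k : closedFieldType) (a : lieSuper k).
Hypothesis two_neq0 : (2%:R : k) != 0.
Hypothesis central : forall t x, t \in gr a false -> br a t x = 0.
Implicit Types M N P : smod a.

(** The action of an odd x on End(M), with the sign that comes from M (x) M^*. *)
Definition ad M (x : a) (phi : 'End(M)) : 'End(M) :=
  (act M x \o phi)%VF - (sgn M true \o phi \o sgn M true \o act M x)%VF.

Lemma adE M x (phi : 'End(M)) n :
  ad x phi n = act M x (phi n) - sgn M true (phi (sgn M true (act M x n))).
Proof. by rewrite /ad add_lfunE opp_lfunE !comp_lfunE. Qed.

Definition rank1 M (m : M) (f : dual M) : 'End(M) :=
  linfun (fun n => (f : 'Hom(M, k^o)) n *: m).

Lemma rank1E M (m : M) (f : dual M) n : rank1 m f n = (f : 'Hom(M, k^o)) n *: m.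
Proof. by rewrite /rank1 linfun_lin // => c u v; rewrite linearP scalerDl scalerA. Qed.

(** The isomorphism from M (x) M^* to End(M). *)
Definition to_end M : 'Hom(tensor M (dual M), 'End(M)) := tlift (@rank1 M).

Lemma to_endE M (m : M) (f : dual M) : to_end M (tens m f) = rank1 m f.
Proof.
rewrite /to_end tliftE // => [g c u v|m' c u v]; apply/lfunP => n.
  by rewrite add_lfunE scale_lfunE !rank1E scalerDr !scalerA mulrC.
by rewrite add_lfunE scale_lfunE !rank1E add_lfunE scale_lfunE scalerDl scalerA.
Qed.

Definition of_end M (phi : 'End(M)) : tensor M (dual M) :=
  \sum_(i < \dim {:M}) tens (phi (vbasis {:M})`_i)
    (linfun (fun n => coord (vbasis {:M}) i n : k^o) : dual M).

Lemma coord_lfunE (T : vectType k) i n :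
  linfun (fun n => coord (vbasis {:T}) i n : k^o) n = coord (vbasis {:T}) i n.
Proof. by rewrite linfun_lin // => c u v; rewrite linearP. Qed.

Lemma of_endK M (phi : 'End(M)) : to_end M (of_end phi) = phi.
Proof.
apply/lfunP => n; rewrite /of_end linear_sum sum_lfunE [in RHS](coord_vbasis (memvf n)) linear_sum.
by apply: eq_bigr => i _; rewrite /= to_endE rank1E coord_lfunE linearZ.
Qed.

Lemma of_end_linear M : linear (@of_end M).
Proof.
move=> c u v; rewrite /of_end scaler_sumr -big_split; apply: eq_bigr => i _ /=.
by rewrite add_lfunE scale_lfunE tens_linear_l.
Qed.

Lemma to_endK M (A : tensor M (dual M)) : of_end (to_end M A) = A.
Proof.
pose F : 'Hom('End(M), tensor M (dual M)) := linfun (@of_end M).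
have FE phi : F phi = of_end phi by rewrite /F linfun_lin //; apply: of_end_linear.
rewrite -FE -comp_lfunE -[RHS]id_lfunE; congr (fun_of_lfun _ A).
apply: tens_ext => m f; rewrite comp_lfunE id_lfunE FE to_endE /of_end.
under eq_bigr => i _ do rewrite rank1E tensZl -tensZr.
rewrite -tens_sumr; congr (tens m _); apply/lfunP => n; rewrite sum_lfunE.
rewrite [in RHS](coord_vbasis (memvf n)) linear_sum; apply: eq_bigr => i _.
by rewrite scale_lfunE coord_lfunE linearZ; apply: mulrC.
Qed.

Lemma to_end_odd M x (A : tensor M (dual M)) : x \in gr a true ->
  to_end M (act _ x A) = ad x (to_end M A).
Proof.
move=> hx; pose D : 'Hom('End(M), 'End(M)) := linfun (@ad M x).
have DE phi : D phi = ad x phi.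
  rewrite /D linfun_lin // => c u v; apply/lfunP => n.
  rewrite [in RHS]add_lfunE scale_lfunE !adE scalerBr.
  rewrite ![(c *: u + v)%VF _]add_lfunE ![(c *: u)%VF _]scale_lfunE.
  rewrite ![act M x _]linearP ![sgn M true (_ + _)]linearP /=.
  by rewrite opprD addrACA.
rewrite -DE -!comp_lfunE; congr (fun_of_lfun _ A).
apply: tens_ext => m f; rewrite !comp_lfunE DE [act (tensor M (dual M)) x _](tens_act_gr_tens _ _ hx).
rewrite linearD /= !to_endE; apply/lfunP => n.
rewrite [LHS]add_lfunE adE !rank1E [act M x (_ *: m)]linearZ [sgn M true (_ *: _)]linearZ /=; congr (_ + _).
by rewrite [act (dual M) x f n](dual_act_gr_fun _ _ hx) scaleNr.
Qed.

Lemma to_end_even M t (A : tensor M (dual M)) n : t \in gr a false ->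
  to_end M (act _ t A) n = act M t (to_end M A n) - to_end M A (act M t n).
Proof.
move=> ht; pose D : 'Hom('End(M), 'End(M)) :=
  linfun (fun phi => (act M t \o phi)%VF - (phi \o act M t)%VF).
have DE phi : D phi = (act M t \o phi)%VF - (phi \o act M t)%VF.
  rewrite /D linfun_lin // => c u v; apply/lfunP => w.
  rewrite !(add_lfunE, opp_lfunE, scale_lfunE, comp_lfunE) linearP scalerBr.
  by rewrite opprD -scalerN addrACA.
have -> : act M t (to_end M A n) - to_end M A (act M t n) = D (to_end M A) n.
  by rewrite DE add_lfunE opp_lfunE !comp_lfunE.
rewrite -!comp_lfunE; congr (fun_of_lfun (fun_of_lfun _ A) n).
apply: tens_ext => m f; rewrite !comp_lfunE DE [act (tensor M (dual M)) t _](tens_act_gr_tens _ _ ht).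
rewrite linearD /= !to_endE; apply/lfunP => w.
rewrite [LHS]add_lfunE [RHS]add_lfunE opp_lfunE !comp_lfunE !rank1E [act M t (_ *: _)]linearZ /=; congr (_ + _).
by rewrite [act (dual M) t f w](dual_act_gr_fun _ _ ht) /sgn !id_lfunE scaleNr.
Qed.

(** End(M) = k zeta + contractible as a module: alpha is the coordinate of zeta, and H contracts
    the complement while killing zeta. *)
Definition ad_split M (alpha : 'End(M) -> k) : Prop :=
  [/\ forall c u v, alpha (c *: u + v) = c * alpha u + alpha v,
      forall x phi, x \in gr a true -> alpha (ad x phi) = 0
    & exists zeta : 'End(M), forall y : 'Hom(a, k^o), exists H : 'End(M) -> 'End(M),
       [/\ H 0 = 0,
           forall phi : 'End(M), (forall t n, t \in gr a false -> act M t (phi n) = phi (act M t n)) ->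
             forall t n, t \in gr a false -> act M t (H phi n) = H phi (act M t n)
         & forall phi x, x \in gr a true ->
             ad x (H phi) + H (ad x phi) = y x *: (phi - alpha phi *: zeta)]].

Lemma endotrivial_ad_split M : endotrivial M -> exists alpha, ad_split (M := M) alpha.
Proof.
move=> [_ [P pP [F [hF k0 i1]]]]; have [G [hG GF FG]] := iso_inverse hF k0 i1.
have GFE A : G (F A) = A by rewrite -comp_lfunE GF id_lfunE.
have FGE A : F (G A) = A by rewrite -comp_lfunE FG id_lfunE.
have cP := projective_contractible central pP.
exists (fun phi => (F (of_end phi)).1); split.
- by move=> c u v; rewrite of_end_linear linearP.
- move=> x phi hx; rewrite -[phi]of_endK -to_end_odd // to_endK (proj2 hF).
  by rewrite [act _ x _]dsum_actE /= !zero_lfunE.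
exists (to_end M (G (1, 0))) => y; have [K [K1 K2]] := cP y.
exists (fun phi => to_end M (G (0, K (F (of_end phi)).2))); split.
- rewrite (_ : of_end 0 = 0); last by apply: big1 => i _; rewrite zero_lfunE tens0l.
  by rewrite linear0 /= linear0 (_ : ((0, 0) : k_ev a * P) = 0) // !linear0.
- move=> phi phit t n ht; apply/eqP; rewrite -subr_eq0 -to_end_even //.
  rewrite -(proj2 hG) [act _ t _]dsum_actE /dsum_act_fun /= -K1 // !zero_lfunE.
  have -> : act P t (F (of_end phi)).2 = (F (act _ t (of_end phi))).2.
    by rewrite (proj2 hF) [act _ t (F _)]dsum_actE.
  have -> : act _ t (of_end phi) = 0.
    rewrite -[LHS]to_endK (_ : to_end M _ = 0).
      by apply: big1 => i _; rewrite zero_lfunE tens0l.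
    by apply/lfunP => w; rewrite to_end_even // of_endK phit // subrr zero_lfunE.
  by rewrite linear0 /= linear0 (_ : ((0, 0) : k_ev a * P) = 0) // !linear0 zero_lfunE.
move=> phi x hx; rewrite -{2}[phi]of_endK -!to_end_odd // to_endK -(proj2 hG) (proj2 hF).
rewrite -linearD -linearD /= ![act (dsum (k_ev a) P) x _]dsum_actE /dsum_act_fun /=.
set A := of_end phi; set u := F A.
have -> : ((0 : 'Hom(a, 'End(k_ev a))) x 0, act P x (K u.2)) + (0, K (act P x u.2)) =
    y x *: (u - u.1 *: (1, 0)) :> (k_ev a * P)%type.
  congr (_, _); rewrite /= ?zero_lfunE ?scaler0 ?oppr0 ?addr0.
    by rewrite /GRing.scale /= mulr1 subrr mulr0.
  by rewrite K2.
rewrite [G _]linearZ [to_end M _]linearZ /=; congr (_ *: _).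
have GB c (v w : dsum (k_ev a) P) : to_end M (G (v - c *: w)) = to_end M (G v) - c *: to_end M (G w).
  by rewrite linearB linearZ /= linearB linearZ.
by apply: etrans (GB u.1 u (1, 0)) _; rewrite GFE of_endK.
Qed.

(** The component of an operator that anticommutes with the parity operator. *)
Definition odd_part M (K : 'End(M)) : 'End(M) :=
  2%:R^-1 *: (K - (sgn M true \o K \o sgn M true)%VF).

Lemma odd_partE M (K : 'End(M)) v :
  odd_part K v = 2%:R^-1 *: (K v - sgn M true (K (sgn M true v))).
Proof. by rewrite /odd_part scale_lfunE add_lfunE opp_lfunE !comp_lfunE. Qed.

Lemma odd_part_even_comm M (K : 'End(M)) t v : t \in gr a false ->
  (forall v, act M t (K v) = K (act M t v)) ->
  odd_part K (act M t v) = act M t (odd_part K v).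
Proof.
move=> ht h; rewrite !odd_partE [act M t (_ *: _)]linearZ /= [act M t (_ - _)]linearB /= h.
by congr (_ *: (_ - _)); rewrite (even_act_sgn _ ht) h even_act_sgn.
Qed.

Lemma odd_part_anti M (K e : 'End(M)) x c v : x \in gr a true -> ad x K = c *: e ->
  (forall v, e (sgn M true v) = sgn M true (e v)) ->
  act M x (odd_part K v) + odd_part K (act M x v) = c *: e v.
Proof.
move=> hx /lfunP he es; set s := sgn M true in es *.
have ss w : s (s w) = w by apply: sgnK.
have sx w : act M x (s w) = - s (act M x w) by apply: odd_act_sgn.
have h1 := he v; have h2 := congr1 s (he (s v)); rewrite !adE !scale_lfunE -/s in h1 h2.
rewrite linearB /= ss linearZ /= es ss sx !linearN /= ss in h2.
rewrite !odd_partE -/s [act M x (_ *: _)]linearZ /= [act M x (_ - _)]linearB /= sx opprK -scalerDr.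
have -> : act M x (K v) + s (act M x (K (s v))) + (K (act M x v) - s (K (s (act M x v)))) =
    c *: e v + c *: e v.
  by rewrite -{1}h1 -h2 opprK [RHS]addrACA [K _ - _]addrC [RHS]addrACA addrACA.
by rewrite -mulr2n -[X in _ *: X]scaler_nat !scalerA mulrA mulVf // mul1r.
Qed.
End EndAction.

(** * Endotrivial modules are stably locally one-dimensional *)

Lemma exact_homotopy (k : fieldType) (T : vectType k) (e : 'End(T)) : limg e = lker e ->
  exists h : 'End(T), forall v, e (h v) + h (e v) = v.
Proof.
move=> IK; set I := limg e in IK; set C := (I^C)%VS.
have d1 : (I :&: C)%VS = 0%VS by apply: capv_compl.
pose p := daddv_pi I C; pose q := daddv_pi C I; exists (q \o e^-1 \o p)%VF => v.
have pI w : p w \in I by apply: memv_pi.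
have pq w : p w + q w = w by apply: daddv_pi_add => //; rewrite addv_complf memvf.
have eK u : u \in I -> e u = 0 by rewrite IK memv_ker => /eqP.
have eq' w : e (q w) = e w by rewrite -{2}(pq w) linearD /= (eK (p w)) // add0r.
have ee u : u \in I -> e (e^-1%VF u) = u by move=> uI; apply: limg_lfunVK.
rewrite !comp_lfunE eq' ee // [p (e v)](daddv_pi_id d1) ?memv_img ?memvf //.
have : q (e^-1%VF (e v) - v) = 0.
  have : e^-1%VF (e v) - v \in I.
    by rewrite IK memv_ker linearB /= ee ?subrr // memv_img ?memvf.
  move=> uI; have := pq (e^-1%VF (e v) - v); rewrite /p (daddv_pi_id d1 uI).
  by move/(canRL (addKr _)); rewrite addNr.
by rewrite linearB /= => /eqP; rewrite subr_eq0 => /eqP->; apply: pq.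
Qed.

Section Endotrivial.
Variables (k : closedFieldType) (a : lieSuper k).
Hypothesis two_neq0 : (2%:R : k) != 0.
Hypothesis central : forall t x, t \in gr a false -> br a t x = 0.
Implicit Types M N P Q : smod a.

(** A free family of eigenvectors diagonalises t. *)
Lemma even_semisimple M t w : in_F M -> t \in gr a false ->
  act M t (act M t w) = 0 -> act M t w = 0.
Proof.
move=> /(in_F_wspan central)[X hX sX] ht.
have [C [sC fC _ gC]] := span_complement 0%VS X.
rewrite !add0v sX in gC.
have ev (i : 'I_(size C)) : exists c, act M t C`_i = c *: C`_i.
  have [_ /(_ t ht)] : wvec C`_i by apply: hX; apply: sC; rewrite mem_nth.
  by case/vlineP => c ->; exists c.
have [c cE] := fin_all_exists ev.
have wE : w = \sum_(i < size C) coord (in_tuple C) i w *: C`_i.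
  by apply: (coord_span (X := in_tuple C)); apply: (subvP gC); rewrite memvf.
have tE (x : 'I_(size C) -> k) : act M t (\sum_i x i *: C`_i) = \sum_i (c i * x i) *: C`_i.
  rewrite linear_sum; apply: eq_bigr => i _ /=.
  by rewrite linearZ /= cE scalerA mulrC.
rewrite wE !tE => h; apply: big1 => i _.
have /freeP/(_ _ h i)/eqP : free (in_tuple C) by [].
by rewrite !mulf_eq0; case/orP => [/eqP->|/orP[]/eqP->]; rewrite ?mulr0 ?mul0r scale0r.
Qed.

Lemma hom_of_comm M (f : 'End(M)) : (forall i v, f (prj M i v) = prj M i (f v)) ->
  (forall x v, f (act M x v) = act M x (f v)) -> is_hom f.
Proof. by move=> h1 h2; split=> // i v /prj_id vE; rewrite -vE h1 memv_prj. Qed.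

(** For t = [v, v] the projection to the image of t is t h, with h the group inverse of t, and it
    equals ad v (v h) as v^2 = t / 2.  So alpha kills it.  Removing these projections for one v after
    the other leaves a projection to the common kernel. *)
Lemma square_projection M (alpha : 'End(M) -> k) (vs : seq a) : in_F M ->
  (forall c u v, alpha (c *: u + v) = c * alpha u + alpha v) ->
  (forall x phi, x \in gr a true -> alpha (ad x phi) = 0) ->
  {subset vs <= gr a true} ->
  exists p : 'End(M), [/\ is_hom p, forall v w, v \in vs -> act M (br a v v) (p w) = 0,
    forall w, (forall v, v \in vs -> act M (br a v v) w = 0) -> p w = w
    & alpha p = alpha \1%VF].
Proof.
move=> FM al aad; elim: vs => [|v vs IH] hv; first by exists \1%VF; split=> // *; rewrite ?id_lfunE //; exact: hom_id.
have [|p [hp p0 p1 pa]] := IH; first by move=> u uv; apply: hv; rewrite inE uv orbT.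
have vo : v \in gr a true by apply: hv; rewrite mem_head.
set t := br a v v; have ht : t \in gr a false by apply: (br_gr vo vo).
have [h [h1 h2 h3]] := group_inverse (fun w => even_semisimple (w := w) FM ht).
have hx x w : act M x (h w) = h (act M x w) by apply: h3 => u; rewrite [RHS]act_even_comm.
have hj j w : prj M j (h w) = h (prj M j w) by apply: h3 => u; rewrite act_even_prj.
have tp w : act M t (p w) = p (act M t w) by rewrite (proj2 hp).
pose p' : 'End(M) := p - (act M t \o h \o p)%VF.
have p'E w : p' w = p w - act M t (h (p w)) by rewrite add_lfunE opp_lfunE !comp_lfunE.
exists p'; split.
- apply: hom_of_comm => [i w|x w]; rewrite !p'E.
    by rewrite (hom_prj _ _ hp) -hj act_even_prj // linearB.
  by rewrite (proj2 hp) -hx act_even_comm // linearB.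
- move=> u w; rewrite inE p'E linearB /= => /orP[/eqP->|us].
    by rewrite -/t hx h1 subrr.
  have uo : br a u u \in gr a false.
    have uo : u \in gr a true by apply: hv; rewrite inE us orbT.
    exact: (br_gr uo uo).
  by rewrite act_even_comm // hx p0 // linear0 linear0 subrr.
- move=> w w0; rewrite p'E p1 => [|u us]; last by apply: w0; rewrite inE us orbT.
  by rewrite hx w0 ?mem_head // linear0 subr0.
have -> : p' = (-1) *: ad v (act M v \o h \o p)%VF + p; last by rewrite al aad // mulr0 add0r.
apply/lfunP => w; rewrite p'E [RHS]add_lfunE scale_lfunE scaleN1r addrC; congr (- _ + _).
have hs u : h (sgn M true u) = sgn M true (h u) by rewrite !sgnE linearB /= !hj.
rewrite adE !comp_lfunE hom_sgn // hs odd_act_sgn // linearN /= sgnK.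
rewrite opprK (proj2 hp) -hx act_odd_sq // -scalerDr.
rewrite -/t -mulr2n -[X in _ *: X]scaler_nat scalerA mulVf // scale1r; congr (act M t _).
Qed.

Hypothesis squares : exists2 vs : seq a, {subset vs <= gr a true} &
  (gr a false <= <<[seq br a v v | v <- vs]>>)%VS.

(** Being killed by the squares [v, v] means being killed by a_0, which they span. *)
Lemma wz_projection M (alpha : 'End(M) -> k) : in_F M ->
  (forall c u v, alpha (c *: u + v) = c * alpha u + alpha v) ->
  (forall x phi, x \in gr a true -> alpha (ad x phi) = 0) ->
  exists p : 'End(M), [/\ is_hom p, (limg p <= wzpart M)%VS,
    forall w, w \in wzpart M -> p w = w & alpha p = alpha \1%VF].
Proof.
move=> FM al aad; have [vs vso svs] := squares.
have [p [hp p0 p1 pa]] := square_projection FM al aad vso.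
exists p; split=> // [|w /wzpartP w0]; last by apply: p1 => v /vso vo; apply/w0/(br_gr vo vo).
apply/subvP => _ /memv_imgP[w _ ->]; apply/wzpartP => t /(subvP svs) ht.
pose ev : 'Hom(a, M) := linfun (fun t => act M t (p w)).
have evE s : ev s = act M s (p w) by rewrite /ev linfun_lin // => c x y; apply: act_linear_l.
suff /subvP/(_ t ht) : (<<[seq br a v v | v <- vs]>> <= lker ev)%VS.
  by rewrite memv_ker evE => /eqP.
by apply/span_subvP => _ /mapP[v vvs ->]; rewrite memv_ker evE p0.
Qed.

(** A morphism e is invariant in End(M), so if alpha kills it then H e is a null-homotopy of
    y e; its odd part satisfies the equation without signs. *)
Lemma ad_split_contracts M alpha (e : 'End(M)) (y : 'Hom(a, k^o)) : ad_split (M := M) alpha -> is_hom e ->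
  alpha e = 0 -> exists O : 'End(M),
    (forall t v, t \in gr a false -> O (act M t v) = act M t (O v)) /\
    (forall x v, x \in gr a true -> act M x (O v) + O (act M x v) = y x *: e v).
Proof.
move=> [_ _ [zeta /(_ y)[H [H0 Hc HE]]]] he ae; exists (odd_part (H e)).
split=> [t v ht|x v hx].
  apply: odd_part_even_comm => // w; apply: Hc => // {}t {}v {}ht.
  by rewrite (proj2 he).
apply: odd_part_anti => // [|{}v]; last exact: hom_sgn.
have := HE e x hx; rewrite (_ : ad x e = 0) ?H0 ?addr0 ?ae ?scale0r ?subr0 //.
apply/lfunP => w; rewrite adE zero_lfunE (hom_sgn _ he) sgnK (proj2 he) subrr //.
Qed.

Section Retract.
Variables (M N : smod a) (i : 'Hom(N, M)) (p : 'Hom(M, N)) (alpha : 'End(M) -> k).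
Hypotheses (hi : is_hom i) (hp : is_hom p) (pi : (p \o i)%VF = \1%VF).
Hypothesis spl : ad_split (M := M) alpha.
Hypothesis aip : alpha (i \o p)%VF = alpha \1%VF.

Let piE v : p (i v) = v. Proof. by rewrite -comp_lfunE pi id_lfunE. Qed.

(** The complementary idempotent 1 - i p has alpha-value zero, hence is contracted, and its image
    is projective. *)
Lemma retract_stable_iso : in_F M -> stable_iso M N.
Proof.
move=> FM; pose e : 'End(M) := \1%VF - (i \o p)%VF.
have eE v : e v = v - i (p v) by rewrite add_lfunE opp_lfunE id_lfunE comp_lfunE.
have he : is_hom e by apply: hom_sub; [exact: hom_id|exact: hom_comp].
have ee v : e (e v) = e v by rewrite [LHS]eE {2}eE linearB /= piE subrr linear0 subr0.
have ae : alpha e = 0.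
  have [al _ _] := spl; rewrite (_ : e = (-1) *: (i \o p)%VF + \1%VF).
    by rewrite al aip mulN1r addNr.
  by rewrite scaleN1r addrC.
have sQ : submod (limg e).
  split=> [j _ /memv_imgP[v _ ->]|x _ /memv_imgP[v _ ->]].
    by rewrite -hom_prj // memv_img ?memvf.
  by rewrite -(proj2 he) memv_img ?memvf.
pose Q := sub_smod sQ; pose j : 'Hom(Q, M) := sub_incl sQ; pose q : 'Hom(M, Q) := corestr sQ e.
have hj : is_hom j := sub_incl_hom sQ.
have hq : is_hom q by apply: corestr_hom.
have qj : (q \o j)%VF = \1%VF.
  by apply: corestr_sub_incl => // _ /memv_imgP[v _ ->]; rewrite ee.
have jq : (j \o q)%VF = e by apply: sub_incl_corestr.
have jqE v : j (q v) = e v by rewrite -comp_lfunE jq.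
have qjE v : q (j v) = v by rewrite -comp_lfunE qj id_lfunE.
have cQ : contractible Q.
  move=> y; have [O [O1 O2]] := ad_split_contracts y spl he ae; exists (q \o O \o j)%VF.
  split=> [t v ht|x v hx]; rewrite !comp_lfunE (proj2 hj).
    by rewrite O1 // (proj2 hq).
  by rewrite -(proj2 hq) -linearD /= O2 // linearZ /= -jqE !qjE.
have pQ : projective Q.
  apply: contractible_projective => //.
  exact: (in_F_retract central hq qj FM).
exists p, i; split=> //; last by rewrite pi; apply: stable_eq_refl.
exists Q, (- q), j; split=> //; first exact: hom_opp.
apply/lfunP => v; rewrite [RHS]comp_lfunE opp_lfunE linearN /= jqE eE opprB.
by rewrite add_lfunE opp_lfunE id_lfunE comp_lfunE.
Qed.

(** Suppose x is exact on N, with homotopy h.  Then 2 i p has the form x.B, so alpha(1) = alpha(i p) = 0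
    and M is contractible.  Suppose the homology of x on N has dimension at least two.  Then some
    cycle u of N outside the image satisfies alpha(u xi) = 0, for a functional xi which vanishes on
    the image of x and takes the value one at another cycle v1.  Contracting the invariant operator u xi
    by B and evaluating x.B at v1 gives u = x (B v1), a contradiction. *)
Lemma retract_lod : wz N -> ~ contractible M -> lod N.
Proof.
move=> zN ncM; split=> // x hx x0; have [al aad _] := spl.
have [y yx] := functional_1 x0.
set e := act N x; set I := limg e; set K := lker e.
have e2 v : e (e v) = 0 by apply: wz_sq.
have IK : (I <= K)%VS by apply/subvP => _ /memv_imgP[v _ ->]; rewrite memv_ker e2.
have dI : (rk N false x + rk N true x = \dim I)%N.
  rewrite /rk -dimv_disjoint_sum; first by rewrite -limgD gr_add.
  apply/eqP; rewrite -subv0 -(gr_cap N) [X in (_ <= X)%VS]capvC.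
  by apply: capvS; apply: act_odd_img hx.
have dN := limg_ker_dim e fullv; rewrite capfv -/K -/I in dN.
rewrite dI; suff dK : \dim K = (\dim I).+1 by rewrite -dN dK; lia.
have dIK := dimvS IK; have [eqIK|ltIK] := eqVneq (\dim I) (\dim K).
  case: ncM; have [h hE] : exists h : 'End(N), forall v, e (h v) + h (e v) = v.
    by apply: exact_homotopy; apply/eqP; rewrite eqEdim IK eqIK leqnn.
  (* h need not be odd, hence the symmetrised operator; it produces twice the projection *)
  pose s := sgn N true; pose B : 'End(M) := (i \o (h - (s \o h \o s)) \o p)%VF.
  have BE v : B v = i (h (p v) - s (h (s (p v)))).
    by rewrite /B !comp_lfunE [(h - _)%VF _]add_lfunE opp_lfunE !comp_lfunE.
  have adB : ad x B = 2%:R *: (i \o p)%VF.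
    apply/lfunP => v; rewrite adE scale_lfunE !BE comp_lfunE -(proj2 hi) -(hom_sgn _ hi).
    rewrite (hom_sgn _ hp) (proj2 hp) -linearB -linearZ /=; congr (i _).
    rewrite -/e -/s !linearB /= /s !sgnK !(odd_act_sgn _ hx) -/s -/e.
    set w := p v; have h1 := hE w; have h2 := congr1 s (hE (s w)).
    rewrite linearD /= /s sgnK !(odd_act_sgn _ hx) -/s -/e linearN /= linearN /= in h2.
    by rewrite scaler_nat mulr2n; apply: etrans (congr2 +%R h1 h2); rewrite !opprK [RHS]addrACA [h (e w) - _]addrC.
  have a1 : alpha \1%VF = 0.
    rewrite -aip; have := aad x B hx; rewrite adB -[_ *: _]addr0 al.
    have a0 : alpha 0 = 0 by have := al 1 0 0; rewrite scale1r addr0 mul1r => /eqP; rewrite -subr_eq subrr => /eqP.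
    by rewrite a0 addr0 => /eqP; rewrite mulf_eq0 (negPf two_neq0) => /eqP.
  move=> y'; have [O [O1 O2]] := ad_split_contracts y' spl (hom_id M) a1.
  by exists O; split=> // z v hz; rewrite O2 // id_lfunE.
apply/eqP; rewrite eqn_leq ltn_neqAle ltIK dIK andbT leqNgt; apply/negP => gtIK.
have [v1 v1K v1I] : exists2 v, v \in K & v \notin I.
  apply/subvPn; apply: contra ltIK => KI; apply/eqP/eqP; rewrite eqn_leq dIK.
  exact: dimvS.
have [xi [xiI xi1]] : exists xi : 'Hom(N, k^o), (forall v, v \in I -> xi v = 0) /\ xi v1 = 1.
  pose T := [tuple of v1 :: vbasis I].
  have fT : free T by rewrite free_cons (span_basis (vbasisP I)) v1I (basis_free (vbasisP I)).
  exists (linfun (fun v => coord T ord0 v : k^o)).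
  have xE v : linfun (fun v => coord T ord0 v : k^o) v = coord T ord0 v.
    by rewrite linfun_lin // => c m m'; rewrite linearP.
  split=> [v vI|]; rewrite xE; last by rewrite (coord_free ord0 ord0 fT).
  rewrite (coord_vbasis vI) linear_sum big1 // => j _ /=.
  have xj : coord T ord0 (vbasis I)`_j = 0.
    have h := coord_free (lift ord0 j) ord0 fT; rewrite eq_sym (negPf (neq_lift _ _)) in h.
    exact: h.
  by rewrite linearZ /= xj mulr0.
pose phi u : 'End(M) := linfun (fun n => xi (p n) *: i u).
have phiE u n : phi u n = xi (p n) *: i u.
  by rewrite /phi linfun_lin // => c m m'; rewrite !linearP scalerDl scalerA.
pose lam : 'Hom(N, k^o) := linfun (fun u => alpha (phi u) : k^o).
have lamE u : lam u = alpha (phi u).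
  rewrite /lam linfun_lin // => c m m'; rewrite -[RHS]al; congr alpha.
  by apply/lfunP => n; rewrite add_lfunE scale_lfunE !phiE linearP scalerDr !scalerA mulrC.
(* the condition alpha (phi u) = 0 has codimension at most one in K *)
have [u] : exists2 u, u \in (K :&: lker lam)%VS & u \notin I.
  apply/subvPn; apply/negP => /dimvS le; have := gtIK.
  have := limg_ker_dim lam K; have : (\dim (lam @: K) <= 1)%N.
    by apply: leq_trans (dimvS (subvf _)) _; rewrite dimvf.
  lia.
rewrite memv_cap !memv_ker lamE => /andP[/eqP eu /eqP au] /negP[].
have [_ _ [zeta /(_ y)[H [H0 _ HE]]]] := spl.
have := HE (phi u) x hx; rewrite yx au scale1r scale0r subr0.
have -> : ad x (phi u) = 0.
  apply/lfunP => n; rewrite adE zero_lfunE !phiE linearZ /= -(proj2 hi) -/e eu linear0 scaler0.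
  rewrite (hom_sgn _ hp) (proj2 hp) (_ : sgn _ _ _ = - e (sgn N true (p n))).
    by rewrite linearN /= xiI ?memv_img ?memvf // oppr0 scale0r linear0 subr0.
  by rewrite odd_act_sgn ?opprK.
rewrite H0 addr0 => /lfunP/(_ (i v1)); rewrite adE phiE piE xi1 scale1r.
move: v1K; rewrite memv_ker -(proj2 hi) -/e => /eqP->; rewrite !linear0 addr0.
move/(congr1 p); rewrite (proj2 hp) piE => <-; exact: memv_img (memvf _).
Qed.
End Retract.
End Endotrivial.

(** * Projective covers and Omega *)

Section Omega.
Variables (k : closedFieldType) (a : lieSuper k).
Hypothesis two_neq0 : (2%:R : k) != 0.
Hypothesis central : forall t x, t \in gr a false -> br a t x = 0.
Implicit Types M N P Q K : smod a.

Lemma sub_wz P (U : {vspace P}) (sU : submod U) : wz P -> wz (sub_smod sU).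
Proof.
move=> zP t v ht; apply: (@subvs_inj _ _ U); apply: (etrans (sub_actE _ _ _)).
by rewrite zP // linear0.
Qed.

(** Among the iterates of g choose one of minimal rank; then its kernel meets its image
    trivially. *)
Lemma fitting_step P N (p : 'Hom(P, N)) (g : 'End(P)) : is_hom g -> (p \o g)%VF = p ->
  exists G : 'End(P), [/\ is_hom G, (p \o G)%VF = p, (limg G <= limg g)%VS
    & forall w, G (G w) = 0 -> G w = 0].
Proof.
move: {2}(\dim (limg g)).+1 (ltnSn (\dim (limg g))) => n.
elim: n g => // n IH g lt hg pg.
have hgg : is_hom (g \o g)%VF by apply: hom_comp.
have pgg : (p \o (g \o g))%VF = p by rewrite comp_lfunA !pg.
have sub : (limg (g \o g)%VF <= limg g)%VS by rewrite limg_comp limgS ?subvf.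
have [eqd|ned] := eqVneq (\dim (limg (g \o g)%VF)) (\dim (limg g)).
  exists g; split=> // w ggw.
  have := limg_ker_dim g (limg g); rewrite -limg_comp eqd => /eqP.
  rewrite -{2}[\dim (limg g)]add0n eqn_add2r dimv_eq0 => /eqP c0.
  apply/eqP; rewrite -memv0 -c0 memv_cap memv_img ?memvf //= memv_ker ggw //.
have [|G [hG pG sG G0]] := IH _ _ hgg pgg.
  by have := dimvS sub; lia.
by exists G; split=> //; apply: subv_trans sub.
Qed.

(** If p restricted to a proper submodule U is onto, lift p through U to an endomorphism g of P
    with p g = p.  By Fitting, an iterate of g has an image which is a direct summand of P, smaller
    than P because it lies in U, and which p still maps onto N. *)
Lemma smaller_cover P N (p : 'Hom(P, N)) (U : {vspace P}) : wz P -> contractible P ->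
  wz N -> is_hom p -> limg p = fullv -> submod U -> (U + lker p)%VS = fullv -> U <> fullv ->
  exists Q (q : 'Hom(Q, N)), [/\ wz Q, contractible Q, is_hom q, limg q = fullv
    & (\dim {:Q} < \dim {:P})%N].
Proof.
move=> zP cP zN hp p1 sU Up nU.
pose i := sub_incl sU; have hi : is_hom i := sub_incl_hom sU.
have zU : wz (sub_smod sU) by apply: sub_wz.
have pi1 : limg (p \o i)%VF = fullv.
  apply/eqP; rewrite eqEsubv subvf limg_comp limg_incl -p1 -Up limgD.
  rewrite subv_add subvv; apply/subvP => _ /memv_imgP[v + ->].
  by rewrite memv_ker => /eqP->; apply: mem0v.
have [h hh ph] := contractible_lift two_neq0 central cP (in_F_wz zU) (hom_comp hp hi) pi1 hp.
have hih : is_hom (i \o h)%VF by apply: hom_comp.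
have [|G [hG pG sG G0]] := fitting_step hih (p := p); first by rewrite comp_lfunA ph.
have [r [r1 r2 r3]] := group_inverse G0.
have rG x w : act P x (r w) = r (act P x w) by apply: r3 => u; rewrite (proj2 hG).
have rj j w : prj P j (r w) = r (prj P j w) by apply: r3 => u; rewrite (hom_prj _ _ hG).
pose e := (G \o r)%VF.
have eE w : e w = G (r w) by rewrite comp_lfunE.
have he : is_hom e.
  by apply: hom_comp => //; apply: hom_of_comm => *; rewrite ?rj ?rG.
have eG w : e (G w) = G w by rewrite eE r1.
have ee w : e (e w) = e w by rewrite [in LHS]eE [e w]eE r1.
have sQ : submod (limg e).
  split=> [j _ /memv_imgP[v _ ->]|x _ /memv_imgP[v _ ->]].
    by rewrite -hom_prj // memv_img ?memvf.
  by rewrite -(proj2 he) memv_img ?memvf.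
pose Q := sub_smod sQ; pose j : 'Hom(Q, P) := sub_incl sQ; pose q : 'Hom(P, Q) := corestr sQ e.
have hj : is_hom j := sub_incl_hom sQ.
have hq : is_hom q by apply: corestr_hom.
have qj : (q \o j)%VF = \1%VF.
  by apply: corestr_sub_incl => // _ /memv_imgP[v _ ->]; rewrite ee.
have jqE v : j (q v) = e v by rewrite -comp_lfunE sub_incl_corestr.
exists Q, (p \o j)%VF; split.
- exact: sub_wz.
- exact: (contr_retract hj hq qj).
- exact: hom_comp.
- apply/eqP; rewrite eqEsubv subvf -p1; apply/subvP => _ /memv_imgP[w _ ->].
  have -> : p w = (p \o j)%VF (q (G w)) by rewrite comp_lfunE jqE eG -comp_lfunE pG.
  exact: memv_img (memvf _).
rewrite dim_subvs; apply: leq_ltn_trans (_ : \dim U < _)%N.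
  apply: dimvS; rewrite limg_comp; apply: subv_trans (limgS _ (subvf _)) _.
  by apply: subv_trans sG _; rewrite limg_comp; apply: subv_trans (limgS _ (subvf _)) _; rewrite limg_incl.
rewrite ltn_neqAle dimvS ?subvf // andbT; apply: contra_not_neq nU => dU.
by apply/eqP; rewrite eqEdim subvf dU leqnn.
Qed.

Lemma cover_exists N : wz N -> exists P (p : 'Hom(P, N)), proj_cover p.
Proof.
move=> zN; have [P [p [zP cP hp p1]]] := wz_projective_over two_neq0 central zN.
move: {2}(\dim {:P}).+1 (ltnSn (\dim {:P})) => n.
elim: n P p zP cP hp p1 => // n IH P p zP cP hp p1 lt.
have pP : projective P by apply: contractible_projective => //; apply: in_F_wz.
have [cov|ncov] := Classical_Prop.classic (proj_cover p); first by exists P, p.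
have [U [sU Up nU]] : exists U : {vspace P}, [/\ submod U, (U + lker p)%VS = fullv & U <> fullv].
  apply: Classical_Prop.NNPP => nex; apply: ncov; split=> // U sU Up.
  by apply: Classical_Prop.NNPP => nU; apply: nex; exists U.
have [Q [q [zQ cQ hq q1 ltQ]]] := smaller_cover zP cP zN hp p1 sU Up nU.
by apply: (IH Q q) => //; apply: leq_trans ltQ _.
Qed.

(** An a_0-equivariant section of p shows that the part of weight zero of P already maps onto k_ev,
    so by minimality it is all of P. *)
Lemma cover_wz P (p : 'Hom(P, k_ev a)) : proj_cover p -> wz P.
Proof.
move=> [[FP pP] hp p1 pmin].
have [s [ps s1 s2]] := even_section central FP hp p1.
pose v := s (1 : k_ev a).
have pv : p v = (1 : k_ev a) by rewrite /v -comp_lfunE ps id_lfunE.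
have v0 : v \in wzpart P.
  by apply/wzpartP => t ht; rewrite -s2 // act_triv linear0.
have full : wzpart P = fullv.
  apply: pmin; first exact: wzpart_submod.
  apply/eqP; rewrite eqEsubv subvf; apply/subvP => w _.
  rewrite -[w](subrK ((p w : k) *: v)) addrC memv_add ?memvZ // memv_ker linearB linearZ /= pv.
  by rewrite subr_eq0 /GRing.scale /= mulr1.
by move=> t w ht; apply: (wzpartP (M := P) w _) => //; rewrite full memvf.
Qed.

Hypothesis rank_ge2 : (2 <= \dim (gr a true))%N.

(** On P each odd y has rank c in both degrees and P has dimensions (2 c, 2 c).  Passing to the kernel
    of p removes one even dimension.  The image of y in even degree is its whole kernel there and
    lies in ker p, so only the rank of y on the even part drops, by one. *)
Lemma omega_lod Om x : is_Omega1 (k_ev a) Om -> x \in gr a true -> x != 0 ->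
  lod Om /\ lod_inv x Om (-1) true.
Proof.
move=> [P [p [i [cov hi i0 iK]]]] hx x0; have zP := cover_wz cov.
have [pP hp p1 _] := cov; have cP := projective_contractible central pP.
have inj u v : i u = i v -> u = v by apply: lker0P; rewrite i0.
have zO : wz Om by move=> t v ht; apply: inj; rewrite (proj2 hi) zP // linear0.
have ker_odd v : v \in gr P true -> p v = 0.
  by move/(proj1 hp); rewrite /= /triv_gr /= memv0 => /eqP.
have img d : (i @: gr Om d = gr P d :&: lker p)%VS.
  apply/eqP; rewrite eqEsubv; apply/andP; split; apply/subvP => v.
    by case/memv_imgP => w hw ->; rewrite memv_cap (proj1 hi) //= -iK memv_img ?memvf.
  rewrite memv_cap -iK => /andP[vd /memv_imgP[w _ vE]].
  by rewrite -(prj_id vd) vE -(hom_prj _ _ hi) memv_img ?memv_prj.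
have gd d : gdim Om d = \dim (gr P d :&: lker p).
  by rewrite -img /gdim limg_dim_eq // i0 capv0.
have rd d y : rk Om d y = \dim (act P y @: (gr P d :&: lker p)).
  rewrite -img -limg_comp /rk -(limg_dim_eq (f := i)) ?i0 ?capv0 // -limg_comp.
  by congr (\dim _); apply: eq_in_limg => v _; rewrite !comp_lfunE (proj2 hi).
have capT : (gr P true :&: lker p)%VS = gr P true.
  by apply/capv_idPl/subvP => v vT; rewrite memv_ker ker_odd.
have dF : (\dim (gr P false :&: lker p)).+1 = gdim P false.
  have := limg_ker_dim p (gr P false); rewrite -/(gdim P false) => <-.
  suff -> : (p @: gr P false)%VS = fullv by rewrite dimvf addn1.
  apply/eqP; rewrite eqEsubv subvf -p1 -gr_add limgD subv_add subvv.
  by apply/subvP => _ /memv_imgP[v vT ->]; rewrite ker_odd // mem0v.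
have key y : y \in gr a true -> y != 0 -> exists c : nat,
    [/\ gdim P false = (2 * c)%N, gdim P true = (2 * c)%N, rk Om true y = c & (rk Om false y).+1 = c].
  move=> hy y0; have [w hw yw] := independent_partner rank_ge2 y0.
  have g := contractible_gdim two_neq0 _ zP cP hy y0.
  have rF := contractible_rk two_neq0 false zP cP hy hw yw; rewrite /= in rF.
  have gF := g false; have gT := g true; rewrite /= in gF gT.
  exists (rk P true y); rewrite gF gT rF; split; try lia; first by rewrite rd capT.
  have kF : (gr P false :&: lker (act P y) = act P y @: gr P true)%VS.
    apply/eqP; rewrite eq_sym eqEdim; apply/andP; split.
      apply/subvP => _ /memv_imgP[v vT ->]; rewrite memv_cap memv_ker wz_sq // eqxx andbT.
      exact: (act_gr hy vT).
    have := limg_ker_dim (act P y) (gr P false).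
    by rewrite -/(gdim P false) gF -/(rk P false y) -/(rk P true y); lia.
  have kA : ((gr P false :&: lker p) :&: lker (act P y) = act P y @: gr P true)%VS.
    rewrite -capvA [(lker p :&: _)%VS]capvC capvA kF; apply/capv_idPl/subvP.
    by move=> _ /memv_imgP[v vT ->]; rewrite memv_ker (proj2 hp) act_triv.
  have := limg_ker_dim (act P y) (gr P false :&: lker p); rewrite kA -rd -/(rk P true y).
  lia.
have [c [e1 e2 e3 e4]] := key x hx x0.
split; last first.
  by rewrite /lod_inv /= !gd capT; split; [rewrite -/(gdim P true)| |]; lia.
split=> // y hy y0; have [c' [e1' e2' e3' e4']] := key y hy y0.
by rewrite gdim_add !gd capT -/(gdim P true); lia.
Qed.
End Omega.

(** * The group of stable classes *)

Lemma int_Z2_closed (S : int * 'Z_2 -> Prop) : S 0 -> (forall u v, S u -> S v -> S (u + v)) ->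
  (forall u, S u -> S (- u)) -> S (-1, 1) -> S (0, 1) -> forall u, S u.
Proof.
move=> S0 SD SN S11 S01.
have SE n n' (e e' : 'Z_2) : n = n' -> e = e' -> S (n, e) -> S (n', e') by move=> -> ->.
have S10 : S (1, 0).
  by apply: SE (SN _ (SD _ _ S11 S01)); [|apply: val_inj].
have Sn (n : nat) : S (n%:Z, 0).
  elim: n => [|n IH]; first exact: S0.
  by apply: SE (SD _ _ S10 IH); [rewrite /= -PoszD|rewrite /= addr0].
have Sz (n : int) : S (n, 0).
  by case: n => n //; apply: SE (SN _ (Sn n.+1)); [rewrite NegzE|rewrite /= oppr0].
case=> n [[|[|//]] h]; first by apply: SE (Sz n) => //; apply: val_inj.
by apply: SE (SD _ _ (Sz n) S01); [rewrite /= addr0|apply: val_inj].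
Qed.

Lemma Z2_parityD (u v : 'Z_2) : (u + v != 0) = (u != 0) (+) (v != 0).
Proof. by case: u v => [[|[|//]] h] [[|[|//]] h']. Qed.

Section Picard.
Variables (k : closedFieldType) (a : lieSuper k).
Hypothesis two_neq0 : (2%:R : k) != 0.
Hypothesis central : forall t x, t \in gr a false -> br a t x = 0.
Hypothesis squares : exists2 vs : seq a, {subset vs <= gr a true} &
  (gr a false <= <<[seq br a v v | v <- vs]>>)%VS.
Hypothesis rank_ge2 : (2 <= \dim (gr a true))%N.
Variable x0 : a.
Hypotheses (hx0 : x0 \in gr a true) (nx0 : x0 != 0).
Implicit Types M N P : smod a.

Let in_F_lod N : lod N -> in_F N. Proof. by case=> zN _; apply: in_F_wz. Qed.

Lemma triv_lod d : lod (triv a d) /\ lod_inv x0 (triv a d) 0 d.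
Proof.
have rk0 i x : rk (triv a d) i x = 0%N.
  apply/eqP; rewrite /rk dimv_eq0 -subv0; apply/subvP => _ /memv_imgP[v _ ->].
  by rewrite act_triv mem0v.
split; first by split=> [|x hx xn0]; [exact: wz_triv|rewrite !rk0 dimvf].
by split; rewrite ?gdim_triv ?rk0 ?eqxx //; [case: (d)|rewrite subrr mulr0].
Qed.

Lemma lod_trivial_stable N d : lod N -> lod_inv x0 N 0 d ->
  exists2 P, projective P & smod_iso N (dsum (triv a d) P).
Proof.
move=> lN iN; have [P [zP cP NP]] := lod_split two_neq0 rank_ge2 lN hx0 nx0 iN.
by exists P => //; apply: contractible_projective => //; apply: in_F_wz.
Qed.

(** N (x) N^* has invariant (n - n, e + e) = (0, 0). *)
Lemma lod_endotrivial N : lod N -> endotrivial N.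
Proof.
move=> lN; split; first exact: in_F_lod.
have [n [e iN]] := lod_inv_exists two_neq0 lN hx0 nx0.
have lD := lod_dual two_neq0 lN; have iD := lod_inv_dual two_neq0 (proj1 lN) hx0 iN.
have := lod_inv_tensor two_neq0 lN lD hx0 nx0 iN iD; rewrite subrr addbb => iT.
exact: lod_trivial_stable (lod_tensor two_neq0 lN lD) iT.
Qed.

(** With N' the dual of N, M = M (N' N) = (M N') N = N, as N' N and M N' are stably trivial. *)
Lemma lod_inv_stable_iso M N n e : lod M -> lod N -> lod_inv x0 M n e -> lod_inv x0 N n e ->
  stable_iso M N.
Proof.
move=> lM lN iM iN.
have lD := lod_dual two_neq0 lN; have iD := lod_inv_dual two_neq0 (proj1 lN) hx0 iN.
have unit X Y i f : lod X -> lod Y -> lod_inv x0 X i f -> lod_inv x0 Y (- i) f ->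
    stable_iso (tensor X Y) (k_ev a).
  move=> lX lY iX iY; have := lod_inv_tensor two_neq0 lX lY hx0 nx0 iX iY.
  rewrite subrr addbb => iT.
  have [P pP XP] := lod_trivial_stable (lod_tensor two_neq0 lX lY) iT.
  exact: stable_iso_dsum XP.
have MD := unit _ _ _ _ lM lD iM iD; have DN := unit _ _ _ _ lD lN iD _.
rewrite opprK in DN; have {}DN := DN iN.
apply: (stable_iso_trans two_neq0 central (stable_iso_sym (iso_stable_iso two_neq0 central (tensor_unit_r M)))).
apply: (stable_iso_trans two_neq0 central (stable_iso_tensor_r two_neq0 central (in_F_lod lM) (stable_iso_sym DN))).
apply: (stable_iso_trans two_neq0 central (stable_iso_sym (iso_stable_iso two_neq0 central (tensor_assoc M (dual N) N)))).
apply: (stable_iso_trans two_neq0 central (stable_iso_tensor_l two_neq0 central (in_F_lod lN) MD)).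
exact: (iso_stable_iso two_neq0 central (tensor_unit_l N)).
Qed.

(** Otherwise k_ev would be a direct summand of a contractible module. *)
Lemma endotrivial_not_contractible M : endotrivial M -> ~ contractible M.
Proof.
move=> [FM [P pP MP]] cM; have [F [hF F0 F1]] := MP.
have [G [hG GF FG]] := iso_inverse hF F0 F1.
have cMM := contr_tensor_l two_neq0 (dual M) cM.
pose i : 'Hom(k_ev a, dsum (k_ev a) P) := dpair \1%VF 0.
pose p : 'Hom(dsum (k_ev a) P, k_ev a) := dcopair \1%VF 0.
have hi : is_hom i by apply: dpair_hom; [exact: hom_id|exact: hom_zero].
have hp : is_hom p by apply: dcopair_hom; [exact: hom_id|exact: hom_zero].
have ck : contractible (k_ev a).
  apply: (contr_retract (i := (G \o i)%VF) (p := (p \o F)%VF)) cMM; try exact: hom_comp.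
  apply/lfunP => v; rewrite !comp_lfunE -[F _]comp_lfunE FG id_lfunE dpairE dcopairE /=.
  by rewrite !id_lfunE !zero_lfunE addr0.
have [y yx] := functional_1 nx0; have [H [_ /(_ x0 (1 : k_ev a) hx0)]] := ck y.
by rewrite !act_triv linear0 addr0 yx scale1r => /esym/eqP; rewrite oner_eq0.
Qed.

Lemma endotrivial_stably_lod M : endotrivial M -> exists2 N, lod N & stable_iso M N.
Proof.
move=> eM; have FM := proj1 eM; have [alpha spl] := endotrivial_ad_split central eM.
have [al aad _] := spl; have [e [he ew e1 ae]] := wz_projection two_neq0 central squares FM al aad.
pose i : 'Hom(wzmod central M, M) := sub_incl (wzpart_submod central M).
pose p : 'Hom(M, wzmod central M) := corestr (wzpart_submod central M) e.
have hi : is_hom i := sub_incl_hom _; have hp : is_hom p by apply: corestr_hom.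
have pi : (p \o i)%VF = \1%VF by apply: corestr_sub_incl.
have aip : alpha (i \o p)%VF = alpha \1%VF by rewrite sub_incl_corestr.
exists (wzmod central M).
  exact: (retract_lod two_neq0 hi hp pi spl aip (@wzmod_wz _ _ central M) (endotrivial_not_contractible eM)).
exact: (retract_stable_iso two_neq0 central hi hp pi spl aip FM).
Qed.

(** The predicate on modules attached to u, which is the stable class of any lod module of invariant u. *)
Definition inv_class (u : int * 'Z_2) : smod a -> Prop := fun X =>
  in_F X /\ exists N, [/\ lod N, lod_inv x0 N u.1 (u.2 != 0) & stable_iso N X].

Lemma inv_classE N u : lod N -> lod_inv x0 N u.1 (u.2 != 0) -> stable_class N = inv_class u.
Proof.
move=> lN iN; apply: functional_extensionality => X; apply: propositional_extensionality.
split=> -[FX]; first by move=> NX; split=> //; exists N.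
case=> N' [lN' iN' NX]; split=> //; apply: stable_iso_trans NX => //.
exact: lod_inv_stable_iso iN iN'.
Qed.

Lemma stable_class_eq M N : stable_iso M N -> stable_class M = stable_class N.
Proof.
move=> MN; apply: functional_extensionality => X; apply: propositional_extensionality.
split=> -[FX sX]; split=> //; last exact: stable_iso_trans MN sX.
exact: stable_iso_trans (stable_iso_sym MN) sX.
Qed.

Lemma T_add_class M N : in_F M -> in_F N ->
  T_add (stable_class M) (stable_class N) = stable_class (tensor M N).
Proof.
move=> FM FN; apply: functional_extensionality => X; apply: propositional_extensionality.
split=> [[M' [N' [[FM' MM'] [FN' NN'] [FX sX]]]]|[FX sX]]; last first.
  by exists M, N; split; split=> //; apply: stable_iso_refl.
split=> //; apply: stable_iso_trans sX => //.
exact: stable_iso_tensor.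
Qed.

Lemma omega_inv Om : is_Omega1 (k_ev a) Om -> lod Om /\ lod_inv x0 Om (-1) true.
Proof. by move=> hO; apply: omega_lod. Qed.

Lemma omega_exists : exists Om : smod a, is_Omega1 (k_ev a) Om.
Proof.
have [P [p cov]] := cover_exists two_neq0 central (@wz_triv _ a false).
have hp : is_hom p by case: cov.
have sK : submod (lker p).
  split=> [i u|x u]; rewrite !memv_ker => /eqP pu.
    by rewrite (hom_prj _ _ hp) pu linear0.
  by rewrite (proj2 hp) pu linear0.
exists (sub_smod sK), P, p, (sub_incl sK); split=> //; first exact: sub_incl_hom.
  exact: incl_inj.
exact: limg_incl.
Qed.

Lemma inv_exists (u : int * 'Z_2) : exists2 N, lod N & lod_inv x0 N u.1 (u.2 != 0).
Proof.
move: u; apply: int_Z2_closed => [|u v [N lN iN] [N' lN' iN']|u [N lN iN]||].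
- by have [l i] := triv_lod false; exists (k_ev a).
- exists (tensor N N'); first exact: lod_tensor.
  by rewrite Z2_parityD; apply: lod_inv_tensor.
- exists (dual N); first exact: lod_dual.
  by rewrite /= oppr_eq0; apply: lod_inv_dual iN => //; case: lN.
- by have [Om hO] := omega_exists; have [l i] := omega_inv hO; exists Om.
- by have [l i] := triv_lod true; exists (k_od a).
Qed.

Lemma inv_classP u : exists2 N, lod N & inv_class u = stable_class N.
Proof. by have [N lN iN] := inv_exists u; exists N => //; rewrite (inv_classE lN iN). Qed.

Lemma inv_class_add u v : inv_class (u + v) = T_add (inv_class u) (inv_class v).
Proof.
have [N lN iN] := inv_exists u; have [N' lN' iN'] := inv_exists v.
rewrite -(inv_classE lN iN) -(inv_classE lN' iN') T_add_class; try exact: in_F_lod.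
apply/esym/inv_classE; first exact: lod_tensor.
by rewrite Z2_parityD; apply: lod_inv_tensor.
Qed.

Lemma inv_class_iso : T_isomorphism inv_class.
Proof.
split=> [u v e|C|]; last exact: inv_class_add.
  have [N lN iN] := inv_exists u; have [N' lN' iN'] := inv_exists v.
  have [_ NN'] : stable_class N N'.
    rewrite (inv_classE lN iN) e -(inv_classE lN' iN'); split; first exact: in_F_lod.
    exact: stable_iso_refl.
  have [_ iu] := lod_inv_stable two_neq0 central rank_ge2 lN (proj1 lN') NN' hx0 nx0 iN.
  have [e1 e2] := lod_inv_uniq iu iN'; case: u v e1 e2 {e iN iN' iu} => n e [n' e'] /= -> ee.
  by congr (_, _); case: e e' ee => [[|[|//]] h] [[|[|//]] h'] //= _; apply: val_inj.
split=> [[M eM ->]|[u ->]]; last first.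
  by have [N lN ->] := inv_classP u; exists N => //; apply: lod_endotrivial.
have [N lN MN] := endotrivial_stably_lod eM; have [n [e iN]] := lod_inv_exists two_neq0 lN hx0 nx0.
exists (n, (e : nat)%:R); rewrite (stable_class_eq MN); apply: inv_classE => //=.
by case: e iN.
Qed.

Lemma inv_class_generated Om : is_Omega1 (k_ev a) Om ->
  T_generated_by (fun C => C = stable_class Om \/ C = stable_class (k_od a)).
Proof.
move=> hO; have [lO iO] := omega_inv hO; have [l1 i1] := triv_lod true.
have [l0 i0] := triv_lod false.
have [inj onto add] := inv_class_iso.
have T0 : @T_zero k a = inv_class 0 by apply: (inv_classE (N := k_ev a)).
have TO : stable_class Om = inv_class (-1, 1) by apply: inv_classE.
have T1 : stable_class (k_od a) = inv_class (0, 1) by apply: (inv_classE (N := k_od a)).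
split=> [C [->|->]|H [_ H0 HD HN] HS C]; first by rewrite TO; apply/onto; exists (-1, 1).
  by rewrite T1; apply/onto; exists (0, 1).
case/onto=> u ->; move: u; apply: int_Z2_closed => [|u v hu hv|u hu||].
- by rewrite -T0.
- by rewrite add; apply: HD.
- apply: HN hu _ _; first by apply/onto; exists (- u).
  by rewrite -add subrr T0.
- by apply: HS; left.
- by apply: HS; right.
Qed.

End Picard.

(** * Detecting subalgebras *)

Section EvenPart.
Variable k : fieldType.
Implicit Types g h : lieSuper k.

Definition even_central g := forall t x, t \in gr g false -> br g t x = 0.

Definition even_squares g := exists2 vs : seq g, {subset vs <= gr g true} &
  (gr g false <= <<[seq br g v v | v <- vs]>>)%VS.

Lemma lie_iso_even g h : lie_iso g h -> even_central h /\ even_squares h ->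
  even_central g /\ even_squares g.
Proof.
move=> [f [f0 f1 fgr fbr]] [ch [vs vso vss]].
have inj u v : f u = f v -> u = v by apply: lker0P; rewrite f0.
split=> [t x ht|]; first by apply: inj; rewrite fbr linear0 ch // fgr.
have fK v : f (f^-1%VF v) = v by apply: limg_lfunVK; rewrite f1 memvf.
exists [seq f^-1%VF v | v <- vs].
  move=> _ /mapP[v vvs ->]; set u := f^-1%VF v.
  have fu : f u \in gr h true by rewrite fK vso.
  suff u0 : prj g false u = 0 by rewrite -(prj_add u) u0 add0r memv_prj.
  apply: inj; rewrite linear0; apply/eqP; rewrite -memv0 -(gr_cap h) memv_cap fgr ?memv_prj //=.
  rewrite -[X in X \in _](addrK (f (prj g true u))) -linearD /= prj_add.
  by rewrite memvB // fgr // memv_prj.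
apply/subvP => t ht; have := subvP vss _ (fgr _ _ ht).
suff -> : <<[seq br h v v | v <- vs]>>%VS = (f @: <<[seq br g v v | v <- [seq f^-1%VF v | v <- vs]]>>)%VS.
  by case/memv_imgP => u hu /inj ->.
rewrite limg_span; congr <<_>>%VS; rewrite -!map_comp; apply: eq_map => v /=.
by rewrite fbr !fK.
Qed.

Lemma lie_pow_even n g : even_central g /\ even_squares g ->
  even_central (lie_pow n g) /\ even_squares (lie_pow n g).
Proof.
move=> [cg [vs vso vss]]; split=> [t x /pow_grP ht|].
  by rewrite [LHS]pow_brE; apply/ffunP => i; rewrite !ffunE cg.
pose sg (i : 'I_n) (v : g) : {ffun 'I_n -> g} := [ffun j => if j == i then v else 0].
pose s i : 'Hom(g, lie_pow n g) := linfun (sg i).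
have sE i v : s i v = sg i v.
  by rewrite /s linfun_lin // => c x y; apply/ffunP => j; rewrite !ffunE; case: eqP; rewrite ?scaler0 ?addr0.
exists [seq s i v | i <- enum 'I_n, v <- vs].
  move=> _ /allpairsP[[i v] /= [_ hv ->]]; rewrite sE; apply/pow_grP => j; rewrite ffunE.
  by case: eqP; rewrite ?mem0v // vso.
apply/subvP => u /pow_grP hu; have -> : u = \sum_i s i (u i).
  apply/ffunP => j; rewrite sum_ffunE (bigD1 j) //= sE ffunE eqxx big1 ?addr0 // => i ij.
  by rewrite sE ffunE eq_sym (negPf ij).
apply: memv_suml => i _; have : s i (u i) \in (s i @: <<[seq br g v v | v <- vs]>>)%VS.
  exact: memv_img (subvP vss _ (hu i)).
rewrite limg_span; apply/subvP/span_subvP => _ /mapP[_ /mapP[v vvs ->] ->].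
apply: memv_span; apply/mapP; exists (s i v); first by apply: allpairs_f; rewrite ?mem_enum.
rewrite [RHS]pow_brE; apply/ffunP => j; rewrite !sE !ffunE.
by case: eqP => // _; rewrite linear0.
Qed.

Hypothesis two_neq0 : (2%:R : k) != 0.

Lemma q1_even : even_central (q1 k) /\ even_squares (q1 k).
Proof.
split=> [t x /pair_grE -> |].
  by rewrite [LHS]q1_brE /q1_br_fun /= mul0r mul0rn.
exists [:: ((0, 1) : (k^o * k^o)%type) : q1 k] => [v|].
  by rewrite inE => /eqP ->; apply/(limg_projP (@pair_proj_comp _ _ _)); rewrite pair_projE.
apply/subvP => t /pair_grE ->; rewrite span_seq1 [br _ _ _]q1_brE /q1_br_fun /=.
apply/vlineP; exists (t.1 / 2%:R); congr (_, _); rewrite /= ?scaler0 //.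
by rewrite mulr1 /GRing.scale /= mulfVK.
Qed.

Lemma sl11_even : even_central (sl11 k) /\ even_squares (sl11 k).
Proof.
split=> [t x /pair_grE -> |].
  by rewrite [LHS]sl11_brE /sl11_br_fun /= !mul0r addr0.
exists [:: ((0, (1, 1)) : (k^o * (k^o * k^o))%type) : sl11 k] => [v|].
  by rewrite inE => /eqP ->; apply/(limg_projP (@pair_proj_comp _ _ _)); rewrite pair_projE.
apply/subvP => t /pair_grE ->; rewrite span_seq1 [br _ _ _]sl11_brE /sl11_br_fun /=.
apply/vlineP; exists (t.1 / 2%:R); congr (_, _); rewrite /= ?scaler0 //.
by rewrite mulr1 /GRing.scale /= mulfVK.
Qed.

Lemma detecting_even g : detecting g -> even_central g /\ even_squares g.
Proof.
case=> -[n gn]; apply: (lie_iso_even gn); apply: lie_pow_even.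
  exact: q1_even.
exact: sl11_even.
Qed.
End EvenPart.

Theorem theorem6p3 (k : closedFieldType) (chark0 : [pchar k] =i pred0)
    (r : nat) (a : lieSuper k) (deta : detecting a) (rka : rank a = r)
    (r_ge2 : (2 <= r)%N) :
  (exists psi : int * 'Z_2 -> smod a -> Prop, T_isomorphism psi) /\
  (exists Om : smod a, is_Omega1 (k_ev a) Om) /\
  (forall Om : smod a, is_Omega1 (k_ev a) Om ->
     T_generated_by (fun C => C = stable_class Om \/
                              C = stable_class (k_od a))).
Proof.
have two_neq0 : (2%:R : k) != 0 by apply/negP => h; have := chark0 2%N; rewrite !inE /= h.
have [central squares] := detecting_even two_neq0 deta.
have rank2 : (2 <= \dim (gr a true))%N by rewrite -/(rank a) rka.
have [x0 hx0 nx0] : exists2 x0, x0 \in gr a true & x0 != 0.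
  exists (vpick (gr a true)); first exact: memv_pick.
  by rewrite vpick0 -dimv_eq0 -lt0n ltnW.
split; [|split].
- by exists (inv_class x0); apply: inv_class_iso.
- exact: omega_exists.
- by move=> Om; apply: inv_class_generated hx0 nx0 _ => //.
Qed.
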